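(* Let $R$ be an admissible ring. If $\mathcal{E},\mathcal{F}\in\mathfrak{R}_R$ are such that $\mathcal{E}\subseteq\mathcal{F}$, then $$\ell_R(\mathcal{F}/\mathcal{E})=d(\Gamma_{\mathcal{F}}\backslash\Gamma_{\mathcal{E}}),$$ where $\ell_R$ denotes the length of an $R$-module.
   Context: Rings: all rings are commutative and unitary. A one-dimensional Noetherian ring $R$ is Cohen–Macaulay if $\operatorname{depth}(R_{\mathfrak m})=1$ for all maximal ideals $\mathfrak m$. $Q_R$ is the total ring of fractions of $R$, $Q_R^{\mathrm{reg}}$ the set of its regular elements, $T^{\mathrm{reg}}:=T\cap Q_R^{\mathrm{reg}}$ for $T\subseteq Q_R$, and $\overline{R}$ the integral closure of $R$ in $Q_R$. A fractional ideal of $R$ is an $R$-submodule $\mathcal{E}\subseteq Q_R$ with $r\mathcal{E}\subseteq R$ for some $r\in R^{\mathrm{reg}}$; it is regular if $\mathcal{E}^{\mathrm{reg}}\ne\emptyset$. $\mathfrak{R}_R$ is the set of regular fractional ideals. Values: let $R$ be a one-dimensional semilocal Cohen–Macaulay ring. $\mathfrak{V}_R$ is the set of valuation rings of $Q_R$ over $R$, i.e. subrings $V$ with $R\subseteq V\subsetneq Q_R$ such that $Q_R\setminus V$ is multiplicatively closed. This set is finite and nonempty; each $V\in\mathfrak{V}_R$ is a discrete valuation ring in the sense that it has a unique regular maximal ideal $\mathfrak{m}_V$, which is invertible and is the only regular prime ideal of $V$. The associated discrete valuation $\nu_V\colon Q_R\to\mathbb{Z}\cup\{\infty\}$ is $\nu_V(x)=\max\{k\in\mathbb{Z}\mid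 x\in\mathfrak{m}_V^k\}$, with $\nu_V(x)=\infty$ if $x\in\bigcap_k\mathfrak{m}_V^k$. Set $\nu=(\nu_V)_{V\in\mathfrak{V}_R}$ and, for $\mathcal{E}\in\mathfrak{R}_R$, $\Gamma_{\mathcal{E}}:=\nu(\mathcal{E}^{\mathrm{reg}})\subseteq\mathbb{Z}^{\mathfrak{V}_R}$. $R$ is admissible if it is a one-dimensional semilocal Cohen–Macaulay ring that is analytically reduced (its completion $\widehat{R}$ at the Jacobson radical is reduced), residually rational ($\overline{R}/\mathfrak{n}=R/(\mathfrak{n}\cap R)$ for all maximal ideals $\mathfrak{n}$ of $\overline{R}$) and has large residue fields ($|R/\mathfrak{m}|\ge|\mathfrak{V}_{R_{\mathfrak{m}}}|$ for all maximal ideals $\mathfrak{m}$ of $R$). For admissible $R$, $\Gamma_R$ is a good semigroup with $D_{\Gamma_R}=\mathbb{Z}^{\mathfrak{V}_R}$, $\overline{\Gamma_R}=\mathbb{N}^{\mathfrak{V}_R}$, and each $\Gamma_{\mathcal{E}}$, $\mathcal{E}\in\mathfrak{R}_R$, is a good semigroup ideal of $\Gamma_R$, in the following terminology. Semigroups: $\mathbb{N}=\{0,1,2,\dots\}$. For a finite set $I$, $\mathbb{Z}^I$ carries the componentwise partial order and minimum; $\alpha<\beta$ means $\alpha\le\beta$, $\alpha\ne\beta$. For $E\subseteq\mathbb{Z}^I$ consider: (E0) there is $\alpha\in\mathbb{Z}^I$ with $\alpha+\mathbb{N}^I\subseteq E$; (E1) $\alpha,\beta\in E$ implies $\min\{\alpha,\beta\}\in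 E$; (E2) for $\alpha,\beta\in E$ and $j\in I$ with $\alpha_j=\beta_j$ there is $\varepsilon\in E$ with $\varepsilon_j>\alpha_j$ and $\varepsilon_i\ge\min\{\alpha_i,\beta_i\}$ for all $i\neq j$, with equality if $\alpha_i\ne\beta_i$. For $E,F\subseteq\mathbb{Z}^I$, $E-F:=\{\alpha\in\mathbb{Z}^I\mid\alpha+F\subseteq E\}$. A good semigroup is (up to isomorphism) a submonoid $S\subseteq\overline{S}:=\mathbb{N}^I$ with group of differences $D_S=\mathbb{Z}^I$ satisfying (E0), (E1), (E2). A semigroup ideal of $S$ is a nonempty $E\subseteq D_S$ with $E+S\subseteq E$ and $\alpha+E\subseteq S$ for some $\alpha\in S$; it is good if it satisfies (E1) and (E2). For $E$ satisfying (E1), $\mu^E:=\min E$ and $\gamma^E:=\min(E-\overline{S})$. Distance: a chain $\alpha=\alpha^{(0)}<\dots<\alpha^{(n)}=\beta$ in $E$ is saturated of length $n$ if no element of $E$ lies strictly between $\alpha^{(i)}$ and $\alpha^{(i+1)}$ for any $i$. In a good semigroup ideal $E$ any two saturated chains with the same endpoints $\alpha\le\beta$ in $E$ have the same length (a result of D'Anna), denoted $d_E(\alpha,\beta)$. For good semigroup ideals $E\subseteq F$ of $S$, the distance is $d(F\backslash E):=d_F(\mu^F,\gamma^E)-d_E(\mu^E,\gamma^E)$. *)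

(* Defs.v *)
From HB Require Import structures.
From mathcomp Require Import all_boot all_order all_algebra generic_quotient.
From mathcomp Require Import ring.
From mathcomp Require Import boolp classical_sets functions cardinality.
From mathcomp Require Import constructive_ereal.

Set Implicit Arguments.
Unset Strict Implicit.
Unset Printing Implicit Defensive.

Import Order.TTheory GRing.Theory Num.Theory.
Local Open Scope classical_set_scope.
Local Open Scope ring_scope.
Local Open Scope quotient_scope.

Definition chain (T : Type) (r : T -> T -> Prop) (A : set T) (n : nat)
    (c : nat -> T) : Prop :=
  (forall i, (i <= n)%N -> A (c i)) /\ (forall i, (i < n)%N -> r (c i) (c i.+1)).

(* The supremum of a set of natural numbers in [Z] extended by [-oo], [+oo];
   it is [-oo] on the empty set. *)
Definition nat_sup (A : set nat) : \bar int :=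
  supremum -oo%E [set (n%:Z)%:E | n in A].

(* [x0] is a default value, only returned when there is no minimum (maximum). *)
Definition minimum d (T : porderType d) (x0 : T) (A : set T) : T :=
  xget x0 (A `&` lbound A).
Definition maximum d (T : porderType d) (x0 : T) (A : set T) : T :=
  xget x0 (A `&` ubound A).

(* Submodules and ideals are taken relative to a subring [A] of [T], so that
   they apply both to a ring ([A = setT]) and to the subrings of its total ring
   of fractions. *)

Section Ideals.
Variable T : comNzRingType.
Implicit Types A I J : set T.

Definition regular : set T := [set x | GRing.lreg x].

Definition submod_in A I : Prop :=
  [/\ I 0, (forall x y, I x -> I y -> I (x + y))
    & forall a x, A a -> I x -> I (a * x)].

Definition ideal_in A I : Prop := submod_in A I /\ I `<=` A.

Definition prime_in A P : Prop :=
  [/\ ideal_in A P, P `<` A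
    & forall x y, A x -> A y -> P (x * y) -> P x \/ P y].

Definition maximal_in A m : Prop :=
  [/\ ideal_in A m, m `<` A
    & forall J, ideal_in A J -> m `<=` J -> J = m \/ J = A].

Definition span_in A (X : set T) : set T := smallest (submod_in A) X.

Definition prod_in A I J : set T :=
  span_in A [set z | exists x y, [/\ I x, J y & z = x * y]].

Definition pow_in A I (n : nat) : set T := iter n (prod_in A I) A.

Definition inv_in A I : set T := [set x | forall y, I y -> A (x * y)].

(* Negative powers are powers of the inverse [A : I]. *)
Definition zpow_in A I (k : int) : set T :=
  match k with
  | Posz n => pow_in A I n
  | Negz n => pow_in A (inv_in A I) n.+1
  end.

Definition jacobson : set T :=
  \bigcap_(m in [set m | maximal_in setT m]) m.

Definition noetherian : Prop :=
  forall I, ideal_in setT I -> exists s : seq T, I = span_in setT [set` s].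

Definition krull_dim : \bar int :=
  nat_sup [set n | exists c : nat -> set T,
    chain (fun P P' => P `<` P') [set P | prime_in setT P] n c].

Definition semilocal : Prop := finite_set [set m : set T | maximal_in setT m].

(* Each [s`_i] is a nonzerodivisor on [T / (s`_0, ..., s`_(i-1))], and
   [T / (s)] is nonzero. *)
Definition regular_seq (s : seq T) : Prop :=
  (forall i y, (i < size s)%N ->
     span_in setT [set` take i s] (s`_i * y) -> span_in setT [set` take i s] y)
  /\ span_in setT [set` s] <> setT.

(* Only meant for local rings, whose maximal ideal is the Jacobson radical. *)
Definition local_depth : \bar int :=
  nat_sup [set n | exists s : seq T,
    [/\ size s = n, (forall x, x \in s -> jacobson x) & regular_seq s]].

End Ideals.

Record ideal (R : comNzRingType) := Ideal {
  ideal_set :> set R;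
  idealP : ideal_in setT ideal_set }.

Record maxideal (R : comNzRingType) := MaxIdeal {
  maxideal_set :> set R;
  maxidealP : maximal_in setT maxideal_set }.

Lemma pow_ideal_in (R : comNzRingType) (I : set R) n :
  ideal_in setT (pow_in setT I n).
Proof.
split=> //; case: n => [|n] //; rewrite /pow_in iterS; split.
- by move=> M [[]].
- by move=> x y xI yI M MI; case: (MI) => -[_ MD _] _; apply: MD; [apply: xI|apply: yI].
- by move=> a x _ xI M MI; case: (MI) => -[_ _ MM] _; apply: MM => //; apply: xI.
Qed.

Definition ideal_exp (R : comNzRingType) (I : set R) n : ideal R :=
  Ideal (pow_ideal_in I n).

Definition ideal_of_max (R : comNzRingType) (m : maxideal R) : ideal R :=
  Ideal (let: And3 h _ _ := maxidealP m in h).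

Section QuotientRing.
Variables (R : comNzRingType) (I : ideal R).

Definition ideal_pred : {pred R} := fun x => x \in (I : set R).

Lemma ideal_predP x : reflect ((I : set R) x) (x \in ideal_pred).
Proof. by apply: (iffP idP); [exact: set_mem | exact: mem_set]. Qed.

Lemma ideal_pred_zmod : zmod_closed ideal_pred.
Proof.
have [[I0 ID IM] _] := idealP I; split; first exact/ideal_predP.
move=> x y /ideal_predP xI /ideal_predP yI; apply/ideal_predP/ID => //.
by rewrite -mulN1r; apply: IM.
Qed.

HB.instance Definition _ := GRing.isZmodClosed.Build R ideal_pred ideal_pred_zmod.

Definition quotring : Type := Quotient.quot ideal_pred.

HB.instance Definition _ := GRing.Zmodule.on quotring.
HB.instance Definition _ := EqQuotient.on quotring.

Definition to_quotring (x : R) : quotring := \pi x.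

Lemma quotring_eqP (x y : R) :
  reflect ((I : set R) (x - y)) (to_quotring x == to_quotring y).
Proof. by rewrite /to_quotring /quotring piE Quotient.equivE; apply: ideal_predP. Qed.

Let repr_quot (x : R) : (I : set R) (repr (to_quotring x) - x).
Proof. by apply/quotring_eqP; rewrite /to_quotring reprK. Qed.

Lemma to_quotring_is_zmod : zmod_morphism to_quotring.
Proof. by move=> x y; rewrite /to_quotring /quotring !piE. Qed.

HB.instance Definition _ :=
  GRing.isZmodMorphism.Build R quotring to_quotring to_quotring_is_zmod.

Definition quotring_one : quotring := to_quotring 1.
Definition quotring_mul (x y : quotring) : quotring :=
  to_quotring (repr x * repr y).

Lemma to_quotringM x y :
  quotring_mul (to_quotring x) (to_quotring y) = to_quotring (x * y).
Proof.
have [[_ ID IM] _] := idealP I.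
apply/eqP/quotring_eqP; set a := repr _; set b := repr _.
have -> : a * b - x * y = b * (a - x) + x * (b - y) by ring.
by apply: ID; apply: IM => //; apply: repr_quot.
Qed.

Let to_quotring_reprK (x : quotring) : to_quotring (repr x) = x.
Proof. exact: reprK. Qed.

Lemma quotring_mulA : associative quotring_mul.
Proof.
move=> x y z; rewrite -[x]to_quotring_reprK -[y]to_quotring_reprK.
by rewrite -[z]to_quotring_reprK !to_quotringM mulrA.
Qed.

Lemma quotring_mulC : commutative quotring_mul.
Proof. by move=> x y; rewrite /quotring_mul mulrC. Qed.

Lemma quotring_mul1 : left_id quotring_one quotring_mul.
Proof. by move=> x; rewrite -[x]to_quotring_reprK to_quotringM mul1r. Qed.

Lemma quotring_mulDl : left_distributive quotring_mul +%R.
Proof.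
move=> x y z; rewrite -[x]to_quotring_reprK -[y]to_quotring_reprK.
by rewrite -[z]to_quotring_reprK -raddfD !to_quotringM -raddfD mulrDl.
Qed.

HB.instance Definition _ := GRing.Zmodule_isComPzRing.Build quotring
  quotring_mulA quotring_mulC quotring_mul1 quotring_mulDl.

Lemma to_quotring_is_monoid : monoid_morphism to_quotring.
Proof. by split=> // x y; rewrite -to_quotringM. Qed.

HB.instance Definition _ :=
  GRing.isMonoidMorphism.Build R quotring to_quotring to_quotring_is_monoid.

End QuotientRing.

Record submod (R : pzRingType) (V : lmodType R) := Submod {
  submod_set :> set V;
  submodP : GRing.submod_closed [in submod_set] }.

Section QuotientModule.
Variables (R : pzRingType) (V : lmodType R) (N : submod V).

Definition submod_pred : {pred V} := fun x => x \in (N : set V).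

Lemma submod_pred_zmod : zmod_closed submod_pred.
Proof. exact: GRing.submod_closedB (submodP N). Qed.

HB.instance Definition _ :=
  GRing.isZmodClosed.Build V submod_pred submod_pred_zmod.

Definition quotmod : Type := Quotient.quot submod_pred.

HB.instance Definition _ := GRing.Zmodule.on quotmod.
HB.instance Definition _ := EqQuotient.on quotmod.

Definition to_quotmod (x : V) : quotmod := \pi x.

Lemma quotmod_eqP (x y : V) :
  reflect ((N : set V) (x - y)) (to_quotmod x == to_quotmod y).
Proof.
rewrite /to_quotmod /quotmod piE Quotient.equivE.
by apply: (iffP idP); [exact: set_mem | exact: mem_set].
Qed.

Lemma to_quotmod_is_zmod : zmod_morphism to_quotmod.
Proof. by move=> x y; rewrite /to_quotmod /quotmod !piE. Qed.

HB.instance Definition _ :=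
  GRing.isZmodMorphism.Build V quotmod to_quotmod to_quotmod_is_zmod.

Definition quotmod_scale (a : R) (x : quotmod) : quotmod :=
  to_quotmod (a *: repr x).

Lemma to_quotmodZ a x : quotmod_scale a (to_quotmod x) = to_quotmod (a *: x).
Proof.
apply/eqP/quotmod_eqP; rewrite -scalerBr; apply: set_mem.
have [N0 Nlin] := submodP N; rewrite -[X in X \in _]addr0.
apply: Nlin => //; apply: mem_set; apply/quotmod_eqP.
by rewrite /to_quotmod reprK.
Qed.

Let to_quotmod_reprK (x : quotmod) : to_quotmod (repr x) = x.
Proof. exact: reprK. Qed.

Lemma quotmod_scaleA a b x :
  quotmod_scale a (quotmod_scale b x) = quotmod_scale (a * b) x.
Proof. by rewrite -[x]to_quotmod_reprK !to_quotmodZ scalerA. Qed.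

Lemma quotmod_scale1 : left_id 1 quotmod_scale.
Proof. by move=> x; rewrite -[x]to_quotmod_reprK to_quotmodZ scale1r. Qed.

Lemma quotmod_scaleDr : right_distributive quotmod_scale +%R.
Proof.
move=> a x y; rewrite -[x]to_quotmod_reprK -[y]to_quotmod_reprK.
by rewrite -raddfD !to_quotmodZ scalerDr raddfD.
Qed.

Lemma quotmod_scaleDl x :
  {morph quotmod_scale^~ x : a b / a + b}.
Proof.
by move=> a b; rewrite -[x]to_quotmod_reprK !to_quotmodZ scalerDl raddfD.
Qed.

HB.instance Definition _ := GRing.Zmodule_isLmodule.Build R quotmod
  quotmod_scaleA quotmod_scale1 quotmod_scaleDr quotmod_scaleDl.

End QuotientModule.

(* [M / N] as a submodule of [V / N]; meant for [N `<=` M]. *)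
Definition subquot (R : pzRingType) (V : lmodType R) (M N : submod V) :
    set (quotmod N) :=
  [set to_quotmod N x | x in M : set V].
Arguments subquot {R V} M N.

(* The length of a submodule [M] of [V], as a module in its own right: its
   submodules are the submodules of [V] contained in [M]. *)
Definition mod_length (R : pzRingType) (V : lmodType R) (M : set V) : \bar int :=
  nat_sup [set n | exists c : nat -> set V,
    chain (fun N N' => N `<` N')
      [set N : set V | GRing.submod_closed [in N] /\ N `<=` M] n c].

Section Completion.
Variables (R : comNzRingType) (I : set R).

(* The inverse limit of the [R / I ^ n]: [componentP] states that [component n]
   is the image of [component n.+1]. *)
Record completion := Completion {
  component : forall n, quotring (ideal_exp I n);
  componentP : forall n (r : R), component n.+1 = to_quotring _ r ->
    component n = to_quotring _ r }.

Lemma completionP (x y : completion) :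
  (forall n, component x n = component y n) -> x = y.
Proof.
case: x y => x xP [y yP] /= xy; have {}xy : x = y by exact: functional_extensionality_dep.
by case: y / xy yP => yP; congr Completion; exact: Prop_irrelevance.
Qed.

HB.instance Definition _ := gen_eqMixin completion.
HB.instance Definition _ := gen_choiceMixin completion.

Let to_quotringK n (x : quotring (ideal_exp I n)) : exists r, x = to_quotring _ r.
Proof. by exists (repr x); rewrite /to_quotring reprK. Qed.

Lemma ideal_expSS n x : (ideal_exp I n.+1 : set R) x -> (ideal_exp I n : set R) x.
Proof.
have [[_ _ M] _] := pow_ideal_in I n.
move=> h; apply: (h (pow_in setT I n)); split; first by case: (pow_ideal_in I n).
by move=> _ [a [b [_ bI ->]]]; apply: M.
Qed.

Lemma coherent_repr n (a b : R) :
  to_quotring (ideal_exp I n.+1) a = to_quotring _ b ->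
  to_quotring (ideal_exp I n) a = to_quotring _ b.
Proof.
by move=> /eqP /quotring_eqP ab; apply/eqP/quotring_eqP; exact: ideal_expSS.
Qed.

Let coherent_opp (x : completion) n r : - component x n.+1 = to_quotring _ r ->
  - component x n = to_quotring _ r.
Proof.
have [a xa] := to_quotringK (component x n.+1).
by rewrite (componentP xa) xa -!raddfN; exact: coherent_repr.
Qed.

Let coherent_add (x y : completion) n r :
  component x n.+1 + component y n.+1 = to_quotring _ r ->
  component x n + component y n = to_quotring _ r.
Proof.
have [a xa] := to_quotringK (component x n.+1).
have [b yb] := to_quotringK (component y n.+1).
by rewrite (componentP xa) (componentP yb) xa yb -!raddfD; exact: coherent_repr.
Qed.

Let coherent_mul (x y : completion) n r :
  component x n.+1 * component y n.+1 = to_quotring _ r ->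
  component x n * component y n = to_quotring _ r.
Proof.
have [a xa] := to_quotringK (component x n.+1).
have [b yb] := to_quotringK (component y n.+1).
by rewrite (componentP xa) (componentP yb) xa yb -!rmorphM; exact: coherent_repr.
Qed.

Definition to_completion (a : R) := Completion (fun n => @coherent_repr n a).
Definition completion_opp x := Completion (@coherent_opp x).
Definition completion_add x y := Completion (@coherent_add x y).
Definition completion_mul x y := Completion (@coherent_mul x y).

Lemma completion_addA : associative completion_add.
Proof. by move=> x y z; apply: completionP => n; exact: addrA. Qed.
Lemma completion_addC : commutative completion_add.
Proof. by move=> x y; apply: completionP => n; exact: addrC. Qed.
Lemma completion_add0 : left_id (to_completion 0) completion_add.
Proof. by move=> x; apply: completionP => n; rewrite /= raddf0 add0r. Qed.
Lemma completion_addN : left_inverse (to_completion 0) completion_opp completion_add.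
Proof. by move=> x; apply: completionP => n; rewrite /= raddf0 addNr. Qed.

HB.instance Definition _ := GRing.isZmodule.Build completion
  completion_addA completion_addC completion_add0 completion_addN.

Lemma completion_mulA : associative completion_mul.
Proof. by move=> x y z; apply: completionP => n; exact: mulrA. Qed.
Lemma completion_mulC : commutative completion_mul.
Proof. by move=> x y; apply: completionP => n; exact: mulrC. Qed.
Lemma completion_mul1 : left_id (to_completion 1) completion_mul.
Proof. by move=> x; apply: completionP => n; rewrite /= rmorph1 mul1r. Qed.
Lemma completion_mulDl : left_distributive completion_mul +%R.
Proof. by move=> x y z; apply: completionP => n; exact: mulrDl. Qed.

HB.instance Definition _ := GRing.Zmodule_isComPzRing.Build completion
  completion_mulA completion_mulC completion_mul1 completion_mulDl.

End Completion.

Definition reduced (A : pzRingType) : Prop :=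
  forall (x : A) n, x ^+ n = 0 -> x = 0.

Record mulset (R : comNzRingType) := MulSet {
  mulset_set :> set R;
  mulset1 : mulset_set 1;
  mulsetM : forall x y, mulset_set x -> mulset_set y -> mulset_set (x * y);
  mulset_neq0 : ~ mulset_set 0 }.

Section Localization.
Variables (R : comNzRingType) (S : mulset R).

Definition fraction : Type := (R * {s : R | s \in (S : set R)})%type.
HB.instance Definition _ := Choice.on fraction.
Implicit Types x y z : fraction.

Let den x : R := val x.2.

Let denP x : (S : set R) (den x).
Proof. exact: set_mem (valP x.2). Qed.

Definition frac_equiv x y : bool :=
  `[< exists2 t, (S : set R) t & t * (x.1 * val y.2 - y.1 * val x.2) = 0 >].

Lemma frac_equiv_refl : reflexive frac_equiv.
Proof.
by move=> x; apply/asboolP; exists 1; [exact: mulset1 | rewrite subrr mulr0].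
Qed.

Lemma frac_equiv_sym : symmetric frac_equiv.
Proof.
move=> x y; apply/asboolP/asboolP => -[t tS E]; exists t => //;
by apply/eqP; rewrite -oppr_eq0 -mulrN opprB E.
Qed.

Lemma frac_equiv_trans : transitive frac_equiv.
Proof.
move=> y x z /asboolP[t tS E] /asboolP[u uS F]; apply/asboolP.
exists (t * u * den y); first by do 2?[apply: mulsetM] => //; exact: denP.
rewrite -/(den x) -/(den y) -/(den z) in E F *.
transitivity (u * den z * (t * (x.1 * den y - y.1 * den x))
              + t * den x * (u * (y.1 * den z - z.1 * den y))); first by ring.
by rewrite E F !mulr0 addr0.
Qed.

Canonical frac_equiv_equiv :=
  EquivRel frac_equiv frac_equiv_refl frac_equiv_sym frac_equiv_trans.

Definition loc : Type := {eq_quot frac_equiv}.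
HB.instance Definition _ : EqQuotient _ frac_equiv loc := EqQuotient.on loc.
HB.instance Definition _ := Choice.on loc.

Definition mkfrac (a s : R) (sS : (S : set R) s) : loc :=
  \pi_loc (a, exist _ s (mem_set sS)).

Lemma mkfrac_eq a s sS b u uS :
  @mkfrac a s sS = @mkfrac b u uS <->
  exists2 t, (S : set R) t & t * (a * u - b * s) = 0.
Proof.
rewrite /mkfrac; split; first by move/eqmodP => /asboolP.
by move=> h; apply/eqmodP/asboolP.
Qed.

Lemma mkfrac_surj (q : loc) : exists a s sS, q = @mkfrac a s sS.
Proof.
elim/quotW: q => -[a [s sS]]; exists a, s, (set_mem sS).
by rewrite /mkfrac (bool_irrelevance (mem_set _) sS).
Qed.

Definition loc_of (a : R) : loc := mkfrac a (mulset1 S).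

Let num (q : loc) : R := (repr q).1.
Let dnm (q : loc) : R := den (repr q).
Let dnmP q : (S : set R) (dnm q). Proof. exact: denP. Qed.

Let repr_mkfrac a s sS :
  exists2 t, (S : set R) t
    & t * num (@mkfrac a s sS) * s = t * a * dnm (@mkfrac a s sS).
Proof.
have : mkfrac (num (@mkfrac a s sS)) (dnmP (@mkfrac a s sS)) = @mkfrac a s sS.
  rewrite -[RHS]reprK /mkfrac; congr \pi.
  by apply/eqP; rewrite -pair_eqE /= eqxx; apply/eqP/val_inj.
by case/mkfrac_eq => t tS /eqP; rewrite mulrBr subr_eq0 !mulrA => /eqP; exists t.
Qed.

Definition loc_opp (q : loc) : loc := mkfrac (- num q) (dnmP q).
Definition loc_add (p q : loc) : loc :=
  mkfrac (num p * dnm q + num q * dnm p) (mulsetM (dnmP p) (dnmP q)).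
Definition loc_mul (p q : loc) : loc :=
  mkfrac (num p * num q) (mulsetM (dnmP p) (dnmP q)).

Lemma mkfracN a s sS : loc_opp (@mkfrac a s sS) = mkfrac (- a) sS.
Proof.
have [t tS E] := repr_mkfrac a sS; apply/mkfrac_eq; exists t => //.
by move: E; move: (num _) (dnm _) => n d E; ring: E.
Qed.

Lemma mkfracD a s sS b u uS :
  loc_add (@mkfrac a s sS) (@mkfrac b u uS)
  = mkfrac (a * u + b * s) (mulsetM sS uS).
Proof.
have [t tS E] := repr_mkfrac a sS; have [t' t'S E'] := repr_mkfrac b uS.
apply/mkfrac_eq; exists (t * t'); first exact: mulsetM.
by move: E E'; move: (num _) (dnm _) (num _) (dnm _) => n d n' d' E E'; ring: E E'.
Qed.

Lemma mkfracM a s sS b u uS :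
  loc_mul (@mkfrac a s sS) (@mkfrac b u uS) = mkfrac (a * b) (mulsetM sS uS).
Proof.
have [t tS E] := repr_mkfrac a sS; have [t' t'S E'] := repr_mkfrac b uS.
apply/mkfrac_eq; exists (t * t'); first exact: mulsetM.
by move: E E'; move: (num _) (dnm _) (num _) (dnm _) => n d n' d' E E'; ring: E E'.
Qed.

Lemma loc_addA : associative loc_add.
Proof.
move=> p q r; have [a [s [sS ->]]] := mkfrac_surj p.
have [b [u [uS ->]]] := mkfrac_surj q; have [c [v [vS ->]]] := mkfrac_surj r.
by rewrite !mkfracD; apply/mkfrac_eq; exists 1; [exact: mulset1 | ring].
Qed.

Lemma loc_addC : commutative loc_add.
Proof.
move=> p q; have [a [s [sS ->]]] := mkfrac_surj p.
have [b [u [uS ->]]] := mkfrac_surj q.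
by rewrite !mkfracD; apply/mkfrac_eq; exists 1; [exact: mulset1 | ring].
Qed.

Lemma loc_add0 : left_id (loc_of 0) loc_add.
Proof.
move=> p; have [a [s [sS ->]]] := mkfrac_surj p.
by rewrite mkfracD; apply/mkfrac_eq; exists 1; [exact: mulset1 | ring].
Qed.

Lemma loc_addN : left_inverse (loc_of 0) loc_opp loc_add.
Proof.
move=> p; have [a [s [sS ->]]] := mkfrac_surj p.
by rewrite mkfracN mkfracD; apply/mkfrac_eq; exists 1; [exact: mulset1 | ring].
Qed.

HB.instance Definition _ :=
  GRing.isZmodule.Build loc loc_addA loc_addC loc_add0 loc_addN.

Lemma loc_mulA : associative loc_mul.
Proof.
move=> p q r; have [a [s [sS ->]]] := mkfrac_surj p.
have [b [u [uS ->]]] := mkfrac_surj q; have [c [v [vS ->]]] := mkfrac_surj r.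
by rewrite !mkfracM; apply/mkfrac_eq; exists 1; [exact: mulset1 | ring].
Qed.

Lemma loc_mulC : commutative loc_mul.
Proof.
move=> p q; have [a [s [sS ->]]] := mkfrac_surj p.
have [b [u [uS ->]]] := mkfrac_surj q.
by rewrite !mkfracM; apply/mkfrac_eq; exists 1; [exact: mulset1 | ring].
Qed.

Lemma loc_mul1 : left_id (loc_of 1) loc_mul.
Proof.
move=> p; have [a [s [sS ->]]] := mkfrac_surj p.
by rewrite mkfracM; apply/mkfrac_eq; exists 1; [exact: mulset1 | ring].
Qed.

Lemma loc_mulDl : left_distributive loc_mul loc_add.
Proof.
move=> p q r; have [a [s [sS ->]]] := mkfrac_surj p.
have [b [u [uS ->]]] := mkfrac_surj q; have [c [v [vS ->]]] := mkfrac_surj r.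
rewrite mkfracD !mkfracM mkfracD.
by apply/mkfrac_eq; exists 1; [exact: mulset1 | ring].
Qed.

Lemma loc_1neq0 : loc_of 1 != loc_of 0.
Proof.
apply/eqP => /mkfrac_eq[t tS]; rewrite mul0r subr0 !mulr1 => t0.
by rewrite t0 in tS; exact: mulset_neq0 tS.
Qed.

HB.instance Definition _ := GRing.Zmodule_isComNzRing.Build loc
  loc_mulA loc_mulC loc_mul1 loc_mulDl loc_1neq0.

Lemma loc_of_is_zmod : zmod_morphism loc_of.
Proof.
move=> a b; rewrite -[RHS]/(loc_add _ (loc_opp _)) mkfracN mkfracD.
by apply/mkfrac_eq; exists 1; [exact: mulset1 | ring].
Qed.

Lemma loc_of_is_monoid : monoid_morphism loc_of.
Proof.
split=> // a b; rewrite -[RHS]/(loc_mul _ _) mkfracM.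
by apply/mkfrac_eq; exists 1; [exact: mulset1 | ring].
Qed.

HB.instance Definition _ :=
  GRing.isZmodMorphism.Build R loc loc_of loc_of_is_zmod.
HB.instance Definition _ :=
  GRing.isMonoidMorphism.Build R loc loc_of loc_of_is_monoid.

Definition loc_scale (a : R) (q : loc) : loc := loc_of a * q.

Lemma loc_scaleA a b q : loc_scale a (loc_scale b q) = loc_scale (a * b) q.
Proof. by rewrite /loc_scale mulrA rmorphM. Qed.
Lemma loc_scale1 : left_id 1 loc_scale.
Proof. by move=> q; rewrite /loc_scale rmorph1 mul1r. Qed.
Lemma loc_scaleDr : right_distributive loc_scale +%R.
Proof. by move=> a p q; exact: mulrDr. Qed.
Lemma loc_scaleDl q : {morph loc_scale^~ q : a b / a + b}.
Proof. by move=> a b; rewrite /loc_scale rmorphD mulrDl. Qed.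

HB.instance Definition _ := GRing.Zmodule_isLmodule.Build R loc
  loc_scaleA loc_scale1 loc_scaleDr loc_scaleDl.

End Localization.

Lemma regular_mul (R : comNzRingType) (x y : R) :
  regular x -> regular y -> regular (x * y).
Proof. exact: GRing.lregM. Qed.

Lemma regular_neq0 (R : comNzRingType) : ~ regular (0 : R).
Proof.
by move=> h; have /eqP := @h 1 0 (etrans (mul0r _) (esym (mul0r _))); rewrite oner_eq0.
Qed.

Definition regular_mulset (R : comNzRingType) : mulset R :=
  MulSet (@GRing.lreg1 R) (@regular_mul R) (@regular_neq0 R).

Lemma compl_max1 (R : comNzRingType) (m : maxideal R) : (~` (m : set R)) 1.
Proof.
have [[[_ _ M] _] [_ mT] _] := maxidealP m; move=> m1; apply: mT => x _.
by rewrite -[x]mulr1; exact: M.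
Qed.

Lemma compl_maxM (R : comNzRingType) (m : maxideal R) (x y : R) :
  (~` (m : set R)) x -> (~` (m : set R)) y -> (~` (m : set R)) (x * y).
Proof.
have [[[m0 D M] _] _ max] := maxidealP m; move=> mx my mxy.
pose J : set R := [set z | exists a b, (m : set R) a /\ z = a + b * x].
have Jid : ideal_in setT J.
  split=> //; split; first by exists 0, 0; rewrite mul0r addr0.
  - move=> _ _ [a [b [ma ->]]] [c [d [mc ->]]].
    by exists (a + c), (b + d); split; [exact: D | ring].
  - move=> e _ _ [a [b [ma ->]]].
    by exists (e * a), (e * b); split; [exact: M | ring].
have [|E|E] := max J Jid.
- by move=> a ma; exists a, 0; rewrite mul0r addr0.
- by apply: mx; rewrite -E; exists 0, 1; rewrite mul1r add0r.
have : J 1 by rewrite E.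
move=> [a [b [ma one]]]; apply: my.
have -> : y = y * a + b * (x * y) by rewrite -[y in LHS]mulr1 one; ring.
by apply: D; apply: M.
Qed.

Lemma compl_max0 (R : comNzRingType) (m : maxideal R) : ~ (~` (m : set R)) 0.
Proof. by have [[[m0 _ _] _] _ _] := maxidealP m; exact. Qed.

Definition compl_max (R : comNzRingType) (m : maxideal R) : mulset R :=
  MulSet (@compl_max1 R m) (@compl_maxM R m) (@compl_max0 R m).

Notation locmax m := (loc (compl_max m)).

Notation total_frac R := (loc (regular_mulset R)).

Section TotalFractions.
Variable R : comNzRingType.
Local Notation Q := (total_frac R).

Definition to_frac : R -> Q := @loc_of R (regular_mulset R).

Definition int_closure : set Q := [set x | integralOver to_frac x].

Definition valuation_rings : set (set Q) :=
  [set V : set Q | [/\ GRing.subring_closed [in V], range to_frac `<=` V, V `<` setT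
             & forall x y, ~ V x -> ~ V y -> ~ V (x * y)]].

(* The regular maximal ideal of a valuation ring is unique. *)
Definition val_ideal (V : set Q) : set Q :=
  xget set0 [set m | maximal_in V m /\ (m `&` @regular Q) !=set0].

(* The powers of [val_ideal V] decrease, so that the maximum exists unless [x]
   lies in all of them. *)
Definition valuation (V : set Q) (x : Q) : \bar int :=
  if `[< forall k, zpow_in V (val_ideal V) k x >] then +oo%E
  else (maximum 0 [set k : int | zpow_in V (val_ideal V) k x])%:E.

Definition value_set (E : set Q) : set (valuation_rings -> int) :=
  [set a | exists x, [/\ E x, regular x
             & forall V : valuation_rings, valuation (val V) x = (a V)%:E]].

Definition regular_fractional_ideal (E : submod Q) : Prop :=
  (exists2 r : R, regular r & forall x, (E : set Q) x -> range to_frac (r *: x))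
  /\ ((E : set Q) `&` @regular Q) !=set0.

End TotalFractions.

Record one_dim_semilocal_CM (R : comNzRingType) : Prop := {
  osc_noetherian : noetherian R;
  osc_dim : krull_dim R = 1%:E;
  osc_semilocal : semilocal R;
  osc_depth : forall m : maxideal R, local_depth (locmax m) = 1%:E }.

Record admissible (R : comNzRingType) : Prop := {
  adm_CM : one_dim_semilocal_CM R;
  adm_analytically_reduced : reduced (completion (@jacobson R));
  (* The canonical injection of residue fields is onto. *)
  adm_residually_rational :
    forall n : set (total_frac R), maximal_in (@int_closure R) n ->
    forall x, int_closure x -> exists r : R, n (x - to_frac r);
  adm_large_residue_fields :
    forall m : maxideal R,
    (@valuation_rings (locmax m) #<= [set: quotring (ideal_of_max m)])%card }.

Section Distance.
Variable I : Type.
Implicit Types (E F : set (I -> int)) (a b : I -> int).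

(* [E - F] in [Z ^ I]; in [gamma], [nonneg] is the ambient [N ^ I]. *)
Definition set_colon E F : set (I -> int) :=
  [set a | forall b, F b -> E (a + b)].

Definition nonneg : set (I -> int) := [set a | forall i, 0 <= a i].

Definition mu E : I -> int := minimum (fun=> 0) E.
Definition gamma E : I -> int := minimum (fun=> 0) (set_colon E nonneg).

Definition covers E a b : Prop :=
  (a < b)%O /\ forall e, E e -> ~ ((a < e)%O /\ (e < b)%O).

(* The length of any saturated chain from [a] to [b]; in a good semigroup
   ideal it does not depend on the chain. *)
Definition chain_dist E a b : nat :=
  xget 0%N [set n | exists c, [/\ chain (covers E) E n c, c 0%N = a & c n = b]].

Definition distance F E : int :=
  (chain_dist F (mu F) (gamma E))%:Z - (chain_dist E (mu E) (gamma E))%:Z.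

End Distance.

(* Main.v *)
(* Let [A] be the integral closure of [R] in its total ring of fractions.

   Analytic reducedness gives a conductor.  For a regular [x] in the Jacobson
   radical, R[y] / x R[y] has the same length [e] as R / x R for every integral
   [y], so that [y] satisfies a monic equation of degree [e].  Hence all elements
   of [x ^ n A] in [R] have [e]-th power in [x ^ n R].  If these contracted ideals
   were never contained in [x R], a Mittag-Leffler argument would produce a nonzero
   nilpotent element of the completion.

   With the conductor, [A] is a semilocal ring whose maximal ideals are principal,
   the valuation rings over [R] are its localizations, and every regular fraction
   is uniquely a unit of [A] times a monomial in the uniformizers.  Filter a
   fractional ideal [E] by E^a = { y in E | nu(y) >= a }.  If [b] covers [a] in the
   value set of [E], then E^a / E^b is simple: it is at most one-dimensional in each
   coordinate by residual rationality, and a second jump would give, after taking a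
   minimum with [b], a value strictly between [a] and [b].  The residue fields are
   large enough for minima of values to be values.  Saturated chains thus compute
   lengths, independently of the chain, and E^g is the same for [E] and [F] when
   [g] is the conductor of the values of [E]. *)

Require Import Defs.
From HB Require Import structures.
From mathcomp Require Import all_boot all_order all_algebra.
From mathcomp Require Import boolp classical_sets functions cardinality.
From mathcomp Require Import constructive_ereal.
From mathcomp Require Import zify ring.

Set Implicit Arguments.
Unset Strict Implicit.
Unset Printing Implicit Defensive.

Import Order.TTheory GRing.Theory Num.Theory.
Local Open Scope classical_set_scope.
Local Open Scope ring_scope.

(** * Chains of submodules and length *)

(** Two obstacles shape the proof. The total ring of fractions is in general not a field, so
    submodules contain zero divisors, whose valuations need not be finite. Reducedness descends from
    the completion to [R] and gives every fraction [y] the form [y * y * z]; an element of a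
    submodule can then be corrected, deep in the filtration, to a unit lying in the same steps. And
    before the conductor exists, integral elements have no common denominator: only because the
    exponent [e] is the same for all of them does an infinite sequence of approximations give one
    nilpotent element of the completion.

    The hypothesis on residue fields counts valuation rings over the localization at [m], so those
    over [R] centred at [m] have to be mapped injectively to them. As many residue classes as
    valuation rings are enough, because the projective line has one point more than the residue
    field.

    Lengths are a relation on chains of subsets of one ambient ring. Modules over [R] and ideals of
    the integral closure are thus compared without forming quotients, and a bound on chains also
    serves as a descending chain condition. *)

Definition is_subring (T : comNzRingType) (A : set T) : Prop :=
  [/\ A 1, forall x y, A x -> A y -> A (x - y) & forall x y, A x -> A y -> A (x * y)].

Lemma subringT (T : comNzRingType) : is_subring [set: T].
Proof. by []. Qed.

Section SubmodTheory.
Variables (T : comNzRingType) (A : set T).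
Implicit Types (L M N X Y Z : set T) (x y z : T).

Definition mscale x M : set T := [set z | exists2 y, M y & z = x * y].
Definition madd M N : set T := [set z | exists y w, [/\ M y, N w & z = y + w]].

Hypothesis sA : is_subring A.

Lemma subring1 : A 1. Proof. by case: sA. Qed.
Lemma subringB x y : A x -> A y -> A (x - y). Proof. by case: sA => _ + _; apply. Qed.
Lemma subringM x y : A x -> A y -> A (x * y). Proof. by case: sA => _ _; apply. Qed.
Lemma subring0 : A 0. Proof. by rewrite -(subrr 1); apply: subringB; exact: subring1. Qed.
Lemma subringN x : A x -> A (- x).
Proof. by rewrite -(sub0r x); apply: subringB; exact: subring0. Qed.
Lemma subringD x y : A x -> A y -> A (x + y).
Proof. by move=> Ax /subringN Ay; rewrite -(opprK y); exact: subringB. Qed.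
Lemma subringX x n : A x -> A (x ^+ n).
Proof.
by move=> Ax; elim: n => [|n IH]; rewrite ?expr0 ?exprS; [exact: subring1|exact: subringM].
Qed.
Lemma subring_prod (I : Type) (r : seq I) (P : pred I) (F : I -> T) :
  (forall i, P i -> A (F i)) -> A (\prod_(i <- r | P i) F i).
Proof. by move=> AF; apply: big_ind => //; [exact: subring1|exact: subringM]. Qed.
Lemma submod0 M : submod_in A M -> M 0. Proof. by case. Qed.
Lemma submodD M x y : submod_in A M -> M x -> M y -> M (x + y).
Proof. by case=> _ + _; apply. Qed.
Lemma submodM M a x : submod_in A M -> A a -> M x -> M (a * x).
Proof. by case=> _ _; apply. Qed.
Lemma submodN M x : submod_in A M -> M x -> M (- x).
Proof.
by move=> sM Mx; rewrite -mulN1r; apply: submodM => //; apply: subringN; exact: subring1.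
Qed.
Lemma submodB M x y : submod_in A M -> M x -> M y -> M (x - y).
Proof. by move=> sM Mx My; apply: submodD => //; exact: submodN. Qed.
Lemma submod_sum M (I : Type) (r : seq I) (P : pred I) (F : I -> T) :
  submod_in A M -> (forall i, P i -> M (F i)) -> M (\sum_(i <- r | P i) F i).
Proof. by move=> sM MF; apply: big_ind => //; [exact: submod0|move=> *; exact: submodD]. Qed.

Lemma submodI M N : submod_in A M -> submod_in A N -> submod_in A (M `&` N).
Proof.
move=> sM sN; split; first by split; exact: submod0.
- by move=> x y [? ?] [? ?]; split; exact: submodD.
- by move=> a x Aa [? ?]; split; exact: submodM.
Qed.

Lemma submod_madd M N : submod_in A M -> submod_in A N -> submod_in A (madd M N).
Proof.
move=> sM sN; split; first by exists 0, 0; rewrite addr0; split=> //; exact: submod0.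
- move=> _ _ [x [y [Mx Ny ->]]] [x' [y' [Mx' Ny' ->]]]; exists (x + x'), (y + y').
  by split; [exact: submodD|exact: submodD|ring].
- move=> a _ Aa [x [y [Mx Ny ->]]]; exists (a * x), (a * y).
  by split; [exact: submodM|exact: submodM|rewrite mulrDr].
Qed.

Lemma madd_subl M N : submod_in A N -> M `<=` madd M N.
Proof. by move=> sN x Mx; exists x, 0; rewrite addr0; split=> //; exact: submod0. Qed.
Lemma madd_subr M N : submod_in A M -> N `<=` madd M N.
Proof. by move=> sM x Nx; exists 0, x; rewrite add0r; split=> //; exact: submod0. Qed.
Lemma madd_min M N L : submod_in A L -> M `<=` L -> N `<=` L -> madd M N `<=` L.
Proof. by move=> sL ML NL _ [x [y [Mx Ny ->]]]; apply: submodD; [|exact: ML|exact: NL]. Qed.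

Lemma submod_mscale x M : submod_in A M -> submod_in A (mscale x M).
Proof.
move=> sM; split; first by exists 0; rewrite ?mulr0 //; exact: submod0.
- move=> _ _ [y My ->] [z Mz ->]; exists (y + z); last by rewrite mulrDr.
  exact: submodD.
- move=> a _ Aa [y My ->]; exists (a * y); first exact: submodM.
  by rewrite mulrCA.
Qed.

Lemma submod_subring : submod_in A A.
Proof.
split; [exact: subring0|exact: subringD|].
by move=> a x; exact: subringM.
Qed.

Lemma submod_setT : submod_in A setT. Proof. by []. Qed.

(** The modular law, in the form that keeps a step of a chain strict: it stays strict after
    intersecting with [M] or after adding [M]. *)
Lemma modular_eq M X Y : submod_in A M -> submod_in A X -> X `<=` Y -> submod_in A Y ->
  Y `&` M `<=` X -> Y `<=` madd X M -> Y `<=` X.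
Proof.
move=> sM sX XY sY I1 I2 y Yy; have [x [m [Xx Mm E]]] := I2 y Yy.
suff : X m by move=> Xm; rewrite E; exact: submodD.
apply: I1; split=> //; have -> : m = y - x by rewrite E addrC addKr.
by apply: submodB => //; exact: XY.
Qed.

(* [up lo hi n Y]: there is a chain of length [n] of submodules between [lo] and
   [hi] whose largest member is [Y]. *)
Inductive up (lo hi : set T) : nat -> set T -> Prop :=
| up0 X : submod_in A X -> lo `<=` X -> X `<=` hi -> up lo hi 0 X
| upS n X Y : up lo hi n X -> submod_in A Y -> X `<` Y -> Y `<=` hi -> up lo hi n.+1 Y.

Definition len_le lo hi n : Prop := forall k Y, up lo hi k Y -> (k <= n)%N.
Definition has_len lo hi n : Prop := len_le lo hi n /\ exists Y, up lo hi n Y.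

Lemma up_prop lo hi n Y : up lo hi n Y -> [/\ submod_in A Y, lo `<=` Y & Y `<=` hi].
Proof.
elim=> [X sX loX Xhi|m X Z _ [_ loX _] sZ [XZ _] Zhi]; split=> //.
exact: subset_trans XZ.
Qed.

Lemma up_mono lo hi lo' hi' n Y : lo' `<=` lo -> hi `<=` hi' ->
  up lo hi n Y -> up lo' hi' n Y.
Proof.
move=> l h; elim=> [X sX loX Xhi|m X Z _ IH sZ XZ Zhi].
  by apply: up0 => //; [exact: subset_trans loX|exact: subset_trans h].
by apply: upS IH _ XZ _ => //; exact: subset_trans h.
Qed.

Lemma len_le_mono lo hi lo' hi' n : lo' `<=` lo -> hi `<=` hi' ->
  len_le lo' hi' n -> len_le lo hi n.
Proof. by move=> l h H k Y /(up_mono l h); exact: H. Qed.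

Lemma has_len_uniq lo hi n m : has_len lo hi n -> has_len lo hi m -> n = m.
Proof.
move=> [h [Y u]] [h' [Y' u']]; apply/eqP; rewrite eqn_leq.
by rewrite (h' _ _ u) (h _ _ u').
Qed.

Lemma len_le_has lo hi n : submod_in A lo -> lo `<=` hi -> len_le lo hi n ->
  exists k, has_len lo hi k.
Proof.
move=> slo lohi; elim: n => [|n IH] H; first by exists 0%N; split=> //; exists lo; apply: up0.
have [[Y u]|N] := pselect (exists Y, up lo hi n.+1 Y); first by exists n.+1; split=> //; exists Y.
apply: IH => k Y u; have := H _ _ u; rewrite leq_eqVlt => /orP[/eqP E|//].
by case: N; exists Y; rewrite -E.
Qed.

(** The bottom of the upper chain is replaced by the top of the lower one, which it contains. That
    [Z] is contained in [Y] is the invariant keeping the next step strict. *)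
Lemma up_cat lo mid hi m n X Y : submod_in A mid -> lo `<=` mid -> mid `<=` hi ->
  up lo mid m X -> up mid hi n Y -> exists Z, up lo hi (m + n) Z /\ (Z `<=` Y).
Proof.
move=> smid lm mh u; elim=> [Y' sY' midY' Y'hi|k Y' Z _ [W [uW WY']] sZ [Y'Z ZY'] Zhi].
  exists X; rewrite addn0; split; first exact: up_mono mh u.
  by have [_ _ Xmid] := up_prop u; exact: subset_trans midY'.
exists Z; split=> //; rewrite addnS; apply: upS uW _ _ _ => //.
by split; [exact: subset_trans Y'Z|move=> ZW; apply: ZY'; exact: subset_trans WY'].
Qed.

(** Each step stays strict in its trace on [mid] or in its sum with [mid], so no length is lost in
    total. *)
Lemma up_split lo mid hi n Y : submod_in A mid -> lo `<=` mid -> mid `<=` hi ->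
  submod_in A hi -> up lo hi n Y ->
  exists p q, [/\ (n <= p + q)%N, up lo mid p (Y `&` mid) & up mid hi q (madd Y mid)].
Proof.
move=> smid lm mh shi; elim=> [X sX loX Xhi|k X Z uX [p [q [kpq up1 up2]]] sZ [XZ nZX] Zhi].
  exists 0%N, 0%N; split=> //.
  - by apply: up0; [exact: submodI|by move=> x lox; split; auto|by move=> x []].
  - by apply: up0; [exact: submod_madd|exact: madd_subr|exact: madd_min].
have [sX _ _] := up_prop uX.
have step lo' hi' r X' Z' : up lo' hi' r X' -> submod_in A Z' -> X' `<=` Z' -> Z' `<=` hi' ->
    exists r', [/\ up lo' hi' r' Z', (r <= r')%N & ~ (Z' `<=` X') -> (r < r')%N].
  move=> u sZ' XZ' Zhi'; have [ZX'|nZX'] := pselect (Z' `<=` X').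
    by exists r; split=> //; have <- : X' = Z' by apply/seteqP.
  by exists r.+1; split=> //; apply: upS u _ _ _.
have [||x [] //|p' [u1 pp' sp]] := step _ _ _ _ (Z `&` mid) up1.
- exact: submodI.
- by move=> x [/XZ].
have [||x|q' [u2 qq' sq]] := step _ _ _ _ (madd Z mid) up2.
- exact: submod_madd.
- by move=> _ [x [m [/XZ ? ? ->]]]; exists x, m.
- by apply: madd_min.
exists p', q'; split=> //.
have [e1|n1] := pselect (Z `&` mid `<=` X `&` mid); last first.
  by rewrite (leq_ltn_trans kpq) // -addSn leq_add ?sp.
have [e2|n2] := pselect (madd Z mid `<=` madd X mid); last first.
  by rewrite (leq_ltn_trans kpq) // -addnS leq_add ?sq.
case: nZX; apply: (@modular_eq mid) => //; first by move=> x /e1[].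
exact: subset_trans (madd_subl smid) e2.
Qed.

Lemma len_le_add lo mid hi m n : submod_in A mid -> lo `<=` mid -> mid `<=` hi ->
  submod_in A hi -> len_le lo mid m -> len_le mid hi n -> len_le lo hi (m + n).
Proof.
move=> smid lm mh shi H1 H2 k Y /(up_split smid lm mh shi)[p [q [kpq u1 u2]]].
by rewrite (leq_trans kpq) // leq_add ?(H1 _ _ u1) ?(H2 _ _ u2).
Qed.

Lemma has_len_add lo mid hi m n : submod_in A mid -> lo `<=` mid -> mid `<=` hi ->
  submod_in A hi -> has_len lo mid m -> has_len mid hi n -> has_len lo hi (m + n).
Proof.
move=> smid lm mh shi [H1 [X u1]] [H2 [Y u2]]; split; first exact: len_le_add H1 H2.
by have [Z [u _]] := up_cat smid lm mh u1 u2; exists Z.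
Qed.

Lemma has_len_refl M : submod_in A M -> has_len M M 0.
Proof.
move=> sM; split; last by exists M; apply: up0.
move=> k Y; case=> // n X Z /up_prop[_ MX _] _ [_ nZX] ZM.
by case: nZX; exact: subset_trans MX.
Qed.

Lemma has_len1 M N : submod_in A M -> submod_in A N -> M `<` N ->
  (forall X, submod_in A X -> M `<` X -> X `<=` N -> N `<=` X) -> has_len M N 1.
Proof.
move=> sM sN [MN nNM] H; split; last first.
  by exists N; apply: (@upS M N 0 M) => //; apply: up0.
move=> k Y; case=> // n X Z; case=> // n' X' Z' u sZ' [X'Z' nZ'] Z'N sZ [ZZ' nZZ'] ZN.
have [_ MX' _] := up_prop u.
case: nZZ'; apply: (subset_trans ZN); apply: H => //.
split; first exact: subset_trans X'Z'.
by move=> Z'M; apply: nZ'; exact: subset_trans MX'.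
Qed.

Lemma up_mscale x lo hi n Y : GRing.lreg x -> up lo hi n Y ->
  up (mscale x lo) (mscale x hi) n (mscale x Y).
Proof.
have sub M N : M `<=` N -> mscale x M `<=` mscale x N.
  by move=> MN _ [y /MN ? ->]; exists y.
move=> rx; elim=> [X sX loX Xhi|m X Z uX IH sZ [XZ nZX] Zhi].
  by apply: up0; [exact: submod_mscale|exact: sub|exact: sub].
apply: upS IH _ _ _; [exact: submod_mscale| |exact: sub].
split; first exact: sub.
by move=> H; apply: nZX => z Zz; have [|y Xy /rx ->] := H (x * z); first by exists z.
Qed.

End SubmodTheory.

(** Each stage has its own predicate, so the choice function is iterated on pairs of an index and an
    element. It serves both ascending chains of ideals and coherent sequences of approximations. *)
Lemma dep_choice (X : Type) (P : nat -> X -> Prop) (S : nat -> X -> X -> Prop) (x0 : X) :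
  P 0%N x0 -> (forall n x, P n x -> exists2 y, P n.+1 y & S n x y) ->
  exists f : nat -> X, f 0%N = x0 /\ forall n, P n (f n) /\ S n (f n) (f n.+1).
Proof.
move=> P0 step.
have nx (p : {nx : nat * X | P nx.1 nx.2}) : exists q : {nx : nat * X | P nx.1 nx.2},
    (sval q).1 = (sval p).1.+1 /\ S (sval p).1 (sval p).2 (sval q).2.
  by case: p => -[n x] /= Px; have [y Py Sxy] := step _ _ Px; exists (exist _ (n.+1, y) Py).
have [g gP] := choice nx.
pose h n := iter n g (exist (fun nx : nat * X => P nx.1 nx.2) (0%N, x0) P0).
have h1 n : (sval (h n)).1 = n by elim: n => // n IH; rewrite /h /= (gP _).1 -/(h n) IH.
exists (fun n => (sval (h n)).2); split=> // n; split.
  by have := svalP (h n); rewrite h1.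
by have := (gP (h n)).2; rewrite h1.
Qed.

Section ChainConditions.
Variables (T : comNzRingType) (A : set T).
Hypothesis sA : is_subring A.
Implicit Types (lo hi M N : set T).

(** If the sequence never stabilised, every [C s] would be the top of chains of arbitrary length. *)
Lemma len_le_dcc lo hi n (C : nat -> set T) : len_le A lo hi n ->
  (forall k, [/\ submod_in A (C k), lo `<=` C k & C k `<=` hi]) ->
  (forall k, C k.+1 `<=` C k) -> exists s, forall k, (s <= k)%N -> C k = C s.
Proof.
move=> H Cp Cd; apply: contrapT => nstab.
have Cmono j k : (j <= k)%N -> C k `<=` C j.
  by move/subnK <-; elim: (k - j)%N => [|d IH]; [|apply: subset_trans IH; exact: Cd].
have next s : exists2 k, (s <= k)%N & ~ (C s `<=` C k).
  apply: contrapT => N; apply: nstab; exists s => k sk; apply/seteqP; split; first exact: Cmono.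
  by apply: contrapT => N'; apply: N; exists k.
have long m s : up A lo hi m (C s).
  elim: m s => [|m IH] s; first by have [? ? ?] := Cp s; apply: up0.
  have [k sk nk] := next s; have [? ? ?] := Cp s.
  by apply: upS (IH k) _ _ _ => //; split=> //; exact: Cmono.
by have := H _ _ (long n.+1 0%N); rewrite ltnn.
Qed.

Lemma span_submod (X : set T) : submod_in A (span_in A X).
Proof.
split.
- by move=> M [[M0 _ _] _].
- move=> x y xS yS M MP; case: (MP) => sM _.
  by apply: submodD sM _ _; [exact: xS|exact: yS].
- by move=> a x Aa xS M MP; case: (MP) => sM _; apply: submodM sM Aa _; exact: xS.
Qed.

Lemma span_sub (X M : set T) : submod_in A M -> X `<=` M -> span_in A X `<=` M.
Proof. by move=> sM XM; exact: smallest_sub. Qed.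

Lemma sub_span (X : set T) : X `<=` span_in A X.
Proof. by move=> x Xx M [_ XM]; exact: XM. Qed.

End ChainConditions.

(** * Maximal ideals of a subring and the Chinese remainder theorem *)

Section MaximalIdeals.
Variables (T : comNzRingType) (A : set T).
Hypothesis sA : is_subring A.
Implicit Types (I M N : set T) (a b e : T).

Lemma maximal_submod M : maximal_in A M -> submod_in A M. Proof. by case=> -[]. Qed.
Lemma maximal_subset M : maximal_in A M -> M `<=` A. Proof. by case=> -[]. Qed.

Lemma submod_full I : submod_in A I -> I 1 -> A `<=` I.
Proof. by move=> sI I1 a Aa; rewrite -(mulr1 a); exact: (submodM sI). Qed.

Lemma maximal_proper M : maximal_in A M -> ~ M 1.
Proof.
by move=> mM M1; have [_ [_ nAM] _] := mM; apply: nAM; exact: (submod_full (maximal_submod mM)).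
Qed.

Lemma maximal_inv M a : maximal_in A M -> A a -> ~ M a -> exists2 b, A b & M (1 - b * a).
Proof.
move=> mM Aa nMa; have sM := maximal_submod mM; have [_ _ H] := mM.
have sP : submod_in A (mscale a A) by apply: submod_mscale; exact: submod_subring.
have [||E|E] := H (madd M (mscale a A)).
- split; first exact: submod_madd.
  apply: (madd_min (submod_subring sA)); first exact: maximal_subset.
  by move=> _ [b Ab ->]; exact: subringM.
- exact: (madd_subl sP).
- case: nMa; rewrite -E; apply: (madd_subr sM); exists 1; rewrite ?mulr1 //.
  exact: subring1.
have : madd M (mscale a A) 1 by rewrite E; exact: subring1.
move=> [i [_ [Mi [b Ab ->] E1]]]; exists b => //; rewrite E1.
by suff -> : i + a * b - b * a = i by []; ring.
Qed.

Lemma maximal_prime M a b : maximal_in A M -> A a -> A b -> M (a * b) -> M a \/ M b.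
Proof.
move=> mM Aa Ab Mab; have [|nMa] := pselect (M a); [by left|right].
have [c Ac Mc] := maximal_inv mM Aa nMa; have sM := maximal_submod mM.
have -> : b = b * (1 - c * a) + c * (a * b) by ring.
by apply: (submodD sM); apply: (submodM sM).
Qed.

Lemma maximal_sub_eq M N : maximal_in A M -> maximal_in A N -> M `<=` N -> N = M.
Proof.
move=> [_ _ H] mN MN; have [||//|E] := H N => //; first by case: mN.
by case: (maximal_proper mN); rewrite E; exact: subring1.
Qed.

(** The list may contain [M] itself, so that one list of all maximal ideals serves every [M]. *)
Lemma maximal_crt M (l : seq (set T)) : maximal_in A M ->
  (forall N, N \in l -> maximal_in A N) ->
  exists e, [/\ A e, M (1 - e) & forall N, N \in l -> N <> M -> N e].
Proof.
move=> mM; have sM := maximal_submod mM.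
elim: l => [|N l IH] ml.
  by exists 1; split=> //; [exact: subring1|rewrite subrr; exact: submod0 sM].
have [|e [Ae Me le]] := IH; first by move=> N' N'l; apply: ml; rewrite inE N'l orbT.
have mN := ml N (mem_head _ _).
have [EN|NM] := pselect (N = M).
  by exists e; split=> // N'; rewrite inE => /orP[/eqP-> /(_ EN)|/le].
have [a Na nMa] : exists2 a, N a & ~ M a.
  apply: contrapT => H; apply: NM; apply/esym/(maximal_sub_eq mN mM) => a Na.
  by apply: contrapT => nMa; apply: H; exists a.
have Aa : A a by exact: (maximal_subset mN).
have [b Ab Mb] := maximal_inv mM Aa nMa.
have sub_of N' : N' \in N :: l -> submod_in A N' by move=> /ml; exact: maximal_submod.
exists (e * (b * a)); split.
- by do 2?apply: (subringM sA).
- have -> : 1 - e * (b * a) = (1 - e) + e * (1 - b * a) by ring.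
  by apply: (submodD sM) => //; exact: (submodM sM).
- move=> N'; rewrite inE => /orP[/eqP-> _|N'l N'M].
    by do 2?apply: (submodM (maximal_submod mN)) => //.
  rewrite mulrC; apply: (submodM (sub_of _ _)); rewrite ?inE ?N'l ?orbT //.
    exact: (subringM sA).
  exact: le.
Qed.

End MaximalIdeals.

(** * Noetherian rings of dimension one *)

Section Noetherian.
Variable R : comNzRingType.
Implicit Types (I J P Q M : set R) (a b r s x : R).
Local Notation sub I := (submod_in [set: R] I).
Local Notation principal s := (mscale s [set: R]).

Definition is_prime P := ~ P 1 /\ forall x y, P (x * y) -> P x \/ P y.
Definition ann a : set R := [set r | r * a = 0].

Let sT : is_subring [set: R] := subringT R.

Lemma submod_ann a : sub (ann a).
Proof.
split; first exact: mul0r.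
- by move=> x y; rewrite /ann /= mulrDl => -> ->; rewrite addr0.
- by move=> b x _; rewrite /ann /= -mulrA => ->; rewrite mulr0.
Qed.

Lemma submod_principal s : sub (principal s).
Proof. exact: submod_mscale. Qed.

Lemma submod1T I : sub I -> I 1 -> I = setT.
Proof.
move=> sI I1; apply/seteqP; split=> // x _.
by rewrite -(mulr1 x); apply: (submodM sI _ I1).
Qed.

Lemma prime_inP P : sub P -> is_prime P -> prime_in setT P.
Proof.
move=> sP [P1 Pp]; split=> //.
- by split=> // H; apply: P1; exact: H.
- by move=> x y _ _; exact: Pp.
Qed.

Lemma maximal_is_prime I : maximal_in setT I -> is_prime I.
Proof.
move=> mI; split; first exact: (maximal_proper mI).
by move=> x y; exact: (maximal_prime sT mI).
Qed.

(** For incomparable primes, a product of elements of the remaining primes can avoid [P]; a multiple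
    of it corrects [r] at [P] and changes nothing modulo the others. *)
Lemma prime_avoidance I (ps : seq (set R)) : sub I ->
  (forall P, P \in ps -> [/\ sub P, is_prime P & ~ (I `<=` P)]) ->
  (forall P Q, P \in ps -> Q \in ps -> P `<=` Q -> P = Q) ->
  exists2 r, I r & forall P, P \in ps -> ~ P r.
Proof.
move=> sI; elim: ps => [|P ps IH] H anti; first by exists 0 => //; exact: (submod0 sI).
have [sP pP nIP] := H P (mem_head _ _).
have [Q Qps|Q Q' Qps Q'ps|r Ir nr] := IH.
- by apply: H; rewrite inE Qps orbT.
- by apply: anti; rewrite inE ?Qps ?Q'ps orbT.
have [Pr|nPr] := pselect (P r); last first.
  by exists r => // Q; rewrite inE => /orP[/eqP->|/nr].
have [y Iy nPy] : exists2 y, I y & ~ P y.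
  by apply: contrapT => N; apply: nIP => z Iz; apply: contrapT => nz; apply: N; exists z.
have [z [Qz nPz]] : exists z, (forall Q, Q \in ps -> Q z) /\ ~ P z.
  have nsub Q : Q \in ps -> exists2 w, Q w & ~ P w.
    move=> Qps; apply: contrapT => N; apply: (nr Q Qps).
    rewrite (anti Q P) ?inE ?Qps ?eqxx ?orbT // => w Qw; apply: contrapT => nPw.
    by apply: N; exists w.
  have : forall Q, Q \in ps -> sub Q by move=> Q Qps; have [] := H Q; rewrite // inE Qps orbT.
  move: nsub; clear -pP; elim: ps => [|Q ps IH] nsub sQ; first by exists 1; split=> //; case: pP.
  have [Q' Q'ps|Q' Q'ps|z [Qz nPz]] := IH.
  - by apply: nsub; rewrite inE Q'ps orbT.
  - by apply: sQ; rewrite inE Q'ps orbT.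
  have [w Qw nPw] := nsub Q (mem_head _ _); exists (w * z); split; last by case: pP => _ Pp /Pp[].
  move=> Q'; rewrite inE => /orP[/eqP->|Q'ps].
    by rewrite mulrC; apply: (submodM (sQ Q (mem_head _ _)) _ Qw).
  by apply: submodM (sQ Q' _) _ (Qz _ Q'ps) => //; rewrite inE Q'ps orbT.
exists (r + y * z).
  by apply: (submodD sI Ir _); rewrite mulrC; exact: (submodM sI _ Iy).
move=> Q; rewrite inE => /orP[/eqP->|Qps] Qr.
  case: pP => _ Pp; have [] // := Pp y z.
  by have := submodB sT sP Qr Pr; rewrite addrAC subrr add0r.
have [|sQ _ _] := H Q; first by rewrite inE Qps orbT.
apply: (nr Q Qps); have -> : r = (r + y * z) - y * z by ring.
apply: (submodB sT sQ Qr).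
exact: (submodM sQ _ (Qz Q Qps)).
Qed.

Hypothesis noeth : noetherian R.

Lemma noeth_max (Fam : set (set R)) : Fam !=set0 -> (forall I, Fam I -> sub I) ->
  exists2 M, Fam M & forall N, Fam N -> M `<=` N -> N = M.
Proof.
move=> [I0 F0] Fs; apply: contrapT => nmax.
have [|c [_ cP]] := @dep_choice _ (fun=> Fam) (fun _ M N => M `<` N) I0 F0.
  move=> _ M FM; apply: contrapT => N; apply: nmax; exists M => // N' FN' MN'.
  by apply/seteqP; split=> //; apply: contrapT => nNM; apply: N; exists N'.
have cmono i j : (i <= j)%N -> c i `<=` c j.
  by move/subnK <-; elim: (j - i)%N => [|k IH] //; apply: (subset_trans IH);
    case: (cP (k + i)%N) => _ [].
have cs i := Fs _ (cP i).1.
pose U : set R := \bigcup_i c i.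
have sU : sub U.
  split; first by exists 0%N => //; exact: (submod0 (cs _)).
  - move=> x y [i _ xi] [j _ yj]; exists (maxn i j) => //.
    by apply: (submodD (cs _) _ _); [apply: cmono xi|apply: cmono yj];
       rewrite ?leq_maxl ?leq_maxr.
  - by move=> a x _ [i _ xi]; exists i => //; exact: (submodM (cs _) _ xi).
have [|s Us] := noeth (I := U); first by split.
have [k sk] : exists k, [set` s] `<=` c k.
  have : [set` s] `<=` U by rewrite Us; exact: sub_span.
  elim: s {Us} => [|x s IH] sU'; first by exists 0%N => x; rewrite /= in_nil.
  have [y ys|k sk] := IH; first by apply: sU'; rewrite /= inE; apply/orP; right.
  have [|i _ xi] := sU' x; first by rewrite /= inE eqxx.
  exists (maxn i k) => y; rewrite /= inE => /orP[/eqP->|ys].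
    by apply: cmono xi; rewrite leq_maxl.
  by apply: (cmono k); [rewrite leq_maxr|exact: sk].
have [_ [_ nk]] := cP k; apply: nk => x xk.
have : U x by exists k.+1.
by rewrite Us; apply: span_sub => //; exact: cs.
Qed.

Lemma exists_maximal I : sub I -> ~ I 1 -> exists2 M, maximal_in setT M & I `<=` M.
Proof.
move=> sI I1.
have [||M [sM M1 IM] Mmax] := @noeth_max [set J | [/\ sub J, ~ J 1 & I `<=` J]].
- by exists I; split.
- by move=> J [].
exists M => //; split=> //; first by split=> // H; apply: M1; exact: H.
move=> J [sJ _] MJ; have [J1|nJ1] := pselect (J 1); first by right; exact: submod1T.
by left; apply: Mmax => //; split=> //; exact: subset_trans MJ.
Qed.

(* The maximal annihilators of nonzero elements are finitely many primes, and
   their union is the set of zero divisors, so prime avoidance applies. *)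
Lemma zero_divisor_ideal I : sub I -> (forall r, I r -> ~ regular r) ->
  exists2 a : R, a != 0 & forall r, I r -> r * a = 0.
Proof.
move=> sI Izd.
pose maxann a := a != 0 /\ forall b, b != 0 -> ann a `<=` ann b -> ann b = ann a.
have ex_maxann a : a != 0 -> exists2 b, maxann b & ann a `<=` ann b.
  move=> a0; have [||_ [b [b0 ab ->]] bmax] :=
    @noeth_max [set J | exists b, [/\ b != 0, ann a `<=` ann b & J = ann b]].
  - by exists (ann a); exists a; split.
  - by move=> _ [b [_ _ ->]]; exact: submod_ann.
  exists b => //; split=> // c c0 bc; apply: bmax => //; exists c; split=> //.
  exact: subset_trans bc.
have prime_ann a : maxann a -> is_prime (ann a).
  move=> [a0 amax]; split; first by rewrite /ann /= mul1r; exact/eqP.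
  move=> x y; rewrite /ann /= => xya; have [ya0|ya0] := eqVneq (y * a) 0; first by right.
  left; suff : ann (y * a) x by rewrite (amax (y * a)) // => r ra;
    rewrite /ann /= mulrCA (ra : r * a = 0) mulr0.
  by rewrite /ann /= mulrA.
(* The span of the list [s] is maximal, so it contains every other such [a]. Hence [ann a] contains
   the intersection of the [ann b], then one of them because it is prime, and equality follows from
   maximality. *)
have [||_ [s [sP ->]] smax] := @noeth_max [set J | exists s : seq R,
    (forall a, a \in s -> maxann a) /\ J = span_in setT [set` s]].
- by exists (span_in setT [set` [::]]), [::].
- by move=> _ [s [_ ->]]; exact: span_submod.
have fin a : maxann a -> exists2 b, b \in s & ann a = ann b.
  move=> ma; have [a0 amax] := ma.
  have as_ : span_in setT [set` s] a.
    rewrite -(smax (span_in setT [set` a :: s])).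
    - by apply: sub_span; rewrite /= mem_head.
    - by exists (a :: s); split=> // b; rewrite inE => /orP[/eqP->|/sP].
    - apply: span_sub; first exact: span_submod.
      by move=> b bs; apply: sub_span; rewrite /= inE; apply/orP; right.
  have inter r : (forall b, b \in s -> ann b r) -> ann a r.
    move=> rs; suff : span_in setT [set` s] `<=` [set z | r * z = 0] by apply.
    apply: span_sub => //; split; first exact: mulr0.
    - by move=> x y /= Ex Ey; rewrite mulrDr Ex Ey addr0.
    - by move=> b x _ /= E; rewrite mulrCA E mulr0.
  apply: contrapT => N.
  have nsub b : b \in s -> exists2 w, ann b w & ~ ann a w.
    move=> bs; apply: contrapT => N'; apply: N; exists b => //.
    have [_ bmax] := sP b bs; rewrite (bmax a) // => w wb; apply: contrapT => nw.
    by apply: N'; exists w.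
  have [z [zs nz]] : exists z, (forall b, b \in s -> ann b z) /\ ~ ann a z.
    move: nsub; clear -prime_ann ma; elim: s => [|b s IH] nsub.
      by exists 1; split=> //; case: (prime_ann a ma).
    have [c cs|z [zs nz]] := IH; first by apply: nsub; rewrite inE cs orbT.
    have [w wb nw] := nsub b (mem_head _ _); exists (w * z); split.
      move=> c; rewrite inE => /orP[/eqP->|cs].
        by rewrite mulrC; apply: (submodM (submod_ann _) _ wb).
      by apply: (submodM (submod_ann _) _ (zs _ cs)).
    by case: (prime_ann a ma) => _ pp /pp[].
  exact: (nz (inter _ zs)).
apply: contrapT => N.
have [|_ _ /mapP[a1 a1s ->] /mapP[a2 a2s ->]|r Ir nr] :=
    @prime_avoidance I [seq ann a | a <- s] sI.
- move=> _ /mapP[a a_s ->]; split; [exact: submod_ann|exact: prime_ann (sP a a_s)|].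
  by move=> Ia; apply: N; exists a; [case: (sP a a_s)|move=> r /Ia].
- move=> a12; have [_ m1] := sP _ a1s; rewrite (m1 a2) //.
  by have [] := sP a2 a2s.
apply: (Izd r Ir) => x y /eqP; rewrite -subr_eq0 -mulrBr => /eqP E.
apply/eqP; rewrite -subr_eq0; apply/negPn/negP => xy0.
have [a ma xya] := ex_maxann _ xy0; have [b bs ab] := fin a ma.
by apply: (nr (ann b)); [exact: map_f|rewrite -ab; exact: xya].
Qed.

(** The prime is maximal among the ideals disjoint from the products of powers of [s] with elements
    outside [I]. Regularity of [s] keeps 0 out of this multiplicative set, and missing [s] makes the
    inclusion in [I] strict. *)
Lemma prime_below I s : sub I -> is_prime I -> I s -> regular s ->
  exists2 P, prime_in setT P & P `<` I.
Proof.
move=> sI pI Is rs; have [I1 Ip] := pI.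
pose S : set R := [set r | exists n u, ~ I u /\ r = s ^+ n * u].
have S0 : ~ S 0.
  move=> [n [u [nIu /esym/eqP]]]; rewrite -(mulr0 (s ^+ n)) => /eqP su.
  by apply: nIu; rewrite (lregX rs su); exact: submod0 sI.
have SM x y : S x -> S y -> S (x * y).
  move=> [n [u [nu ->]]] [m [v [nv ->]]]; exists (n + m)%N, (u * v); split; last first.
    by rewrite exprD; ring.
  by move/Ip => [].
have [||P [sP PS] Pmax] := @noeth_max [set J | sub J /\ forall r, J r -> ~ S r].
- exists [set 0]; split; last by move=> _ ->.
  by split=> // [x y -> ->|a x _ ->]; rewrite ?addr0 ?mulr0.
- by move=> J [].
have PI : P `<=` I.
  by move=> p /PS nS; apply: contrapT => nIp; apply: nS; exists 0%N, p; rewrite mul1r.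
have nPs : ~ P s by move=> /PS; apply; exists 1%N, 1; rewrite mulr1.
exists P; last by split=> // IP; apply: nPs; exact: IP.
apply: prime_inP => //; split; first by move/PI.
have big a : ~ P a -> exists p r, P p /\ S (p + a * r).
  move=> nPa; apply: contrapT => N; apply: nPa.
  have sJ : sub (madd P (principal a)) by apply: submod_madd => //; exact: submod_principal.
  rewrite -(Pmax (madd P (principal a))).
  - by apply: (madd_subr sP); exists 1; rewrite ?mulr1.
  - by split=> // _ [p [_ [Pp [r _ ->] ->]]] Sr; apply: N; exists p, r.
  - exact: (madd_subl (submod_principal a)).
move=> a b Pab; apply: contrapT => /not_orP[/big[p [r [Pp Sp]]] /big[q [t [Pq Sq]]]].
apply: (PS _ _ (SM _ _ Sp Sq)).
have -> : (p + a * r) * (q + b * t) = (q + b * t) * p + (a * r) * q + (r * t) * (a * b) by ring.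
by do 2?[apply: (submodD sP)]; apply: (submodM sP).
Qed.

(** Multiplication by [a] identifies [R / (I : a)] with [(I + aR) / I]. *)
Lemma len_le_colon I a k Y : sub I -> up setT I (madd I (principal a)) k Y ->
  exists Z, up setT [set r | I (a * r)] setT k Z /\ Z = [set r | Y (a * r)].
Proof.
move=> sI; have scol X : sub X -> sub [set r | X (a * r)].
  move=> sX; split; first by rewrite /= mulr0; exact: submod0 sX.
  - by move=> x y /= Xx Xy; rewrite mulrDr; exact: submodD sX Xx Xy.
  - by move=> b x _ /= Xx; rewrite mulrCA; exact: submodM sX _ Xx.
elim=> [X sX IX _|n X Z uX [V [+ EV]] sZ [XZ nZX] ZI]; last rewrite {}EV => u.
  by exists [set r | X (a * r)]; split=> //; apply: up0 => //; [exact: scol|move=> r /IX].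
exists [set r | Z (a * r)]; split=> //; apply: (upS u) => //; first exact: scol.
split; first by move=> r /XZ.
move=> H; apply: nZX => z Zz; have [i [_ [Ii [r _ ->] E]]] := ZI z Zz.
have [sX IX _] := up_prop uX.
have Xi : X i by exact: IX.
rewrite E; apply: (submodD sX Xi); apply: H => /=.
have -> : a * r = z - i by rewrite E addrC addKr.
by apply: (submodB sT sZ Zz); exact: XZ.
Qed.

Hypothesis dim1 : forall P Q M, prime_in setT P -> prime_in setT Q -> prime_in setT M ->
  P `<` Q -> Q `<` M -> False.

Lemma prime_regular_maximal I s : sub I -> is_prime I -> I s -> regular s ->
  maximal_in setT I.
Proof.
move=> sI pI Iss rs; have [I1 _] := pI.
have [P pP PI] := prime_below sI pI Iss rs.
have [M mM IM] := exists_maximal sI I1.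
have [MI|nMI] := pselect (M `<=` I); first by have -> : I = M by apply/seteqP.
exfalso; apply: (dim1 pP (prime_inP sI pI) (prime_inP (maximal_submod mM) (maximal_is_prime
  mM)) PI).
by split.
Qed.

(** An ideal containing [s] and maximal among those of infinite colength is prime, since [R / I] is
    an extension of [R / (I + aR)] by [R / (I : a)]. Containing a regular element, it is maximal,
    and its colength is 1 after all. *)
Lemma finite_length_quot s : regular s -> exists n, len_le setT (principal s) setT n.
Proof.
move=> rs; apply: contrapT => N0.
have [||I [sI Is NI] Imax] := @noeth_max [set I |
    [/\ sub I, principal s `<=` I & ~ exists n, len_le setT I setT n]].
- by exists (principal s); split=> //; exact: submod_principal.
- by move=> I [].
have larger J : sub J -> I `<` J -> exists n, len_le setT J setT n.
  move=> sJ [IJ nJI]; apply: contrapT => N; apply: nJI; rewrite (Imax J) //.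
  by split=> //; exact: subset_trans IJ.
have I1 : ~ I 1.
  by move/(submod1T sI) => E; apply: NI; exists 0%N; rewrite E;
    have [] := has_len_refl (submod_setT [set: R]).
have pI : is_prime I.
  split=> // a b Iab; apply: contrapT => /not_orP[nIa nIb]; apply: NI.
  have sJ : sub (madd I (principal a)) by apply: submod_madd => //; exact: submod_principal.
  have IJ : I `<=` madd I (principal a) by exact: (madd_subl (submod_principal a)).
  have [|n Hn] := larger _ sJ.
    split=> // JI; apply: nIa; apply: JI; apply: (madd_subr sI); exists 1 => //.
    by rewrite mulr1.
  have [||m Hm] := larger [set r | I (a * r)].
  - split; first by rewrite /= mulr0; exact: submod0 sI.
    + by move=> x y /= Xx Xy; rewrite mulrDr; exact: submodD sI Xx Xy.
    + by move=> c x _ /= Xx; rewrite mulrCA; exact: submodM sI _ Xx.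
  - split; first by move=> r Ir; exact: submodM sI _ Ir.
    by move=> H; exact: nIb (H _ Iab).
  exists (m + n)%N; apply: (len_le_add sT sJ) => // k Y /(len_le_colon sI)[Z [u _]].
  exact: Hm u.
have mI : maximal_in setT I.
  by apply: (prime_regular_maximal sI pI _ rs); apply: Is; exists 1; rewrite ?mulr1.
apply: NI; exists 1%N; have [] // : has_len setT I setT 1.
apply: has_len1 => //; first by split=> // H; apply: I1; exact: H.
move=> X sX [IX nXI] _; have [_ _ H] := mI; have [||E|->] // := H X.
by case: nXI; rewrite E.
Qed.

Lemma jacobson_unit x r : jacobson x -> exists u, u * (1 - x * r) = 1.
Proof.
move=> jx; apply: contrapT => N.
have [|M mM IM] := exists_maximal (submod_principal (1 - x * r)).
  by move=> [u _ E]; apply: N; exists u; rewrite mulrC.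
apply: (maximal_proper mM); have sM := maximal_submod mM.
have -> : 1 = (1 - x * r) * 1 + r * x by ring.
apply: (submodD sM); first by apply: IM; exists 1.
by apply: (submodM sM) => //; exact: jx.
Qed.

Lemma regular_in_jacobson : semilocal R ->
  (forall M, maximal_in setT M -> exists2 r, M r & regular r) ->
  exists2 x : R, jacobson x & regular x.
Proof.
move=> /finite_seqP[ms msE] H.
have mmax M : M \in ms -> maximal_in setT M by move=> Mms; have : [set` ms] M by []; rewrite -msE.
suff [x [xM rx]] : exists x : R, (forall M, M \in ms -> M x) /\ regular x.
  by exists x => // M /= mM; apply: xM; have : [set` ms] M by rewrite -msE.
elim: ms mmax {msE} => [|M ms IH] mmax; first by exists 1; split=> //; exact: lreg1.
have [|x [xM rx]] := IH; first by move=> Q Qms; apply: mmax; rewrite inE Qms orbT.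
have [r Mr rr] := H M (mmax M (mem_head _ _)).
have sub_of Q : Q \in M :: ms -> sub Q by move=> Qms; exact: maximal_submod (mmax _ Qms).
exists (r * x); split; last exact: lregM.
move=> Q; rewrite inE => /orP[/eqP->|Qms].
  by rewrite mulrC; apply: (submodM (sub_of M (mem_head _ _))).
by apply: (submodM (sub_of Q _)); rewrite ?inE ?Qms ?orbT //; exact: xM.
Qed.

End Noetherian.

(** * Powers of ideals and the adic topology of the Jacobson radical *)

Section PowIn.
Variable R : comNzRingType.
Implicit Types (I J : set R).

Lemma pow_in_sub I n : submod_in setT (pow_in setT I n).
Proof. by have [] := pow_ideal_in I n. Qed.

Lemma pow_inS I n : pow_in setT I n.+1 `<=` pow_in setT I n.
Proof. by move=> x; exact: (@ideal_expSS _ I n x). Qed.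

Lemma pow_in_mul I n i y : I i -> pow_in setT I n y -> pow_in setT I n.+1 (i * y).
Proof. by move=> Ii yn; apply: sub_span; exists i, y. Qed.

Lemma pow_in_min I J m n : submod_in setT J ->
  (forall a b, pow_in setT I m a -> pow_in setT I n b -> J (a * b)) ->
  pow_in setT I (m + n) `<=` J.
Proof.
move=> sJ; elim: m J sJ => [|m IH] J sJ H.
  by move=> z zn; rewrite -(mul1r z); exact: H.
apply: span_sub => // _ [i [y [Ii yn ->]]].
suff : pow_in setT I (m + n) `<=` [set z | J (i * z)] by apply.
apply: IH => [|a b am bn /=]; last by rewrite mulrA; apply: H => //; exact: pow_in_mul.
split; first by rewrite /= mulr0; exact: submod0 sJ.
- by move=> u v /= Ju Jv; rewrite mulrDr; exact: submodD sJ Ju Jv.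
- by move=> c u _ /= Ju; rewrite mulrCA; exact: submodM sJ _ Ju.
Qed.

Lemma expr_pow_in I x n c : I x -> pow_in setT I n (x ^+ n * c).
Proof.
by move=> Ix; elim: n => [|n IH] //; rewrite exprS -mulrA; exact: pow_in_mul.
Qed.

End PowIn.

Section JacobsonAdic.
Variable R : comNzRingType.
Hypothesis noeth : noetherian R.
Hypothesis dim1 : forall P Q M : set R,
  prime_in setT P -> prime_in setT Q -> prime_in setT M -> P `<` Q -> Q `<` M -> False.
Variable x : R.
Hypotheses (xJ : jacobson x) (xreg : regular x).
Local Notation J := (@jacobson R).
Local Notation principal s := (mscale s [set: R]).

(** An ideal containing [x] and maximal among those containing no power of the radical is prime,
    because powers multiply. It is then a maximal ideal and contains the radical itself. *)
Lemma jacobson_pow_principal : exists k, pow_in setT J k `<=` principal x.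
Proof.
apply: contrapT => N0.
have [||I [sI xI NI] Imax] := @noeth_max _ noeth [set I | [/\ submod_in setT I,
    principal x `<=` I & ~ exists k, pow_in setT J k `<=` I]].
- by exists (principal x); split=> //; exact: submod_principal.
- by move=> I [].
have larger a : ~ I a -> exists k, pow_in setT J k `<=` madd I (principal a).
  move=> nIa; apply: contrapT => N; apply: nIa.
  have sJ : submod_in setT (madd I (principal a)).
    by apply: submod_madd => //; exact: submod_principal.
  have IJ : I `<=` madd I (principal a) by exact: (madd_subl (submod_principal a)).
  rewrite -(Imax _ _ IJ); first by apply: (madd_subr sI); exists 1; rewrite ?mulr1.
  by split=> //; exact: subset_trans IJ.
have I1 : ~ I 1 by move/(submod1T sI) => E; apply: NI; exists 0%N; rewrite E.
have pI : is_prime I.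
  split=> // a b Iab; apply: contrapT => /not_orP[/larger[k Hk] /larger[l Hl]].
  apply: NI; exists (k + l)%N; apply: pow_in_min => // u v /Hk[i [_ [Ii [r _ ->] ->]]].
  move=> /Hl[j [_ [Ij [t _ ->] ->]]].
  have -> : (i + a * r) * (j + b * t) = (j + b * t) * i + (a * r) * j + (r * t) * (a * b) by ring.
  by do 2?[apply: (submodD sI)]; apply: (submodM sI).
have mI : maximal_in setT I.
  by apply: (prime_regular_maximal noeth dim1 sI pI _ xreg); apply: xI; exists 1; rewrite ?mulr1.
apply: NI; exists 1%N; apply: span_sub => // _ [i [y [Ji _ ->]]].
by rewrite mulrC; apply: (submodM sI) => //; exact: Ji.
Qed.

(** Among the quotients of [y] by powers of [x], let [r] generate a largest ideal. The next quotient
    [r'] satisfies [r = x * r'] and [r' = r * c], hence is killed by the unit [1 - x * c]. *)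
Lemma inter_powers_eq0 y : (forall n, principal (x ^+ n) y) -> y = 0.
Proof.
move=> yx.
have [||_ [r [n [Er ->]]] rmax] := @noeth_max _ noeth [set I | exists r n,
    x ^+ n * r = y /\ I = principal r].
- by exists (principal y); exists y, 0%N; rewrite mul1r.
- by move=> _ [r [n [_ ->]]]; exact: submod_principal.
have [r' _ Er'] := yx n.+1.
have rr' : r = x * r'.
  by apply: (lregX (n := n) xreg); rewrite Er Er' exprSr mulrA.
have : principal r r'.
  rewrite -(rmax (principal r')); first by exists 1; rewrite ?mulr1.
  - by exists r', n.+1.
  - by move=> _ [c _ ->]; exists (x * c) => //; rewrite rr'; ring.
move=> [c _ E]; have [u uE] := jacobson_unit noeth c xJ.
suff r'0 : r' = 0 by rewrite Er' r'0 mulr0.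
rewrite -(mul1r r') -uE -mulrA mulrBl mul1r {1}E rr'.
suff -> : x * r' * c - x * c * r' = 0 by rewrite mulr0.
by ring.
Qed.

Hypothesis red : reduced (completion J).

(** The [r n] are the components of an element of the completion whose [e]-th power is 0.
    Reducedness puts a late term in [xR]; consecutive terms agree modulo [x] from index 1 on, which
    carries this back to [r 1]. *)
Lemma adic_nilpotent (r : nat -> R) e :
  (forall m, principal (x ^+ m) (r m.+1 - r m)) ->
  (forall m, principal (x ^+ m) (r m ^+ e)) -> principal x (r 1%N).
Proof.
move=> rS re.
have xJn n z : principal (x ^+ n) z -> pow_in setT J n z.
  by move=> [c _ ->]; exact: expr_pow_in.
have coh n s : to_quotring (ideal_exp J n.+1) (r n.+1) = to_quotring _ s ->
    to_quotring (ideal_exp J n) (r n) = to_quotring _ s.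
  move=> /eqP/quotring_eqP /= rs; apply/eqP/quotring_eqP => /=.
  have -> : r n - s = (r n.+1 - s) - (r n.+1 - r n) by ring.
  apply: (submodB (subringT R) (pow_in_sub J n)); last exact: xJn.
  exact: pow_inS.
pose z : completion J := Completion coh.
have zX n : component (z ^+ e) n = to_quotring _ (r n ^+ e).
  elim: {re} e => [|e IH]; first by [].
  by rewrite exprS -[LHS]/(component z n * component (z ^+ e) n) IH -rmorphM -exprS.
have /(congr1 (fun y => component y)) z0 : z = 0.
  apply: (red (n := e)); apply: completionP => n; rewrite zX.
  by apply/eqP/quotring_eqP; rewrite /= subr0; apply: xJn.
have [k Hk] := jacobson_pow_principal.
have rk : principal x (r k.+1).
  apply: Hk; apply: pow_inS.
  have /eqP/quotring_eqP : to_quotring (ideal_exp J k.+1) (r k.+1) = to_quotring _ 0.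
    by have := congr1 (fun f => f k.+1) z0.
  by rewrite subr0.
have sx := submod_principal x.
have : principal x (r k.+1 - r 1%N).
  elim: {rk Hk} k => [|k IH]; first by rewrite subrr; exact: submod0 sx.
  have -> : r k.+2 - r 1%N = (r k.+2 - r k.+1) + (r k.+1 - r 1%N) by ring.
  apply: (submodD sx) => //; have [c _ ->] := rS k.+1.
  by exists (x ^+ k * c); rewrite // exprS mulrA.
move=> H; have -> : r 1%N = r k.+1 - (r k.+1 - r 1%N) by ring.
by apply: (submodB (subringT R) sx).
Qed.

(** A nilpotent [y] is a constant coherent sequence, hence divisible by [x]. The quotient is again
    nilpotent, so every power of [x] divides [y]. *)
Lemma reduced_base : reduced R.
Proof.
move=> y e ye; apply: inter_powers_eq0 => n; elim: n y ye => [|n IH] y ye.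
  by exists y; rewrite ?mul1r.
have [|m|y' _ Ey] := @adic_nilpotent (fun=> y) e.
- by move=> m; rewrite subrr; exists 0; rewrite ?mulr0.
- by rewrite ye; exists 0; rewrite ?mulr0.
have [|c _ Ec] := IH y'; last by exists c => //; rewrite exprS -mulrA -Ec.
by apply: (lregX (n := e) xreg); rewrite mulr0 -exprMn -Ey.
Qed.

(** Otherwise [bR + ann b] consists of zero divisors and is killed by a single nonzero [a]. This [a]
    kills [b], so it lies in [ann b] and has square zero. *)
Lemma reduced_decomp (b : R) : exists c g, b * g = 0 /\ regular (b * c + g).
Proof.
apply: contrapT => N.
have sI : submod_in setT (madd (principal b) (ann b)).
  by apply: submod_madd; [exact: submod_principal|exact: submod_ann].
have [_ [_ [g [[c _ ->] bg ->]]] rz|a a0 Ia] := zero_divisor_ideal noeth sI.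
  by apply: N; exists c, g; split; last exact: rz; rewrite mulrC.
have ba : b * a = 0.
  by apply: Ia; apply: (madd_subl (submod_ann b)); exists 1; rewrite ?mulr1.
have aa : a * a = 0.
  by apply: Ia; apply: (madd_subr (submod_principal b)); rewrite /ann /= mulrC.
by move/eqP: a0; apply; apply: (@reduced_base _ 2); rewrite expr2.
Qed.

End JacobsonAdic.

(** * Dimension and depth as attained suprema *)

Lemma nat_sup_max (A : set nat) n : A n -> (forall k, A k -> (k <= n)%N) ->
  nat_sup A = (n%:Z)%:E.
Proof.
move=> An Ale; rewrite /nat_sup /supremum ifN; last first.
  by apply/set0P; exists (n%:Z)%:E; exists n.
have sup_n : supremums [set (k%:Z)%:E | k in A] (n%:Z)%:E.
  split=> [_ [k Ak <-]|y]; first by rewrite lee_fin lez_nat Ale.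
  by apply; exists n.
apply: xget_unique => // y [ubY lbY]; apply/eqP; rewrite eq_le; apply/andP; split.
  by apply: lbY; case: sup_n.
by apply: ubY; exists n.
Qed.

Lemma nat_supP (A : set nat) n : nat_sup A = (n%:Z)%:E -> A n /\ forall k, A k -> (k <= n)%N.
Proof.
rewrite /nat_sup /supremum; case: ifPn => // /set0P[_ [k0 Ak0 _]].
case: xgetP => // y -> [ubY lbY] yn; rewrite yn in ubY lbY.
have kn k : A k -> (k <= n)%N.
  by move=> Ak; have := ubY (k%:Z)%:E; rewrite lee_fin lez_nat; apply; exists k.
split=> //; apply: contrapT => nAn.
case: n {yn} ubY lbY kn nAn => [|n] ubY lbY kn nAn.
  by apply: nAn; have := kn _ Ak0; rewrite leqn0 => /eqP <-.
have := lbY (n%:Z)%:E; rewrite lee_fin lez_nat ltnn => H.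
suff : false by []; apply: H => _ [k Ak <-]; rewrite lee_fin lez_nat.
by have := kn _ Ak; rewrite leq_eqVlt => /orP[/eqP E|]; rewrite ?ltnS // E in Ak *.
Qed.

Lemma dim1_chain (R : comNzRingType) : krull_dim R = 1%:E -> forall P Q M : set R,
  prime_in setT P -> prime_in setT Q -> prime_in setT M -> P `<` Q -> Q `<` M -> False.
Proof.
move=> /(@nat_supP _ 1)[_ H] P Q M pP pQ pM PQ QM; have := H 2; rewrite ltnn => F.
suff : false by []; apply: F; exists (nth M [:: P; Q]); split=> -[|[|[|i]]] //=.
Qed.

(** If [m] had only zero divisors, one nonzero [a] would kill it, and [a] stays nonzero in the
    localization. The numerator of the single term of a regular sequence either lies in [m] and
    kills [a], or makes the term a unit; both are excluded. *)
Lemma depth1_regular (R : comNzRingType) (m : maxideal R) : noetherian R ->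
  local_depth (locmax m) = 1%:E -> exists2 r, (m : set R) r & regular r.
Proof.
move=> noeth /(@nat_supP _ 1)[[sq [ssq _ +]] _].
case: sq ssq => [|q []] // _ [qreg qT].
have mM := maxidealP m; have sm := maximal_submod mM.
apply: contrapT => N.
have [r mr rr|a a0 ma] := zero_divisor_ideal noeth sm; first by apply: N; exists r.
have {}qreg y : q * y = 0 -> y = 0.
  move=> qy; have := qreg 0%N y isT; rewrite /= qy.
  have E0 : span_in [set: locmax m] [set` [::]] = [set 0].
    apply/seteqP; split=> [|_ ->]; last exact: submod0 (span_submod _ _).
    apply: span_sub => //; split=> // [u v -> ->|b u _ ->]; rewrite ?addr0 ?mulr0 //.
  by rewrite E0; apply.
have [c [s [sS Eq]]] := mkfrac_surj q.
have a1 : loc_of (compl_max m) a <> 0.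
  move=> /mkfrac_eq[t tS /eqP]; rewrite mul0r subr0 mulr1 => /eqP ta.
  suff : (m : set R) t by [].
  apply: contrapT => nmt; have [//|b _ mb] := maximal_inv (subringT R) mM _ nmt.
  have := ma _ mb; rewrite mulrBl mul1r -mulrA ta mulr0 subr0 => a00.
  by rewrite a00 eqxx in a0.
have [mc|nmc] := pselect ((m : set R) c).
  apply: a1; apply: qreg; rewrite Eq -[LHS]/(loc_mul _ _) mkfracM.
  apply/mkfrac_eq; exists 1; first exact: mulset1.
  by rewrite (ma c mc); ring.
apply: qT; apply: submod1T; first exact: span_submod.
have -> : 1 = @mkfrac R (compl_max m) s c nmc * q :> locmax m.
  rewrite Eq -[RHS]/(loc_mul _ _) mkfracM; apply/mkfrac_eq; exists 1; first exact: mulset1.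
  by ring.
apply: (submodM (span_submod _ _)) => //; apply: sub_span; by rewrite /= inE.
Qed.

(** * The conductor of an analytically reduced ring *)

Section Scaling.
Variables (K : comUnitRingType) (B : set K).
Hypothesis sB : is_subring B.
Implicit Types (lo hi M N : set K) (x y z : K).

Lemma unit_lreg x : x \is a GRing.unit -> GRing.lreg x.
Proof. by move=> ux; exact: mulrI. Qed.

Lemma mscaleM x y M : mscale x (mscale y M) = mscale (x * y) M.
Proof.
apply/seteqP; split=> [_ [_ [z Mz ->] ->]|_ [z Mz ->]]; first by exists z; rewrite ?mulrA.
by exists (y * z); [exists z|rewrite mulrA].
Qed.

Lemma mscale1 M : mscale 1 M = M.
Proof.
apply/seteqP; split=> [_ [y My ->]|y My]; first by rewrite mul1r.
by exists y; rewrite ?mul1r.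
Qed.

Lemma mscaleVK x M : x \is a GRing.unit -> mscale x^-1 (mscale x M) = M.
Proof. by move=> ux; rewrite mscaleM mulVr // mscale1. Qed.

Lemma mscaleP x M z : x \is a GRing.unit -> mscale x M z <-> M (x^-1 * z).
Proof.
move=> ux; split=> [[y My ->]|H]; first by rewrite mulKr.
by exists (x^-1 * z); rewrite ?mulVKr.
Qed.

Lemma sub_mscale x M N : M `<=` N -> mscale x M `<=` mscale x N.
Proof. by move=> MN _ [y /MN ? ->]; exists y. Qed.

Lemma has_len_mscale x lo hi n : x \is a GRing.unit ->
  has_len B lo hi n -> has_len B (mscale x lo) (mscale x hi) n.
Proof.
move=> ux [H [Y u]]; split; last by exists (mscale x Y); apply: up_mscale; first exact: unit_lreg.
move=> k Z uZ; apply: (H _ (mscale x^-1 Z)).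
rewrite -[lo](@mscaleVK x) // -[hi](@mscaleVK x) //; apply: up_mscale => //.
by apply: unit_lreg; rewrite unitrV.
Qed.

Lemma mscale_subring x : B x -> mscale x B `<=` B.
Proof. by move=> Bx _ [y By ->]; exact: subringM. Qed.

Lemma has_len_powers x e n : x \is a GRing.unit -> B x -> has_len B (mscale x B) B e ->
  has_len B (mscale (x ^+ n) B) B (n * e).
Proof.
move=> ux Bx He; elim: n => [|n IH].
  by rewrite expr0 mscale1; apply: has_len_refl; exact: submod_subring.
rewrite mulSn.
have sx k : submod_in B (mscale (x ^+ k) B) by apply: submod_mscale; exact: submod_subring.
apply: (has_len_add sB (sx n)).
- rewrite exprSr -mscaleM; apply: sub_mscale; exact: mscale_subring.
- by apply: mscale_subring; exact: subringX.
- exact: submod_subring.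
- by rewrite exprSr -mscaleM; apply: has_len_mscale => //; rewrite unitrX.
- exact: IH.
Qed.

End Scaling.

Section PolynomialModules.
Variables (K : comUnitRingType) (B : set K).
Hypothesis sB : is_subring B.
Variable y : K.

(* The polynomials in [y] of degree less than [j]. *)
Fixpoint poly_mod j : set K :=
  if j is j'.+1 then [set z | exists c z', [/\ B c, poly_mod j' z' & z = c + y * z']]
  else [set 0].

Lemma submod_poly_mod j : submod_in B (poly_mod j).
Proof.
elim: j => [|j IH] /=; first by split=> // [u v -> ->|c u _ ->]; rewrite ?addr0 ?mulr0.
split; first by exists 0, 0; rewrite mulr0 addr0; split=> //; [exact: subring0|exact: submod0 IH].
- move=> _ _ [c [z [Bc Mz ->]]] [c' [z' [Bc' Mz' ->]]]; exists (c + c'), (z + z').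
  by split; [exact: subringD|exact: (submodD IH)|ring].
- move=> b _ Bb [c [z [Bc Mz ->]]]; exists (b * c), (b * z).
  by split; [exact: subringM|exact: (submodM IH)|ring].
Qed.

Lemma poly_modS j : poly_mod j `<=` poly_mod j.+1.
Proof.
elim: j => [_ ->|j IH _ [c [z [Bc /IH Mz ->]]]]; first exact: submod0 (submod_poly_mod 1).
by exists c, z.
Qed.

Lemma poly_mod_le i j : (i <= j)%N -> poly_mod i `<=` poly_mod j.
Proof.
by move/subnK <-; elim: (j - i)%N => [|k IH] //; apply: (subset_trans IH); exact: poly_modS.
Qed.

Lemma poly_mod_base j : B `<=` poly_mod j.+1.
Proof.
by move=> b Bb; exists b, 0; rewrite mulr0 addr0; split=> //; exact: submod0 (submod_poly_mod j).
Qed.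

Lemma poly_mod_mulX j z : poly_mod j z -> poly_mod j.+1 (y * z).
Proof. by move=> Mz; exists 0, z; rewrite add0r; split=> //; exact: subring0. Qed.

Lemma poly_mod_exp j : poly_mod j.+1 (y ^+ j).
Proof.
elim: j => [|j IH]; first by apply: poly_mod_base; exact: subring1.
by rewrite exprS; exact: poly_mod_mulX.
Qed.

Lemma poly_mod_last j z : poly_mod j.+1 z ->
  exists c z', [/\ B c, poly_mod j z' & z = z' + c * y ^+ j].
Proof.
elim: j z => [|j IH] z [c [z1 [Bc Mz1 ->]]].
  by exists c, 0; split=> //; rewrite Mz1; ring.
have [c' [z' [Bc' Mz' ->]]] := IH _ Mz1; exists c', (c + y * z'); split=> //.
  by exists c, z'.
by rewrite exprS; ring.
Qed.

(** Once [y ^+ d] has an expression of lower degree, [poly_mod d] is all of [B[y]]. Integrality is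
    used in this form. *)
Lemma poly_mod_stable d k : poly_mod d (y ^+ d) -> poly_mod k `<=` poly_mod d.
Proof.
move=> yd; have Sd : poly_mod d.+1 `<=` poly_mod d.
  move=> _ /poly_mod_last[c [z [Bc Mz ->]]].
  by apply: (submodD (submod_poly_mod d)) => //; apply: (submodM (submod_poly_mod d)).
elim: k => [_ ->|k IH _ [c [z [Bc /IH Mz ->]]]]; first exact: submod0 (submod_poly_mod d).
by apply: Sd; exists c, z.
Qed.

Lemma poly_mod_denom w j z : B w -> B (w * y) -> poly_mod j.+1 z -> B (w ^+ j * z).
Proof.
move=> Bw Bwy; elim: j z => [|j IH] _ [c [z [Bc Mz ->]]].
  by rewrite Mz mulr0 addr0 mul1r.
have -> : w ^+ j.+1 * (c + y * z) = w ^+ j.+1 * c + (w * y) * (w ^+ j * z).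
  by rewrite exprS; ring.
by apply: subringD => //; apply: subringM => //; [exact: subringX|exact: IH].
Qed.

Variable x : K.
Hypotheses (ux : x \is a GRing.unit) (Bx : B x).
Hypothesis jac : forall b, B b -> exists u, u * (1 - x * b) = 1.
Hypothesis frac : exists n, B (x ^+ n * y).

(* The length of [B[y] / x B[y]] equals that of [B / x B], whence [e] generators
   suffice for [B[y]]. *)
Lemma poly_mod_bound d e : poly_mod d (y ^+ d) -> has_len B (mscale x B) B e ->
  poly_mod e (y ^+ e).
Proof.
move=> yd He; have [n Bn] := frac.
have d0 : (0 < d)%N.
  by case: d yd => // /eqP; rewrite expr0 oner_eq0.
set R' := poly_mod d; have sR' : submod_in B R' := submod_poly_mod d.
have BR' : B `<=` R' by move=> b Bb; apply: (poly_mod_le d0); exact: poly_mod_base.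
have yR' z : R' z -> R' (y * z) by move/poly_mod_mulX; exact: poly_mod_stable.
have sBB := submod_subring sB.
have sub_xR' : mscale x R' `<=` R' by move=> _ [z Rz ->]; exact: (submodM sR').
(* [x ^+ n] clears the denominator of [y], so [d] such factors clear those of all polynomials of
   degree at most [d] in [y]. *)
pose N := (n * d)%N.
have denR' z : R' z -> B (x ^+ N * z).
  move=> Rz; have {Rz} Rz : poly_mod d.+1 z by exact: poly_modS.
  by rewrite /N exprM; apply: poly_mod_denom => //; exact: subringX.
have R'sub : R' `<=` mscale (x ^+ N)^-1 B.
  move=> z Rz; exists (x ^+ N * z); first exact: denR'.
  by rewrite mulKr // unitrX.
have [L HL] : exists L, has_len B B R' L.
  have uN : (x ^+ N)^-1 \is a GRing.unit by rewrite unitrV unitrX.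
  apply: (@len_le_has _ _ _ _ (N * e)) => //.
  have [H _] := has_len_mscale uN (has_len_powers sB N ux Bx He).
  by apply: len_le_mono H => //; rewrite mscaleVK ?unitrX.
have HxL := has_len_mscale ux HL.
have xBR' : mscale x B `<=` mscale x R' by exact: sub_mscale.
have xBB : mscale x B `<=` B by exact: mscale_subring.
have [k Hk] : exists k, has_len B (mscale x R') R' k.
  have [H _] := has_len_add sB sBB xBB BR' sR' He HL.
  apply: (@len_le_has _ _ _ _ (e + L)) => //; first exact: submod_mscale.
  by apply: len_le_mono H.
(* The length of [R' / xB] is computed through [B] and through [xR']. Scaling by the unit [x] gives
   [R' / B] and [xR' / xB] the same length [L], which cancels. *)
have ke : k = e.
  have H1 := has_len_add sB sBB xBB BR' sR' He HL.
  have H2 := has_len_add sB (submod_mscale x sR') xBR' sub_xR' sR' HxL Hk.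
  by have := has_len_uniq H1 H2; rewrite addnC => /addnI.
rewrite {k}ke in Hk.
pose W j := madd (mscale x R') (poly_mod j).
have sW j : submod_in B (W j).
  by apply: submod_madd; [exact: submod_mscale|exact: submod_poly_mod].
have MR' j : poly_mod j `<=` R' by exact: poly_mod_stable.
have WS j : W j `<=` W j.+1.
  by move=> _ [u [v [Hu /poly_modS Hv ->]]]; exists u, v.
have WR' j : W j `<=` R' by exact: (madd_min sR' sub_xR' (@MR' j)).
(* Otherwise [W 0], ..., [W e.+1] would be a chain longer than the length of [R' / xR']. *)
have [j je Wj] : exists2 j, (j <= e)%N & W j.+1 `<=` W j.
  apply: contrapT => H.
  have long m : (m <= e.+1)%N -> up B (mscale x R') R' m (W m).
    elim: m => [|m IH] me; first by apply: up0 => //; exact: (madd_subl (submod_poly_mod 0)).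
    apply: (upS (IH (ltnW me))) => //; split=> // WW; apply: H; by exists m.
  by have [/(_ _ _ (long _ (leqnn _)))] := Hk; rewrite ltnn.
have sxR' := submod_mscale x sR'.
have MW k : poly_mod k `<=` W j.
  elim: k => [_ ->|k IH _ [c [z [Bc /IH [_ [z' [[r Rr ->] Mz' ->]]] ->]]]];
    first exact: submod0 (sW j).
  apply: Wj; exists (x * (y * r)), (c + y * z'); split; last by ring.
  - by exists (y * r) => //; exact: yR'.
  - by exists c, z'.
(* An explicit form of Nakayama's lemma: at exponent [N.+1] the first summand lies in [xB], so that
   [R'] is [xB + poly_mod j]. *)
have R'pow m : R' `<=` madd (mscale (x ^+ m) R') (poly_mod j).
  elim: m => [|m IH] z Rz.
    by exists z, 0; rewrite addr0; split=> //; [exists z;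
      rewrite ?mul1r|exact: submod0 (submod_poly_mod j)].
  have [_ [v [[r /MW [_ [v' [[r' Rr' ->] Mv' ->]]] ->] Mv ->]]] := IH z Rz.
  exists (x ^+ m.+1 * r'), (x ^+ m * v' + v); split; [by exists r'| |by rewrite exprSr; ring].
  apply: (submodD (submod_poly_mod j)) => //; apply: (submodM (submod_poly_mod j)) => //.
  exact: subringX.
have R'xB z : R' z -> exists2 b, B b & poly_mod j (z - x * b).
  move=> /(R'pow N.+1)[_ [v [[r Rr ->] Mv ->]]]; exists (x ^+ N * r); first exact: denR'.
  by have -> : x ^+ N.+1 * r + v - x * (x ^+ N * r) = v by rewrite exprS; ring.
have j0 : (0 < j)%N.
  case: (j) R'xB => // /(_ 1 (BR' _ (subring1 sB)))[b Bb /= E].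
  have [u] := jac Bb; rewrite E mulr0 => /esym/eqP; by rewrite oner_eq0.
apply: (poly_mod_le je); have [b Bb Mb] := R'xB _ (MR' _ _ (poly_mod_exp e)).
rewrite -[y ^+ e](subrK (x * b)); apply: (submodD (submod_poly_mod j)) => //.
by apply: (poly_mod_le j0); apply: poly_mod_base; exact: subringM.
Qed.

End PolynomialModules.

Section Conductor.
Variables (R : comNzRingType) (K : comUnitRingType) (phi : {rmorphism R -> K}).
Local Notation B := (range phi).
Local Notation A := [set y | integralOver phi y].

Lemma subring_range : is_subring B.
Proof.
split; first by exists 1; rewrite ?rmorph1.
- by move=> _ _ [a _ <-] [b _ <-]; exists (a - b); rewrite ?rmorphB.
- by move=> _ _ [a _ <-] [b _ <-]; exists (a * b); rewrite ?rmorphM.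
Qed.
Let sB := subring_range.

Lemma subring_integral : is_subring A.
Proof.
split; [exact: integral1|exact: integral_sub|exact: integral_mul].
Qed.

Lemma range_integral : B `<=` A.
Proof. by move=> _ [a _ <-]; exact: integral_id. Qed.

Lemma integral_poly_mod y : A y -> exists d, poly_mod B y d (y ^+ d).
Proof.
move=> [p mp /rootP py]; have sp : (0 < size p)%N.
  by rewrite lt0n size_poly_eq0 monic_neq0.
have szp : (size (map_poly phi p) <= size p)%N by exact: size_poly.
exists (size p).-1; move: py; rewrite (horner_coef_wide _ szp).
rewrite -(prednK sp) big_ord_recr /= coef_map /=.
have -> : p`_(size p).-1 = 1 by exact: (monicP mp).
rewrite rmorph1 mul1r => /eqP; rewrite addrC addr_eq0 => /eqP ->.
have sM := submod_poly_mod sB y (size p).-1.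
apply: (submodN sB sM); apply: (submod_sum _ sM) => i _; apply: (submodM sM).
  by rewrite coef_map; eexists.
by apply: (poly_mod_le sB (ltn_ord i)); exact: poly_mod_exp.
Qed.

Variable x : K.
Hypotheses (ux : x \is a GRing.unit) (Bx : B x).
Hypothesis jac : forall b, B b -> exists u, u * (1 - x * b) = 1.
Hypothesis frac : forall y, exists n, B (x ^+ n * y).
Variable e : nat.
Hypothesis He : has_len B (mscale x B) B e.
Hypothesis adic : forall (r : nat -> K) k, (forall m, B (r m)) ->
  (forall m, mscale (x ^+ m) B (r m.+1 - r m)) ->
  (forall m, mscale (x ^+ m) B (r m ^+ k)) -> mscale x B (r 1%N).

(* [x ^+ n * A `&` B]; its elements have [e]-th powers divisible by [x ^+ n], so a
   coherent sequence of them is nilpotent in the completion. *)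
Let C n : set K := mscale (x ^+ n) A `&` B.

Let submod_C n : submod_in B (C n).
Proof.
apply: submodI; last exact: submod_subring.
apply: submod_mscale; have sA := subring_integral.
split; [exact: (subring0 sA)|exact: (subringD sA)|].
by move=> a y /range_integral; exact: (subringM sA).
Qed.

Let C_le m n : (m <= n)%N -> C n `<=` C m.
Proof.
move=> /subnK E _ [[y Ay ->] By]; split=> //; exists (x ^+ (n - m) * y).
  by apply: (subringM subring_integral) => //; apply: (subringX subring_integral _);
     exact: range_integral.
by rewrite mulrA -exprD addnC E.
Qed.

Let C_exp n a : C n a -> mscale (x ^+ n) B (a ^+ e).
Proof.
move=> [[y Ay Ea] Ba]; have [d yd] := integral_poly_mod Ay.
have := poly_mod_bound sB ux Bx jac (frac y) yd He.
case: (e) => [/eqP|k Mk]; first by rewrite expr0 oner_eq0.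
(* One of the [k.+1] factors [x ^+ n] is kept; the other [k] clear the denominators of [y ^+ k.+1],
   a polynomial of degree at most [k] in [y]. *)
exists ((x ^+ n) ^+ k * y ^+ k.+1); last by rewrite Ea exprMn exprS mulrA.
rewrite Ea in Ba; exact: (poly_mod_denom sB (subringX sB n Bx) Ba Mk).
Qed.

Lemma conductor_step : exists n, C n `<=` mscale x B.
Proof.
have sBB := submod_subring sB.
have sxn n : submod_in B (mscale (x ^+ n) B) by exact: submod_mscale.
(* [D m] is the intersection over [n] of [C n + x ^+ m * B]. Finite length makes these sums
   stationary, so every element of [D m] agrees modulo [x ^+ m] with one of [D m.+1]. *)
pose D m : set K := [set r | B r /\ forall n, exists c b, [/\ C n c, B b & r = c + x ^+ m * b]].
have stab m : exists s, forall n, (s <= n)%N ->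
    madd (C n) (mscale (x ^+ m) B) = madd (C s) (mscale (x ^+ m) B).
  have [H _] := has_len_powers sB m ux Bx He.
  apply: (len_le_dcc (C := fun n => madd (C n) (mscale (x ^+ m) B)) H) => n.
    split; [exact: submod_madd|exact: (madd_subr (submod_C n))|].
    apply: (madd_min sBB); first by move=> ? [].
    exact: (mscale_subring sB (subringX sB m Bx)).
  by move=> _ [u [v [/(C_le (leqnSn n)) ? ? ->]]]; exists u, v.
apply: contrapT => N.
have [s1 s1P] := stab 1%N.
have [r1 Cr1 nxr1] : exists2 r, C s1 r & ~ mscale x B r.
  apply: contrapT => H; apply: N; exists s1 => r Cr; apply: contrapT => nr; apply: H.
  by exists r.
have inD m s r : (forall n, (s <= n)%N ->
    madd (C n) (mscale (x ^+ m) B) = madd (C s) (mscale (x ^+ m) B)) -> C s r -> D m r.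
  move=> sP Cr; split; first by case: Cr.
  move=> n; have : madd (C (maxn s n)) (mscale (x ^+ m) B) r.
    by rewrite sP ?leq_maxl //; exact: (madd_subl (sxn m)).
  move=> [c [_ [Cc [b Bb ->] ->]]]; exists c, b; split=> //.
  by apply: C_le Cc; rewrite leq_maxr.
have step m r : D m r -> exists2 r', D m.+1 r' & mscale (x ^+ m) B (r' - r).
  move=> [Br Dr]; have [s sP] := stab m.+1.
  have [c [b [Cc Bb ->]]] := Dr s; exists c; first exact: inD sP Cc.
  by exists (- b); [exact: subringN|ring].
have [r [r0 rP]] := dep_choice (P := fun m => D m.+1)
  (S := fun m r r' => mscale (x ^+ m.+1) B (r' - r)) (inD _ _ _ s1P Cr1) (fun m => @step m.+1).
have Dexp m a : D m a -> mscale (x ^+ m) B (a ^+ e).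
  move=> [Ba Da]; have [c [b [Cc Bb ->]]] := Da m.
  have Bc : B c by case: Cc.
  have [d Bd ->] : exists2 d, B d & (c + x ^+ m * b) ^+ e = c ^+ e + x ^+ m * d.
    elim: (e) => [|k [d Bd IH]]; first by exists 0; [exact: subring0|rewrite mulr0 addr0].
    exists (b * (c ^+ k + x ^+ m * d) + c * d); last by rewrite !exprS IH; ring.
    have Bxm : B (x ^+ m) by exact: subringX.
    apply: (subringD sB); apply: (subringM sB) => //.
    by apply: (subringD sB); [exact: subringX|exact: subringM].
  by apply: (submodD (sxn m)); [exact: C_exp|exists d].
apply: nxr1; rewrite -r0.
(* Since [r m] lies in [D m.+1], the shifted sequence has its [m]-th term in [D m] for positive [m].
   The term then forced into [xB] is [r 0], chosen outside it. *)
apply: (adic (r := fun m => r m.-1) (k := e)) => m /=.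
- by case: m => [|m]; [case: (rP 0%N) => -[]|case: (rP m) => -[]].
- case: m => [|m] /=; last by case: (rP m).
  by rewrite subrr; exact: submod0 (sxn _).
- case: m => [|m] /=; last by apply: Dexp; case: (rP m).
  by rewrite mscale1; apply: (subringX sB _); case: (rP 0%N) => -[].
Qed.

(** Descent on the exponent: while [n.+1] is at least [n0], an element [x ^+ n.+1 * y] of [B] lies
    in [C n0], hence in [xB], and one factor [x] cancels. *)
Theorem conductor : exists n, forall y, A y -> B (x ^+ n * y).
Proof.
have [n0 Hn0] := conductor_step; exists n0 => y Ay; have [n Bn] := frac y.
elim: n Bn => [|n IH] Bn.
  by rewrite mul1r in Bn; apply: (subringM sB) => //; exact: subringX.
have [n0n|nn0] := leqP n0 n.+1; last first.
  have -> : x ^+ n0 * y = x ^+ (n0 - n.+1) * (x ^+ n.+1 * y).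
    by rewrite mulrA -exprD subnK // ltnW.
  by apply: (subringM sB) => //; exact: subringX.
apply: IH; have [|b Bb E] := Hn0 (x ^+ n.+1 * y).
  by apply: (C_le n0n); split=> //; exists y.
suff -> : x ^+ n * y = b by [].
by apply: (mulrI ux); rewrite -E mulrA -exprS.
Qed.

End Conductor.

(** * Maximal ideals of the integral closure are principal *)

Lemma span_seq (R : comNzRingType) (s : seq R) r : span_in setT [set` s] r ->
  exists c : 'I_(size s) -> R, r = \sum_i c i * s`_i.
Proof.
suff : span_in setT [set` s] `<=` [set r | exists c : 'I_(size s) -> R, r = \sum_i c i * s`_i].
  by apply.
apply: span_sub.
- split; first by exists (fun=> 0); rewrite big1 // => i _; rewrite mul0r.
  + move=> _ _ [c ->] [d ->]; exists (fun i => c i + d i); rewrite -big_split /=.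
    by apply: eq_bigr => i _; rewrite mulrDl.
  + move=> a _ _ [c ->]; exists (fun i => a * c i); rewrite mulr_sumr.
    by apply: eq_bigr => i _; rewrite mulrA.
- move=> a /= /(nthP 0)[i i_s <-]; exists (fun j => (j == i :> nat)%:R).
  rewrite (bigD1 (Ordinal i_s)) //= eqxx mul1r big1 ?addr0 // => j ji.
  suff -> : (j == i :> nat) = false by rewrite mul0r.
  by apply: contraNF ji => /eqP ji; apply/eqP/val_inj.
Qed.

(** The determinant trick: [w * M] is an ideal, so [M] is finitely generated. The determinant of
    [y - a] kills the generators, hence the unit [z0] of [M], and the characteristic polynomial of
    [a] gives the monic equation. *)
Lemma stable_integral (R : comNzRingType) (K : comUnitRingType) (phi : {rmorphism R -> K})
    (M : set K) (w y z0 : K) :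
  noetherian R -> submod_in (range phi) M -> w \is a GRing.unit ->
  (forall z, M z -> range phi (w * z)) -> M z0 -> z0 \is a GRing.unit ->
  (forall z, M z -> M (y * z)) -> integralOver phi y.
Proof.
move=> noeth sM uw Mw Mz0 uz0 My.
pose I : set R := [set r | M (w^-1 * phi r)].
have [|s Es] := noeth I.
  split=> //; split; first by rewrite /I /= rmorph0 mulr0; exact: submod0 sM.
  - by move=> a b; rewrite /I /= rmorphD mulrDr; exact: (submodD sM).
  - by move=> a b _; rewrite /I /= rmorphM mulrCA; apply: (submodM sM); exists a.
pose n := size s; pose v (i : 'I_n) := w^-1 * phi s`_i.
have Mv i : M (v i).
  by suff : I s`_i by []; rewrite Es; apply: sub_span; rewrite /= mem_nth.
have Mspan z : M z -> exists c : 'I_n -> R, z = \sum_i phi (c i) * v i.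
  move=> Mz; have [r _ Er] := Mw z Mz.
  have : I r by rewrite /I /= Er mulKr.
  rewrite Es => /span_seq[c Ec]; exists c; rewrite -(mulKr uw z) -Er Ec rmorph_sum mulr_sumr.
  by apply: eq_bigr => i _; rewrite rmorphM mulrCA.
have [a aP] := choice (fun i => Mspan _ (My _ (Mv i))).
pose a_mx : 'M[R]_n := \matrix_(i, j) a i j.
exists (char_poly a_mx); first exact: char_poly_monic.
apply/rootP; rewrite map_char_poly -/(horner_eval y _) /char_poly -det_map_mx.
set D := map_mx (horner_eval y) _.
have DE i j : D i j = y *+ (i == j) - phi (a i j).
  by rewrite !mxE /horner_eval hornerD hornerN hornerC hornerMn hornerX.
pose V : 'cV[K]_n := \col_i v i.
have DV : D *m V = 0.
  apply/matrixP => i j; rewrite !mxE.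
  under eq_bigr => k _ do rewrite DE !mxE mulrBl.
  rewrite sumrB -aP (bigD1 i) //= eqxx mulr1n big1 ?addr0 ?subrr // => k.
  by rewrite eq_sym => /negPf ->; rewrite mulr0n mul0r.
have dv i : \det D * v i = 0.
  have := congr1 (mulmx (\adj D)) DV; rewrite mulmxA mul_adj_mx mulmx0 mul_scalar_mx.
  by move/matrixP/(_ i 0); rewrite !mxE.
have [c Ec] := Mspan _ Mz0; apply: (mulIr uz0); rewrite mul0r Ec mulr_sumr big1 // => i _.
by rewrite mulrCA dv mulr0.
Qed.

Section PrincipalMaximal.
Variables (K : comUnitRingType) (B A : set K).
Hypotheses (sB : is_subring B) (sA : is_subring A) (BA : B `<=` A).
Variables (x : K) (N e : nat).
Hypotheses (ux : x \is a GRing.unit) (Bx : B x).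
Hypothesis jac : forall b, B b -> exists2 u, B u & u * (1 - x * b) = 1.
Hypothesis cond : forall y, A y -> B (x ^+ N * y).
Hypothesis He : has_len B (mscale x B) B e.
Hypothesis noethB : forall Fam : set (set K), Fam !=set0 ->
  (forall I, Fam I -> ideal_in B I) ->
  exists2 M, Fam M & forall I, Fam I -> M `<=` I -> I = M.
Hypothesis stable_closed : forall (M : set K) y z, submod_in B M -> M `<=` A ->
  M z -> z \is a GRing.unit -> (forall m, M m -> M (y * m)) -> A y.
Implicit Types (I J M n : set K) (a b c t y z : K).

Let Ax : A x. Proof. exact: BA. Qed.
Let uxn k : x ^+ k \is a GRing.unit. Proof. by rewrite unitrX. Qed.

Lemma submod_restr M : submod_in A M -> submod_in B M.
Proof. by case=> M0 MD MM; split=> // a z /BA; exact: MM. Qed.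

(** Multiplication by the conductor element [x ^+ N] embeds the ideals of [A] into those of [B],
    preserving inclusions. *)
Lemma noethA (Fam : set (set K)) : Fam !=set0 -> (forall I, Fam I -> ideal_in A I) ->
  exists2 M, Fam M & forall I, Fam I -> M `<=` I -> I = M.
Proof.
move=> [I0 F0] FamA.
have [||_ [M FM <-] Mmax] := @noethB [set mscale (x ^+ N) I | I in Fam].
- by exists (mscale (x ^+ N) I0); exists I0.
- move=> _ [I /FamA[sI IA] <-]; split; first by apply: submod_mscale; exact: submod_restr.
  by move=> _ [y /IA/cond ? ->].
exists M => // I FI MI; rewrite -[I](mscaleVK _ (uxn N)) -[M](mscaleVK _ (uxn N)).
by congr mscale; apply: Mmax; [exists I|exact: sub_mscale].
Qed.

Lemma exists_maximal_over I : ideal_in A I -> ~ I 1 -> exists2 M, maximal_in A M & I `<=` M.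
Proof.
move=> idI I1.
have [||M [idM M1 IM] Mmax] := @noethA [set J | [/\ ideal_in A J, ~ J 1 & I `<=` J]].
- by exists I; split.
- by move=> J [].
exists M => //; split=> //.
  by split; [case: idM|move=> /(_ _ (subring1 sA))].
move=> J idJ MJ; have [J1|nJ1] := pselect (J 1).
  right; apply/seteqP; split; first by case: idJ.
  by apply: submod_full => //; case: idJ.
by left; apply: Mmax => //; split=> //; exact: subset_trans MJ.
Qed.

Lemma ideal_mscale a : A a -> ideal_in A (mscale a A).
Proof.
move=> Aa; split; first by apply: submod_mscale; exact: submod_subring.
by move=> _ [b Ab ->]; exact: (subringM sA).
Qed.

Lemma unit_of_not_maximal a : A a -> (forall M, maximal_in A M -> ~ M a) ->
  exists2 b, A b & a * b = 1.
Proof.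
move=> Aa nMa; apply: contrapT => H.
have [|M mM aM] := exists_maximal_over (ideal_mscale Aa).
  by move=> [b Ab E]; apply: H; exists b.
by apply: (nMa M mM); apply: aM; exists 1; [exact: subring1|rewrite mulr1].
Qed.

Lemma jacA a : A a -> exists2 u, A u & u * (1 - x * a) = 1.
Proof.
move=> Aa; have Axa : A (x * a) by exact: subringM.
(* [1 - x * a] divides [1 - (x * a) ^+ N.+1], and this power is [x] times an element of [B], thanks
   to the conductor. *)
have [|u Bu Eu] := jac (b := x ^+ N * a ^+ N.+1).
  by apply: cond; exact: subringX.
exists (u * \sum_(i < N.+1) (x * a) ^+ i).
  apply: (subringM sA); first exact: BA.
  by apply: (submod_sum _ (submod_subring sA)) => i _; exact: subringX.
rewrite -[RHS]Eu -mulrA; congr (u * _).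
have := subrX1 (x * a) N.+1; set S := \sum_(i < _) _; rewrite exprMn (exprS x) -mulrA => E.
by rewrite -[RHS]opprB E; ring.
Qed.

Lemma maximal_x M : maximal_in A M -> M x.
Proof.
move=> mM; apply: contrapT => nMx; have [b Ab Mb] := maximal_inv sA mM Ax nMx.
apply: (maximal_proper mM); have [u Au <-] := jacA Ab.
by rewrite [x * b]mulrC; apply: (submodM (maximal_submod mM)).
Qed.

(** [xA] contains [xB] and [A] is contained in [x^-N B], an interval of length [N.+1 * e] over
    [B]. *)
Lemma len_quotA : exists E, len_le B (mscale x A) A E.
Proof.
have sBA := submod_restr (submod_subring sA); have sBB := submod_subring sB.
have uN : (x ^+ N)^-1 \is a GRing.unit by rewrite unitrV.
exists (N.+1 * e)%N.
have [H _] := has_len_mscale uN (has_len_powers sB N.+1 ux Bx He).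
apply: len_le_mono H.
  rewrite exprSr mscaleM mulKr //; apply: sub_mscale; exact: BA.
by move=> a Aa; exists (x ^+ N * a); [exact: cond|rewrite mulKr].
Qed.

(** By the Chinese remainder theorem each further maximal ideal makes the intersection strictly
    smaller, while [x] stays in all of them. The length of [A / xA] therefore bounds their
    number. *)
Lemma finite_maximal : exists ns : seq (set K), uniq ns /\
  forall M, (M \in ns) <-> maximal_in A M.
Proof.
have [E HE] := len_quotA.
pose inter (l : seq (set K)) : set K := [set a | A a /\ forall M, M \in l -> M a].
have bound l : uniq l -> (forall M, M \in l -> maximal_in A M) -> (size l <= E)%N.
  move=> ul ml.
  have sub_inter l' : (forall M, M \in l' -> maximal_in A M) -> submod_in A (inter l').
    move=> ml'; split.
    - by split=> [|M /ml' mM]; [exact: subring0|exact: submod0 (maximal_submod mM)].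
    - move=> a b [Aa la] [Ab lb]; split=> [|M Ml]; first exact: subringD.
      by apply: (submodD (maximal_submod (ml' M Ml))); [exact: la|exact: lb].
    - move=> c a Ac [Aa la]; split=> [|M Ml]; first exact: subringM.
      by apply: (submodM (maximal_submod (ml' M Ml))) => //; exact: la.
  have key l' k : uniq l' -> (forall M, M \in l' -> maximal_in A M) ->
      up B (mscale x A) A k (inter l') -> exists Y, up B (mscale x A) A (k + size l') Y.
    elim: l' k => [|M l' IH] k; first by exists (inter [::]); rewrite addn0.
    move=> /= /andP[Ml' ul'] ml' u; rewrite addnS -addSn.
    have ml'' M' : M' \in l' -> maximal_in A M' by move=> M'l; apply: ml'; rewrite inE M'l orbT.
    have mM := ml' M (mem_head _ _).
    apply: IH => //; apply: (upS u).
    - by apply: submod_restr; exact: sub_inter.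
    - split.
        by move=> a [Aa la]; split=> // M' M'l; apply: la; rewrite inE M'l orbT.
      have [a [Aa Ma la]] := maximal_crt sA mM ml''.
      move=> H; have [|_ /(_ M (mem_head _ _)) Ma'] := H a.
        split=> // M' M'l; apply: la => // E'; by rewrite -E' M'l in Ml'.
      apply: (maximal_proper mM); rewrite -(subrK a 1).
      by apply: (submodD (maximal_submod mM)).
    - by move=> a [].
  have [|Y /HE] := key l 0%N ul ml; last by [].
  apply: up0; [by apply: submod_restr; exact: sub_inter| |by move=> a []].
  move=> _ [a Aa ->]; split=> [|M /ml mM]; first exact: subringM.
  by rewrite mulrC; apply: (submodM (maximal_submod mM)) => //; exact: maximal_x.
pose P k := `[< exists l : seq (set K), [/\ uniq l, (forall M, M \in l -> maximal_in A M)
  & size l = k] >].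
have P0 : exists k, P k by exists 0%N; apply/asboolP; exists [::].
have [k /asboolP[ns [uns mns szk]] kmax] := ex_maxnP P0 (m := E)
  (fun k => fun Pk => let: ex_intro l (And3 ul ml sl) := asboolW Pk in
     eq_ind _ (fun j => (j <= E)%N) (bound l ul ml) _ sl).
exists ns; split=> // M; split; first exact: mns.
move=> mM; apply/negPn/negP => nMns.
have /kmax : P k.+1.
  apply/asboolP; exists (M :: ns); split; rewrite /= ?nMns ?szk //.
  by move=> M'; rewrite inE => /orP[/eqP->|/mns].
by rewrite ltnn.
Qed.

(* [n] is the annihilator of some [b] modulo [x A]; then [b / x] multiplies [n] into [A]. *)
Lemma maximal_colon n : maximal_in A n -> exists b, [/\ A b, ~ mscale x A b &
  forall a, n a -> mscale x A (b * a)].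
Proof.
move=> mn; have sn := maximal_submod mn.
have sxA : submod_in A (mscale x A) by apply: submod_mscale; exact: submod_subring.
pose colon b : set K := [set a | A a /\ mscale x A (b * a)].
have s_colon b : A b -> submod_in A (colon b).
  move=> Ab; split; first by split; rewrite ?mulr0; [exact: subring0|exact: submod0 sxA].
  - move=> a c [Aa xa] [Ac xc]; split; first exact: subringD.
    by rewrite mulrDr; exact: (submodD sxA).
  - by move=> c a Ac [Aa xa]; split; [exact: subringM|rewrite mulrCA; exact: (submodM sxA)].
(* [P] is maximal only among the annihilators contained in [n]. A strictly larger annihilator thus
   has an element outside [n], which is what makes [P] prime. *)
have [||P [[b [Ab EP]] Pn] Pmax] := @noethA [set P | (exists b, A b /\ P = colon b) /\ P `<=` n].
- exists (colon 1); split; first by exists 1; split=> //; exact: subring1.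
  move=> a [Aa]; rewrite mul1r => -[c Ac ->]; rewrite mulrC.
  by apply: (submodM sn) => //; exact: maximal_x.
- by move=> P [[b [Ab ->]] _]; split; [exact: s_colon|move=> a []].
have sP : submod_in A P by rewrite EP; exact: s_colon.
have Pprime c d : A c -> A d -> P (c * d) -> P c \/ P d.
  move=> Ac Ad Pcd; apply: contrapT => /not_orP[nPc nPd].
  have big b' : A b' -> P `<=` colon b' -> ~ (colon b' `<=` P) ->
      exists u, [/\ A u, ~ n u & mscale x A (b' * u)].
    move=> Ab' Pb' nb'; apply: contrapT => H; apply: nb'; rewrite (Pmax (colon b')) //.
    split; first by exists b'.
    by move=> u [Au xu]; apply: contrapT => nu; apply: H; exists u.
  have Pmul f : A f -> P `<=` colon (b * f).
    move=> Af a; rewrite {1}EP => -[Aa xa]; split=> //; rewrite mulrAC mulrC.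
    exact: (submodM sxA).
  have [||H|u [Au nu xu]] := big (b * c).
  - exact: subringM.
  - exact: Pmul.
  - apply: nPd; apply: H; split=> //; move: Pcd; rewrite {1}EP => -[_].
    by rewrite mulrA.
  have [||H|w [Aw nw xw]] := big (b * u).
  - exact: subringM.
  - exact: Pmul.
  - by apply: nPc; apply: H; split=> //; rewrite mulrAC.
  have : n (u * w).
    by apply: Pn; rewrite EP; split; [exact: subringM|rewrite mulrA].
  by move/(maximal_prime sA mn Au Aw) => [].
have xP a : A a -> P (x * a).
  by move=> Aa; rewrite EP; split; [exact: subringM|exists (b * a); [exact: subringM|ring]].
have P1 : ~ P 1 by move/Pn; exact: (maximal_proper mn).
exists b; split=> //.
  by move=> xb; apply: P1; rewrite EP; split; [exact: subring1|rewrite mulr1].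
move=> c nc; have Ac : A c by exact: (maximal_subset mn).
suff : P c by rewrite EP => -[].
apply: contrapT => nPc; have [E HE] := len_quotA.
have sxAB := submod_restr sxA.
(* As these ideals become stationary, some [c ^+ s * (1 - c * d)] lies in [xA], hence in [P]. No
   power of [c] is in [P], so [1 - c * d] would be in [n] together with [c]. *)
pose C k := madd (mscale (c ^+ k) A) (mscale x A).
have sck k : submod_in B (mscale (c ^+ k) A).
  by apply: submod_mscale; apply: submod_restr; exact: submod_subring.
have [k|k|s /(_ s.+1 (leqnSn s)) Cs] := len_le_dcc (C := C) HE.
- split; [exact: submod_madd|exact: madd_subr (sck k)|].
  apply: (madd_min (submod_subring sA)); first by case: (ideal_mscale (subringX sA k Ac)).
  by case: (ideal_mscale Ax).
- move=> _ [_ [v [[a Aa ->] xv ->]]]; exists (c ^+ k * (c * a)), v; split=> //.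
    by exists (c * a) => //; exact: subringM.
  by rewrite exprSr mulrA.
have : C s (c ^+ s).
  by apply: (madd_subl sxAB); exists 1; [exact: subring1|rewrite mulr1].
rewrite -Cs => -[_ [_ [[d Ad ->] [a Aa ->] Ed]]].
have Acs k : A (c ^+ k) by exact: subringX.
have nPcs k : ~ P (c ^+ k).
  elim: k => [//|k IH]; rewrite exprS => Pck.
  by have [] := Pprime _ _ Ac (Acs k) Pck.
have : P (c ^+ s * (1 - c * d)).
  suff -> : c ^+ s * (1 - c * d) = x * a by exact: xP.
  by rewrite mulrBr mulr1 {1}Ed exprSr; ring.
have A1cd : A (1 - c * d).
  by apply: (subringB sA); [exact: subring1|exact: subringM].
move=> /(Pprime _ _ (Acs s) A1cd)[/nPcs//|/Pn ncd].
apply: (maximal_proper mn); rewrite // -(subrK (c * d) 1).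
by apply: (submodD sn) => //; rewrite mulrC; exact: (submodM sn).
Qed.

(** [beta = b / x] is outside [A], so it cannot map [n] to itself, and some [beta * t0] is outside
    [n]: [t0] is a generator locally at [n]. To get a global one, [t0] and [beta] are altered by an
    [f] that is 1 modulo [n] and 0 modulo the other maximal ideals. *)
Theorem maximal_principal n : maximal_in A n ->
  exists t, [/\ A t, t \is a GRing.unit & n = mscale t A].
Proof.
move=> mn; have sn := maximal_submod mn; have nA := maximal_subset mn.
have [b [Ab nxb bn]] := maximal_colon mn.
pose beta := x^-1 * b.
have Abeta a : n a -> A (beta * a).
  by move=> /bn[c Ac E]; rewrite /beta -mulrA E mulKr.
have nAbeta : ~ A beta by move=> H; apply: nxb; exists beta; rewrite ?/beta ?mulVKr.
have [t0 nt0 nbt0] : exists2 t0, n t0 & ~ n (beta * t0).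
  apply: contrapT => H; apply: nAbeta; apply: (stable_closed (M := n) (z := x)) => //.
  - exact: submod_restr.
  - exact: maximal_x.
  - by move=> m nm; apply: contrapT => nb; apply: H; exists m.
have [ns [_ nsP]] := finite_maximal.
have [f [Af nf lf]] := maximal_crt sA mn (fun M => proj1 (nsP M)).
pose g := 1 - f; have Ag : A g by exact: nA.
(* [beta' * t] is [f ^+ 2 * (beta * t0)] modulo [n] and [g ^+ 3] modulo the other maximal ideals, so
   it is a unit of [A]. *)
pose t := f * t0 + g * g; pose beta' := f * beta + g.
have nt : n t by apply: (submodD sn); apply: (submodM sn).
have Abg : A (beta * g) by exact: Abeta.
have Abt : A (beta * t) by exact: Abeta.
have At : A t by exact: nA.
have Ab't a : n a -> A (beta' * a).
  move=> na; have -> : beta' * a = f * (beta * a) + g * a by rewrite /beta'; ring.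
  by apply: (subringD sA); apply: (subringM sA) => //; [exact: Abeta|exact: nA].
have [|M mM|v' Av' Ev] := @unit_of_not_maximal (beta' * t); first exact: Ab't.
  have sM := maximal_submod mM.
  have [->{M mM sM}|/(lf M (proj2 (nsP M) mM)) Mf] := pselect (M = n).
    move=> nv; have : n (f * (f * (beta * t0))).
      have -> : f * (f * (beta * t0)) = beta' * t - (f * ((beta * g) * g) + g * t).
        by rewrite /beta' /t; ring.
      by apply: (submodB sA sn) => //; apply: (submodD sn); do ?apply: (submodM sn).
    have nnf : ~ n f.
      by move=> nf'; apply: (maximal_proper mn); rewrite -(subrK f 1); exact: (submodD sn).
    have Abt0 : A (beta * t0) by exact: Abeta.
    move=> /(maximal_prime sA mn Af (subringM sA Af Abt0))[] //.
    by move=> /(maximal_prime sA mn Af Abt0)[].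
  have nMg : ~ M g.
    by move=> Mg; apply: (maximal_proper mM); rewrite -(subrK f 1); exact: (submodD sM).
  move=> Mv; have : M (g * (g * g)).
    have -> : g * (g * g) = beta' * t - (beta * t + g * t0) * f by rewrite /beta' /t; ring.
    apply: (submodB sA sM) => //; apply: (submodM sM) => //.
    by apply: (subringD sA) => //; apply: (subringM sA) => //; exact: nA.
  move=> /(maximal_prime sA mM Ag (subringM sA Ag Ag))[] //.
  by move=> /(maximal_prime sA mM Ag Ag)[].
exists t; split=> //.
  by apply/unitrPr; exists (beta' * v'); rewrite -Ev; ring.
apply/seteqP; split=> [a na|_ [a Aa ->]]; last by rewrite mulrC; exact: (submodM sn).
exists (v' * (beta' * a)); first by apply: (subringM sA) => //; exact: Ab't.
by rewrite -[LHS]mul1r -Ev; ring.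
Qed.

End PrincipalMaximal.

(** * Value semigroups of a semilocal principal ideal ring *)

Section SemilocalPrincipal.
Variables (K : comUnitRingType) (A : set K).
Hypothesis sA : is_subring A.
Variables (I : eqType) (ind : seq I) (t : I -> K).
Hypotheses (uniq_ind : uniq ind) (mem_ind : forall i, i \in ind).
Hypothesis ut : forall i, t i \is a GRing.unit.
Hypothesis At : forall i, A (t i).
Hypothesis t_max : forall i, maximal_in A (mscale (t i) A).
Hypothesis t_inj : forall i j, mscale (t i) A (t j) -> i = j.
Hypothesis t_unit : forall a, A a -> (forall i, ~ mscale (t i) A a) ->
  exists2 b, A b & a * b = 1.
Hypothesis noethA : forall Fam : set (set K), Fam !=set0 ->
  (forall J, Fam J -> ideal_in A J) ->
  exists2 M, Fam M & forall J, Fam J -> M `<=` J -> J = M.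
Hypothesis fracA : forall y, exists a c, [/\ A a, A c, c \is a GRing.unit & c * y = a].
Implicit Types (a b c d : I -> int) (u v w y z : K) (i j : I).

Definition tpow a : K := \prod_(i <- ind) t i ^ (a i).
Definition unit_in u := [/\ u \is a GRing.unit, A u & A u^-1].

Let exprz_unit y (n : int) : y \is a GRing.unit -> y ^ n \is a GRing.unit.
Proof. by move=> uy; case: n => n; rewrite ?unitrV unitrX. Qed.

Lemma tpow_unit a : tpow a \is a GRing.unit.
Proof. by apply/unitr_prodP => i _ _; exact: exprz_unit. Qed.

Lemma tpowD a b : tpow (fun i => a i + b i) = tpow a * tpow b.
Proof. by rewrite /tpow -big_split; apply: eq_bigr => i _; rewrite exprzDr. Qed.

Lemma tpow0 : tpow (fun=> 0) = 1.
Proof. by rewrite /tpow big1. Qed.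

Lemma tpowN a : tpow (fun i => - a i) = (tpow a)^-1.
Proof.
apply: (mulrI (tpow_unit a)); rewrite divrr ?tpow_unit // -tpowD -[RHS]tpow0.
by congr tpow; apply/funext => i; rewrite subrr.
Qed.

Lemma tpowB a b : tpow (fun i => a i - b i) = tpow a / tpow b.
Proof. by rewrite tpowD tpowN. Qed.

Definition delta i : I -> int := fun j => (j == i)%:Z.

Lemma tpow_delta i : tpow (delta i) = t i.
Proof.
rewrite /tpow (bigD1_seq i) //= /delta eqxx big1 ?mulr1 // => j /negPf ji.
by rewrite ji.
Qed.

Lemma tpow_ge0 a : (forall i, 0 <= a i) -> A (tpow a).
Proof.
move=> a0; apply: (subring_prod sA) => i _; move: (a0 i); case: (a i) => // n _.
exact: subringX.
Qed.

Lemma not_max_unit i u : unit_in u -> ~ mscale (t i) A u.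
Proof.
move=> [uu Au Aui] Mu; apply: (maximal_proper (t_max i)).
by rewrite -(mulVr uu); apply: (submodM (maximal_submod (t_max i))).
Qed.

Lemma not_max_tpow i a : (forall j, 0 <= a j) -> a i = 0 -> ~ mscale (t i) A (tpow a).
Proof.
move=> a0 ai; pose P z := A z /\ ~ mscale (t i) A z.
have n1 : ~ mscale (t i) A 1 by exact: (maximal_proper (t_max i)).
have PM z w : P z -> P w -> P (z * w).
  move=> [Az nz] [Aw nw]; split; first exact: subringM.
  by move=> /(maximal_prime sA (t_max i) Az Aw)[].
have P1 : P 1 by split => //; exact: subring1.
suff [] : P (tpow a) by [].
rewrite /tpow; apply: (big_ind P) => // j _; have [<-|ij] := eqVneq i j; first by rewrite ai.
have Pt : P (t j) by split=> // /t_inj E; rewrite E eqxx in ij.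
move: (a0 j); case: (a j) => // n _; elim: n => [|n IH] //.
by rewrite -exprnP exprS; exact: PM.
Qed.

Lemma tpow_in_max i a : (forall j, 0 <= a j) -> 0 < a i -> mscale (t i) A (tpow a).
Proof.
move=> a0 ai; exists (tpow (fun j => a j - delta i j)).
  apply: tpow_ge0 => j; rewrite /delta; case: eqP => [->|_]; rewrite ?subr0 //.
  by rewrite subr_ge0 -gtz0_ge1.
by rewrite tpowB tpow_delta mulrC divrK.
Qed.

Lemma tpow_inA u a : unit_in u -> A (u * tpow a) <-> forall i, 0 <= a i.
Proof.
move=> [uu Au Aui]; split=> [Aa i|a0]; last by apply: (subringM sA) => //; exact: tpow_ge0.
rewrite leNgt; apply/negP => ai.
have {}Aa : A (tpow a) by rewrite -(mulKr uu (tpow a)); exact: (subringM sA).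
pose p : I -> int := fun j => Num.max 0 (a j); pose n : I -> int := fun j => Num.max 0 (- a j).
have Epn : tpow p = tpow n * tpow a.
  by rewrite -tpowD; congr tpow; apply/funext => j; rewrite /p /n; lia.
apply: (@not_max_tpow i p); [by move=> j; rewrite /p; lia|by rewrite /p; lia|].
rewrite Epn mulrC; apply: (submodM (maximal_submod (t_max i))) => //.
by apply: tpow_in_max; [move=> j; rewrite /n; lia|rewrite /n; lia].
Qed.

Lemma unit_inM u v : unit_in u -> unit_in v -> unit_in (u * v).
Proof.
move=> [uu Au Aui] [uv Av Avi]; split; first by rewrite unitrM uu.
  exact: (subringM sA).
by rewrite invrM //; exact: (subringM sA).
Qed.

Lemma unit_inV u : unit_in u -> unit_in u^-1.
Proof. by case=> uu Au Aui; split; rewrite ?unitrV ?invrK. Qed.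

Lemma unit_in1 : unit_in 1.
Proof. by split; rewrite ?unitr1 ?invr1; try exact: (subring1 sA). Qed.

Lemma unit_inP y : A y -> (forall i, ~ mscale (t i) A y) -> unit_in y.
Proof.
move=> Ay /(t_unit Ay)[b Ab yb]; have uy : y \is a GRing.unit by apply/unitrPr; exists b.
by split=> //; rewrite -(mulr1 y^-1) -yb mulKr.
Qed.

Lemma tpow_le u a b : unit_in u -> mscale (tpow b) A (u * tpow a) <-> (b <= a)%O.
Proof.
move=> uu; rewrite mscaleP ?tpow_unit //.
have -> : (tpow b)^-1 * (u * tpow a) = u * tpow (fun i => a i - b i) by rewrite tpowB; ring.
rewrite tpow_inA //; split=> [H|/lefP H] //; first by apply/lefP => i; have := H i;
  rewrite subr_ge0.
by move=> i; rewrite subr_ge0.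
Qed.

Lemma sub_tpow a b : (b <= a)%O -> mscale (tpow a) A `<=` mscale (tpow b) A.
Proof.
move=> /lefP ba _ [y Ay ->]; exists (tpow (fun i => a i - b i) * y).
  by apply: (subringM sA) => //; apply: tpow_ge0 => i; rewrite subr_ge0.
by rewrite tpowB; rewrite mulrA mulrCA divrr ?tpow_unit // mulr1.
Qed.

(** A counterexample generating a largest ideal is not a unit of [A]; some [t i] divides it, and the
    quotient generates a strictly larger ideal. *)
Lemma factor_in y : A y -> y \is a GRing.unit -> exists u a, unit_in u /\ y = u * tpow a.
Proof.
move=> Ay uy; apply: contrapT => Ny.
pose bad y := [/\ A y, y \is a GRing.unit & ~ exists u a, unit_in u /\ y = u * tpow a].
have [||_ [z [Az uz Nz] <-] zmax] := @noethA [set mscale y A | y in bad].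
- by exists (mscale y A), y.
- move=> _ [z [Az _ _] <-]; split; first by apply: submod_mscale; exact: submod_subring.
  by move=> _ [w Aw ->]; exact: (subringM sA).
have [i [z' Az' Ez]] : exists i, mscale (t i) A z.
  apply: contrapT => H; apply: Nz; exists z, (fun=> 0); rewrite tpow0 mulr1; split=> //.
  by apply: unit_inP => // i Mz; apply: H; exists i.
have uz' : z' \is a GRing.unit by move: uz; rewrite Ez unitrM ut.
have nbad : ~ bad z'.
  move=> bz'; have : mscale z' A z' by exists 1; [exact: subring1|rewrite mulr1].
  rewrite (zmax (mscale z' A)); [|by exists z'|].
    move=> [w Aw E]; apply: (maximal_proper (t_max i)); exists w => //.
    by apply: (mulIr uz'); rewrite mul1r [LHS]E Ez; ring.
  by move=> _ [w Aw ->]; exists (t i * w); [exact: (subringM sA)|rewrite Ez; ring].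
apply: nbad; split=> // -[u [a [uu Ea]]]; apply: Nz; exists u, (fun j => a j + delta i j).
by split=> //; rewrite tpowD tpow_delta Ez Ea; ring.
Qed.

Lemma factor_unit y : y \is a GRing.unit -> exists u a, unit_in u /\ y = u * tpow a.
Proof.
move=> uy; have [f [c [Af Ac uc E]]] := fracA y.
have uf : f \is a GRing.unit by rewrite -E unitrM uc.
have [u [a [uu Ea]]] := factor_in Af uf; have [v [b [uv Eb]]] := factor_in Ac uc.
exists (u * v^-1), (fun i => a i - b i); split; first by apply: unit_inM => //; exact: unit_inV.
have [uuv _ _] := uv; apply: (mulrI uc); rewrite E Ea Eb tpowB.
have -> : v * tpow b * (u * v^-1 * (tpow a / tpow b)) = u * tpow a * (v / v) * (tpow b / tpow b).
  by ring.
by rewrite !divrr ?tpow_unit // !mulr1.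
Qed.

(** Values read off from factorizations, with no valuation involved; the agreement with [value_set]
    is proved once the valuation rings are classified. *)
Definition values (E : set K) : set (I -> int) :=
  [set a | exists2 u, unit_in u & E (u * tpow a)].

Lemma lt_exists a b : (a < b)%O -> exists i, a i < b i.
Proof.
move=> ab; apply: contrapT => N; have := lt_geF ab; suff -> : (b <= a)%O by [].
by apply/lefP => i; rewrite leNgt; apply/negP => ai; apply: N; exists i.
Qed.

(** The localization of [A] at [t i A], as a subset of [K]. The denominators [s] need only avoid
    this maximal ideal and may be zero divisors. *)
Definition vring i : set K := [set y | exists s, [/\ A s, ~ mscale (t i) A s & A (s * y)]].

Let max_submod i : submod_in A (mscale (t i) A).
Proof. exact: maximal_submod. Qed.

Let not_maxM i u v : A u -> A v -> ~ mscale (t i) A u -> ~ mscale (t i) A v ->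
  ~ mscale (t i) A (u * v).
Proof. by move=> Au Av nu nv /(maximal_prime sA (t_max i) Au Av)[]. Qed.

Let not_max1 i : ~ mscale (t i) A 1.
Proof. exact: maximal_proper. Qed.

Lemma sub_vring i : A `<=` vring i.
Proof. by move=> y Ay; exists 1; rewrite mul1r; split=> //; exact: subring1. Qed.

Lemma subring_vring i : is_subring (vring i).
Proof.
split; first by apply: sub_vring; exact: subring1.
- move=> y z [s [As ns Asy]] [s' [As' ns' Asz]]; exists (s * s').
  split; [exact: (subringM sA)|exact: not_maxM|].
  have -> : s * s' * (y - z) = s' * (s * y) - s * (s' * z) by ring.
  by apply: (subringB sA); exact: (subringM sA).
- move=> y z [s [As ns Asy]] [s' [As' ns' Asz]]; exists (s * s').
  split; [exact: (subringM sA)|exact: not_maxM|].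
  have -> : s * s' * (y * z) = (s * y) * (s' * z) by ring.
  exact: (subringM sA).
Qed.

Lemma vring_tV i j : j <> i -> vring i (t j)^-1.
Proof.
move=> ji; exists (t j); rewrite divrr //; split=> //; last exact: subring1.
by move/t_inj/esym.
Qed.

Lemma not_vring_tV i : ~ vring i (t i)^-1.
Proof.
by move=> [s [As ns Ast]]; apply: ns; exists (s / t i) => //; rewrite mulrC divrK.
Qed.

Lemma vring_max i s w : A s -> ~ mscale (t i) A s -> A (s * w) ->
  mscale (t i) (vring i) w <-> mscale (t i) A (s * w).
Proof.
move=> As ns Asw; split=> [[v [s' [As' ns' As'v]] Ew]|[a Aa E]].
  have : mscale (t i) A (s' * (s * w)).
    by exists (s * (s' * v)); [exact: (subringM sA)|rewrite Ew; ring].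
  by move=> /(maximal_prime sA (t_max i) As' Asw)[].
exists ((t i)^-1 * w); last by rewrite mulVKr.
by exists s; split=> //; rewrite mulrCA E mulKr.
Qed.

Lemma vring_maxM i w w' : vring i w -> vring i w' -> ~ mscale (t i) (vring i) w ->
  ~ mscale (t i) (vring i) w' -> ~ mscale (t i) (vring i) (w * w').
Proof.
move=> [s [As ns Asw]] [s' [As' ns' Asw']].
rewrite (vring_max As ns Asw) (vring_max As' ns' Asw') => nw nw'.
have E : s * s' * (w * w') = (s * w) * (s' * w') by ring.
rewrite (@vring_max i (s * s')); [|exact: (subringM sA)|exact: not_maxM|].
  by rewrite E; exact: not_maxM.
by rewrite E; exact: (subringM sA).
Qed.

Lemma tpow_deltaM i (k : int) : tpow (fun j => k * delta i j) = t i ^ k.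
Proof.
rewrite /tpow (bigD1_seq i) //= /delta eqxx mulr1 big1 ?mulr1 // => j /negPf ji.
by rewrite ji mulr0.
Qed.

Lemma tpow_vring i u a : unit_in u -> vring i (u * tpow a) <-> 0 <= a i.
Proof.
move=> uu; have [uuu Au Aui] := uu.
pose p : I -> int := fun j => Num.max 0 (a j); pose n : I -> int := fun j => Num.max 0 (- a j).
have Epn : tpow p = tpow n * tpow a.
  by rewrite -tpowD; congr tpow; apply/funext => j; rewrite /p /n; lia.
have p0 j : 0 <= p j by rewrite /p; lia.
have n0 j : 0 <= n j by rewrite /n; lia.
have Ap := tpow_ge0 p0; have An := tpow_ge0 n0.
split=> [[s [As ns Asa]]|ai].
  rewrite leNgt; apply/negP => ai.
  have : mscale (t i) A ((s * u) * tpow p).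
    rewrite Epn; have -> : (s * u) * (tpow n * tpow a) = (s * (u * tpow a)) * tpow n by ring.
    by apply: (submodM (max_submod i)) => //; apply: tpow_in_max => //; rewrite /n; lia.
  apply: not_maxM => //; first exact: (subringM sA).
    by apply: not_maxM => //; exact: not_max_unit.
  by apply: not_max_tpow => //; rewrite /p; lia.
exists (tpow n); split=> //; first by apply: not_max_tpow => //; rewrite /n; lia.
have -> : tpow n * (u * tpow a) = u * tpow p by rewrite Epn; ring.
exact: (subringM sA).
Qed.

Lemma vring_scale_tpow i u a (k : int) : unit_in u ->
  mscale (t i ^ k) (vring i) (u * tpow a) <-> k <= a i.
Proof.
move=> uu; rewrite mscaleP ?exprz_unit // -tpow_deltaM.
have -> : (tpow (fun j => k * delta i j))^-1 * (u * tpow a)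
    = u * tpow (fun j => a j - k * delta i j) by rewrite tpowB; ring.
by rewrite tpow_vring // /delta eqxx mulr1 subr_ge0.
Qed.

Lemma factor_ge0 y : A y -> y \is a GRing.unit ->
  exists u a, [/\ unit_in u, forall i, 0 <= a i & y = u * tpow a].
Proof.
move=> Ay uy; have [u [a [uu E]]] := factor_in Ay uy; exists u, a; split=> //.
by apply/(tpow_inA a uu); rewrite -E.
Qed.

Lemma clear_denominator i y : exists u a (k : nat),
  [/\ unit_in u, forall j, 0 <= a j, a i = 0 & A (t i ^+ k * (u * tpow a * y))].
Proof.
have [f [c [Af Ac uc E]]] := fracA y; have [u [b [uu b0 Ec]]] := factor_ge0 Ac uc.
exists u, (fun j => b j - b i * delta i j), `|b i|%N; split=> //.
- move=> j; rewrite /delta; case: eqP => [->|_]; first by rewrite mulr1 subrr.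
  by rewrite mulr0 subr0.
- by rewrite /delta eqxx mulr1 subrr.
suff -> : t i ^+ `|b i|%N * (u * tpow (fun j => b j - b i * delta i j) * y) = f by [].
rewrite tpowB tpow_deltaM -E Ec.
have -> : t i ^+ `|b i|%N = t i ^ b i by rewrite exprnP gez0_abs.
have -> : t i ^ b i * (u * (tpow b / t i ^ b i) * y) = (t i ^ b i / t i ^ b i) * (u * tpow b *
  y) by ring.
by rewrite divrr ?exprz_unit // mul1r.
Qed.

Lemma vring_power i y : exists k, vring i (t i ^+ k * y).
Proof.
have [u [a [k [uu a0 ai Aky]]]] := clear_denominator i y; have [_ Au _] := uu.
exists k, (u * tpow a); split; first by apply: (subringM sA) => //; exact: tpow_ge0.
  by apply: not_maxM => //; [exact: tpow_ge0|exact: not_max_unit|exact: not_max_tpow].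
by rewrite mulrCA.
Qed.

Lemma not_vring i y : ~ vring i y -> exists k,
  vring i (t i ^+ k.+1 * y) /\ ~ mscale (t i) (vring i) (t i ^+ k.+1 * y).
Proof.
move=> ny; pose P k := `[< vring i (t i ^+ k * y) >].
have [|[|k] /asboolP Vk kmin] := @ex_minnP P.
- by have [k Vk] := vring_power i y; exists k; apply/asboolP.
- by rewrite mul1r in Vk.
exists k; split=> // -[v Vv E].
have /kmin : P k.
  apply/asboolP; suff -> : t i ^+ k * y = v by [].
  by apply: (mulrI (ut i)); rewrite -E exprS mulrA.
by rewrite ltnn.
Qed.

(** The least powers of [t i] that bring [y] and [z] into the ring bring them outside its maximal
    ideal. Were [y * z] in the ring, the product of the two would be inside. *)
Lemma vring_compl i y z : ~ vring i y -> ~ vring i z -> ~ vring i (y * z).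
Proof.
move=> /not_vring[k [Vk nk]] /not_vring[l [Vl nl]] Vyz; apply: (vring_maxM Vk Vl nk nl).
exists (t i ^+ (k + l.+1) * (y * z)).
  apply: (subringM (subring_vring i)) => //; apply: (subringX (subring_vring i)).
  exact: sub_vring.
by rewrite exprS exprD; ring.
Qed.

Section Classification.
Variable V : set K.
Hypotheses (sV : is_subring V) (AV : A `<=` V).
Hypothesis V_proper : ~ (setT `<=` V).
Hypothesis V_compl : forall y z, ~ V y -> ~ V z -> ~ V (y * z).

Let V_tpow a : (forall i, a i <> 0 -> V (t i)^-1) -> V (tpow a).
Proof.
move=> Va; apply: (subring_prod sV) => i _; have [->|/eqP ai] := eqVneq (a i) 0.
  by rewrite expr0z; exact: subring1.
have Vt : V (t i) by exact: AV.
by move: (Va i ai); case: (a i) => k Vti; [|rewrite -[_ ^ _]/((t i ^+ k.+1)^-1) -exprVn];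
   exact: (subringX sV).
Qed.

(** Some [t i] is not invertible in [V], as otherwise all denominators would be. It is the only one:
    with [b] inverse to [t j] modulo [t i], both [b * t j / t i] and [(1 - b * t j) / t j] would be
    outside [V], yet their product is in [A]. Then [V] inverts all monomials without [t i], and an
    element of [V] outside [vring i] would invert [t i]. *)
Lemma vring_classification : exists i, V = vring i.
Proof.
have [i Vi] : exists i, ~ V (t i)^-1.
  apply: contrapT => N; apply: V_proper => y _.
  have [f [c [Af Ac uc E]]] := fracA y; have [u [b [[uu Au Aui] b0 Ec]]] := factor_ge0 Ac uc.
  have -> : y = u^-1 * tpow (fun j => - b j) * f.
    apply: (mulrI uc); rewrite E Ec tpowN.
    have -> : u * tpow b * (u^-1 * (tpow b)^-1 * f) = (u / u) * (tpow b / tpow b) * f by ring.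
    by rewrite !divrr ?tpow_unit // !mul1r.
  apply: (subringM sV); last exact: AV.
  apply: (subringM sV); first exact: AV.
  by apply: V_tpow => j _; apply: contrapT => nj; apply: N; exists j.
have Vj j : j <> i -> V (t j)^-1.
  move=> ji; apply: contrapT => nVj.
  have [b Ab [c Ac Ec]] : exists2 b, A b & mscale (t i) A (1 - b * t j).
    by apply: (maximal_inv sA (t_max i)) => // /t_inj/esym.
  have Epq : (b * t j / t i) * ((1 - b * t j) / t j) = b * c.
    rewrite Ec;
      have -> : b * t j / t i * (t i * c / t j) = b * c * (t i / t i) * (t j / t j) by ring.
    by rewrite !divrr // !mulr1.
  have : V (b * c) by apply: AV; exact: (subringM sA).
  rewrite -Epq; apply: V_compl => H.
    apply: Vi; have -> : (t i)^-1 = b * t j / t i + c.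
      by rewrite -[c](mulKr (ut i)) -Ec; ring.
    by apply: (subringD sV) => //; exact: AV.
  apply: nVj; have -> : (t j)^-1 = (1 - b * t j) / t j + b.
    by rewrite mulrBl mul1r mulrK // subrK.
  by apply: (subringD sV) => //; exact: AV.
exists i; apply/seteqP; split=> y.
  move=> Vy; apply: contrapT => /not_vring[k [[s [As ns Asw]]]].
  rewrite (vring_max As ns Asw) => nw.
  have [b Ab [c Ac Ec]] := maximal_inv sA (t_max i) Asw nw.
  apply: Vi; have -> : (t i)^-1 = c + b * (s * (t i ^+ k * y)).
    apply: (mulrI (ut i)); rewrite divrr // mulrDr -Ec exprS; ring.
  apply: (subringD sV); first exact: AV.
  have Vt : V (t i ^+ k) by apply: (subringX sV); exact: AV.
  by apply: (subringM sV); [exact: AV|apply: (subringM sV); [exact: AV|exact: (subringM sV)]].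
move=> Vy; have [u [a [k [uu a0 ai Aky]]]] := clear_denominator i y; have [uuu Au Aui] := uu.
(* Membership in [vring i] removes the powers of [t i] from a denominator, leaving only monomials
   invertible in [V]. *)
have step v : vring i v -> A (t i * v) -> A v.
  move=> [s [As ns Asv]] Atv.
  have : mscale (t i) A (s * (t i * v)) by exists (s * v) => //; ring.
  move=> /(maximal_prime sA (t_max i) As Atv)[//|[w Aw E]].
  by rewrite (mulrI (ut i) E).
have Vv : vring i (u * tpow a * y).
  apply: (subringM (subring_vring i)) => //; apply: sub_vring.
  by apply: (subringM sA) => //; exact: tpow_ge0.
have Av : A (u * tpow a * y).
  elim: k Aky => [|k IH]; first by rewrite mul1r.
  rewrite exprS -mulrA => /step H; apply: IH; apply: H.
  apply: (subringM (subring_vring i)) => //; apply: sub_vring; exact: (subringX sA).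
have -> : y = u^-1 * tpow (fun j => - a j) * (u * tpow a * y).
  rewrite tpowN;
    have -> : u^-1 * (tpow a)^-1 * (u * tpow a * y) = (u / u) * (tpow a / tpow a) * y by ring.
  by rewrite !divrr ?tpow_unit // !mul1r.
apply: (subringM sV); last exact: AV.
apply: (subringM sV); first exact: AV.
apply: V_tpow => j; have [->|/eqP ji _] := eqVneq j i; last exact: Vj.
by rewrite ai oppr0.
Qed.

End Classification.

Lemma vring_inj i j : vring i = vring j -> i = j.
Proof.
move=> E; apply: contrapT => ij; apply: (@not_vring_tV i); rewrite E; exact: vring_tV.
Qed.

Lemma vring_neqT i : ~ (setT `<=` vring i).
Proof. by move=> H; apply: (@not_vring_tV i); exact: H. Qed.

Lemma vring_maximal i : maximal_in (vring i) (mscale (t i) (vring i)).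
Proof.
have sV := subring_vring i.
have sM : submod_in (vring i) (mscale (t i) (vring i)).
  by apply: submod_mscale; exact: submod_subring.
have n1 : ~ mscale (t i) (vring i) 1.
  by move=> [v Vv E]; apply: (@not_vring_tV i); rewrite -(mulr1 (t i)^-1) E mulKr.
have MV : mscale (t i) (vring i) `<=` vring i.
  by move=> _ [v Vv ->]; apply: (subringM sV) => //; exact: sub_vring.
split=> //; first by split=> // H; apply: n1; apply: H; exact: subring1.
move=> J [sJ JV] MJ; have [JM|nJM] := pselect (J `<=` mscale (t i) (vring i)).
  by left; apply/seteqP.
have [w Jw nw] : exists2 w, J w & ~ mscale (t i) (vring i) w.
  by apply: contrapT => H; apply: nJM => w Jw; apply: contrapT => nw; apply: H; exists w.
right; apply/seteqP; split=> //; apply: submod_full => //.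
have [s [As ns Asw]] := JV w Jw; rewrite (vring_max As ns Asw) in nw.
have [b Ab [c Ac Ec]] := maximal_inv sA (t_max i) Asw nw.
have -> : 1 = t i * c + b * s * w by rewrite -Ec; ring.
apply: (submodD sJ); first by apply: MJ; exists c => //; exact: sub_vring.
by apply: (submodM sJ) => //; apply: sub_vring; exact: (subringM sA).
Qed.

(** When [K] is a product of fields there can be other maximal ideals, but without units of [K]. A
    unit in [m] puts a power of [t i] there, the other [t j] being invertible in [vring i]. *)
Lemma vring_maximal_unique i m y : maximal_in (vring i) m -> m y -> y \is a GRing.unit ->
  m = mscale (t i) (vring i).
Proof.
move=> mm my uy; have sV := subring_vring i; have sm := maximal_submod mm.
have [u [a [uu Ey]]] := factor_unit uy; have [uuu Au Aui] := uu.
have mta : m (t i ^ (a i)).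
  have -> : t i ^ a i = (u^-1 * tpow (fun j => a i * delta i j - a j)) * y.
    rewrite tpowB tpow_deltaM Ey.
    have -> : u^-1 * (t i ^ a i / tpow a) * (u * tpow a) = t i ^ a i * (u / u) * (tpow a / tpow
      a) by ring.
    by rewrite !divrr ?tpow_unit // !mulr1.
  apply: (submodM sm) => //; apply/(tpow_vring i _ (unit_inV uu)).
  by rewrite /delta eqxx mulr1 subrr.
have m1 := maximal_proper mm; have Vt : vring i (t i) by exact: sub_vring.
have [n Ea] : exists n : nat, a i = n.+1.
  move: mta; case: (a i) => [[|n]|n] mt; [by []|by exists n|case: m1].
  have -> : 1 = t i ^+ n.+1 * t i ^ Negz n.
    by rewrite NegzE exprnP -exprzDr // subrr.
  by apply: (submodM sm) => //; exact: (subringX sV).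
have mt : m (t i).
  move: mta; rewrite Ea; elim: n {Ea} => [|n IH]; first by [].
  rewrite -exprnP exprS => /(maximal_prime sV mm Vt)[] //; exact: (subringX sV).
have Mm : mscale (t i) (vring i) `<=` m.
  by move=> _ [v Vv ->]; rewrite mulrC; exact: (submodM sm).
have [_ _ H] := vring_maximal i; have [||//|E] := H m => //; first by case: mm.
by case: m1; rewrite E; exact: (subring1 sV).
Qed.

(** * The filtration of a submodule by values *)

Variable B : set K.
Hypotheses (sB : is_subring B) (BA : B `<=` A).
Hypothesis vnr : forall y, exists z, y = y * y * z.
Hypothesis general_position : forall f g, A f -> A g ->
  (forall i, ~ (mscale (t i) A f /\ mscale (t i) A g)) ->
  exists r s, [/\ B r, B s & forall i, ~ mscale (t i) A (r * f + s * g)].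
Hypothesis residue : forall i w, A w -> exists2 r, B r & mscale (t i) A (w - r).

Lemma sub_AB M : submod_in A M -> submod_in B M.
Proof. by case=> M0 MD MM; split=> // r z /BA; exact: MM. Qed.

Lemma submod_tpow a : submod_in B (mscale (tpow a) A).
Proof. by apply: submod_mscale; apply: sub_AB; exact: submod_subring. Qed.

Section Module.
Variable E : set K.
Hypothesis sE : submod_in B E.
Hypothesis E_low : exists d, mscale (tpow d) A `<=` E.
Hypothesis E_high : exists d, E `<=` mscale (tpow d) A.

(* Adding a high power of the [t i] times the idempotent complementary to [w]
   makes [w] a unit without changing its position in the filtration. *)
Lemma regularize w a b : E w -> mscale (tpow a) A w -> ~ mscale (tpow b) A w ->
  exists d, [/\ values E d, (a <= d)%O & ~ (b <= d)%O].
Proof.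
move=> Ew wa wb; have [d0 Hd0] := E_low; have [c Ec] := vnr w.
pose e := 1 - w * c.
have we : w * e = 0.
  have -> : w * e = w - w * w * c by rewrite /e; ring.
  by rewrite -Ec subrr.
have [f [k [Af Ak uk Ef]]] := fracA e; have [v [xi [uv Ek]]] := factor_unit uk.
(* Beyond [d0] the correction lies in [E], beyond [a] and [b] it does not affect the two filtration
   conditions, and [xi] absorbs the denominator of [e]. *)
pose D : I -> int := fun i => Num.max (d0 i) (Num.max (a i) (b i)) + xi i.
have HT s : (forall i, s i <= D i - xi i) -> mscale (tpow s) A (tpow D * e).
  move=> sD; have [uuv Av Avi] := uv.
  exists (tpow (fun i => D i - xi i - s i) * (v^-1 * f)).
    apply: (subringM sA); last exact: (subringM sA).
    by apply: tpow_ge0 => i; rewrite subr_ge0.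
  rewrite -Ef Ek tpowB tpowB.
  have -> : tpow s * (tpow D / tpow xi / tpow s * (v^-1 * (v * tpow xi * e))) =
    (tpow s / tpow s) * (v / v) * (tpow xi / tpow xi) * (tpow D * e) by ring.
  by rewrite !divrr ?tpow_unit // !mul1r.
have ET : E (tpow D * e) by apply: Hd0; apply: HT => i; rewrite /D; lia.
have Ta : mscale (tpow a) A (tpow D * e) by apply: HT => i; rewrite /D; lia.
have Tb : mscale (tpow b) A (tpow D * e) by apply: HT => i; rewrite /D; lia.
pose z := w + tpow D * e.
have uz : z \is a GRing.unit.
  (* [w * c] and [e] are complementary idempotents; the summands invert [w] on the first part and
     [tpow D] on the second. *)
  apply/unitrPr; exists (c * (w * c) + (tpow D)^-1 * e); rewrite /z.
  have -> : (w + tpow D * e) * (c * (w * c) + (tpow D)^-1 * e) =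
    (w * w * c) * c + (w * e) * (tpow D)^-1 + tpow D * c * c * (w * e)
    + (tpow D / tpow D) * (e * e) by ring.
  rewrite -Ec we divrr ?tpow_unit //.
  have -> : e * e = e - (w * e) * c by rewrite /e; ring.
  by rewrite we /e; ring.
have [u [d [uu Ez]]] := factor_unit uz; exists d.
have sub s : submod_in A (mscale (tpow s) A) by apply: submod_mscale; exact: submod_subring.
split.
- by exists u => //; rewrite -Ez; exact: (submodD sE).
- by apply/(tpow_le d a uu); rewrite -Ez; exact: (submodD (sub a)).
- move/(tpow_le d b uu); rewrite -Ez => zb; apply: wb.
  have -> : w = z - tpow D * e by rewrite /z addrK.
  exact: (submodB sA (sub b)).
Qed.

Lemma regularize1 w b : E w -> ~ mscale (tpow b) A w ->
  exists2 d, values E d & ~ (b <= d)%O.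
Proof.
move=> Ew wb; have [a0 Ha0] := E_high.
by have [d [Ed _ bd]] := regularize Ew (Ha0 _ Ew) wb; exists d.
Qed.

(** After division by the monomial of the minimum, no [t i] divides both elements. A combination
    over [B] that avoids every [t i A] is then a unit of [A]. *)
Lemma values_min a b : values E a -> values E b ->
  values E (fun i => Num.min (a i) (b i)).
Proof.
move=> [u uu Ea] [v uv Eb]; pose m : I -> int := fun i => Num.min (a i) (b i).
pose f := u * tpow (fun i => a i - m i); pose g := v * tpow (fun i => b i - m i).
have am i : 0 <= a i - m i by rewrite /m; lia.
have bm i : 0 <= b i - m i by rewrite /m; lia.
have Af : A f by apply/tpow_inA.
have Ag : A g by apply/tpow_inA.
have nmul i w c : unit_in w -> (forall j, 0 <= c j) -> c i = 0 ->
    ~ mscale (t i) A (w * tpow c).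
  move=> uw c0 ci; have [_ Aw _] := uw.
  by move=> /(maximal_prime sA (t_max i) Aw (tpow_ge0 c0))[/(not_max_unit uw)|/(not_max_tpow c0
    ci)].
have [|r [s [Br Bs nz]]] := general_position Af Ag.
  move=> i [fi gi]; have [ab|ba] := leP (a i) (b i).
    by apply: (nmul i _ _ uu am _ fi); rewrite /m; lia.
  by apply: (nmul i _ _ uv bm _ gi); rewrite /m; lia.
exists (r * f + s * g).
  apply: unit_inP => //; apply: (subringD sA); apply: (subringM sA) => //; exact: BA.
have -> : (r * f + s * g) * tpow m = r * (u * tpow a) + s * (v * tpow b).
  rewrite /f /g !tpowB.
  have -> : (r * (u * (tpow a / tpow m)) + s * (v * (tpow b / tpow m))) * tpow m =
    (r * (u * tpow a) + s * (v * tpow b)) * (tpow m / tpow m) by ring.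
  by rewrite divrr ?tpow_unit // mulr1.
by apply: (submodD sE); apply: (submodM sE).
Qed.

(** Descent from an exponent [D] deep enough for [E_low], one coordinate at a time. An element of
    [E] with value [d], scaled from [B] by residual rationality, reduces [tpow d * A] to
    [tpow (d + delta i) * A]. *)
Lemma conductor_sub a : (forall b, (a <= b)%O -> values E b) -> mscale (tpow a) A `<=` E.
Proof.
move=> Ha; have [d0 Hd0] := E_low.
pose D : I -> int := fun i => Num.max (d0 i) (a i).
suff H k d : (a <= d)%O -> (d <= D)%O -> (\sum_(i <- ind) `|D i - d i|%N)%N = k ->
    mscale (tpow d) A `<=` E.
  by apply: (H _ a) => //; apply/lefP => i; rewrite /D; lia.
elim: k d => [|k IH] d ad dD dk.
  have -> : d = D.
    apply/funext => i; move/lefP: dD => /(_ i) dD.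
    move/eqP: dk; rewrite sum_nat_seq_eq0 => /allP/(_ i (mem_ind i)) /=.
    by rewrite /= ; lia.
  by apply: subset_trans Hd0; apply: sub_tpow; apply/lefP => i; rewrite /D; lia.
have [i di] : exists i, d i < D i.
  apply: contrapT => N; have : d = D.
    apply/funext => i; apply/eqP; rewrite eq_le (lefP _ _ dD) /= leNgt; apply/negP => di.
    by apply: N; exists i.
  move=> E1; have : (0 < k.+1)%N by []; rewrite -dk lt0n sum_nat_seq_eq0 => /negP; apply.
  by apply/allP => j _; rewrite E1 subrr.
pose d' : I -> int := fun j => d j + delta i j.
have dd' : (d <= d')%O by apply/lefP => j; rewrite /d' /delta; lia.
have Hd' : mscale (tpow d') A `<=` E.
  apply: IH; first exact: le_trans dd'.
    apply/lefP => j; rewrite /d' /delta; case: eqP => [->|_]; first by lia.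
    by rewrite addr0; exact: (lefP _ _ dD).
  apply/eqP; rewrite -eqSS -dk; apply/eqP.
  rewrite (bigD1_seq i) //= [RHS](bigD1_seq i) //=.
  rewrite [X in (_ + X).+1%N = _](eq_bigr (fun j => `|D j - d j|%N)); last first.
    by move=> j /negPf ji; rewrite /d' /delta ji addr0.
  by rewrite -addSn; congr addn; rewrite /d' /delta eqxx; lia.
have [u uu Eu] := Ha d ad; have [uuu Au Aui] := uu.
move=> _ [w Aw ->]; have [r Br [q Aq Eq]] := residue i (subringM sA Aw Aui).
rewrite -(subrK (r * (u * tpow d)) (tpow d * w)); apply: (submodD sE).
  apply: Hd'; exists (u * q); first exact: (subringM sA).
  rewrite /d' tpowD tpow_delta.
  have -> : tpow d * t i * (u * q) = tpow d * u * (t i * q) by ring.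
  rewrite -Eq;
    have -> : tpow d * u * (w / u - r) = tpow d * w * (u / u) - r * (u * tpow d) by ring.
  by rewrite divrr // mulr1.
exact: (submodM sE).
Qed.

Definition filt a : set K := E `&` mscale (tpow a) A.

Lemma submod_filt a : submod_in B (filt a).
Proof. by apply: submodI => //; exact: submod_tpow. Qed.

(** For a coordinate [i] with [a i < b i] and [a' = a + delta i], it turns out that [filt a'] equals
    [filt b]. The quotient thus embeds in [tpow a * A / tpow a' * A], a single copy of the residue
    field at [i]. *)
Lemma covers_length a b : values E a -> values E b -> covers (values E) a b ->
  has_len B (filt b) (filt a) 1.
Proof.
move=> va vb [ab nab]; have [i ai] := lt_exists ab.
have ab' := ltW ab; have [u uu Eu] := va; have [uuu Au Aui] := uu.
pose a' : I -> int := fun j => a j + delta i j.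
have aa' : (a <= a')%O by apply/lefP => j; rewrite /a' /delta; lia.
have a'b : (a' <= b)%O.
  apply/lefP => j; rewrite /a' /delta; have := lefP _ _ ab' j.
  by case: eqP => [->|_]; rewrite ?addr0 //; lia.
have fa'b : filt a' `<=` filt b.
  move=> w [Ew wa']; split=> //; apply: contrapT => wb.
  have [d [vd a'd bd]] := regularize Ew wa' wb.
  apply: (nab _ (values_min vd vb)); split.
    rewrite lt_neqAle; apply/andP; split.
      apply/eqP => Ea; have /= := congr1 (fun f => f i) Ea.
      by have := lefP _ _ a'd i; rewrite /a' /delta eqxx; lia.
    apply/lefP => j; have := lefP _ _ ab' j; have := lefP _ _ a'd j.
    by have := lefP _ _ aa' j; lia.
  rewrite lt_neqAle; apply/andP; split; last by apply/lefP => j; lia.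
  apply/eqP => Eb; apply: bd; apply/lefP => j.
  by have := congr1 (fun f => f j) Eb; lia.
have Ea : filt a (u * tpow a) by split=> //; apply/tpow_le.
have nEa : ~ filt b (u * tpow a).
  by move=> [_ /(tpow_le a b uu)]; rewrite (lt_geF ab).
apply: has_len1; [exact: submod_filt|exact: submod_filt| |].
  split; last by move=> H; apply: nEa; exact: H.
  by move=> w [Ew wb]; split=> //; exact: sub_tpow wb.
move=> X sX [bX nXb] Xa.
have [w Xw nwb] : exists2 w, X w & ~ filt b w.
  by apply: contrapT => H; apply: nXb => w Xw; apply: contrapT => nw; apply: H; exists w.
have [Ew [f Af Ew']] := Xa w Xw.
have nfi : ~ mscale (t i) A f.
  move=> [q Aq Eq]; apply: nwb; apply: fa'b; split=> //; exists q => //.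
  by rewrite /a' tpowD tpow_delta Ew' Eq; ring.
have [g Ag [q Aq Eq]] := maximal_inv sA (t_max i) Af nfi.
move=> z [Ez [h Ah Ezh]]; rewrite {z}Ezh in Ez *.
have [r Br [q' Aq' Eq']] := residue i (subringM sA Ah Ag).
rewrite -(subrK (r * w) (tpow a * h)).
have Xrw : X (r * w) by exact: (submodM sX).
apply: (submodD sX) => //; apply: bX; apply: fa'b; split.
  by apply: (submodB sB sE) => //; exact: (submodM sE).
exists (h * q + q' * f); first by apply: (subringD sA); exact: (subringM sA).
rewrite /a' tpowD tpow_delta Ew'.
have -> : tpow a * t i * (h * q + q' * f) = tpow a * (h * (t i * q) + (t i * q') * f) by ring.
by rewrite -Eq -Eq'; ring.
Qed.

Lemma chain_length n (c : nat -> I -> int) : chain (covers (values E)) (values E) n c ->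
  has_len B (filt (c n)) (filt (c 0%N)) n.
Proof.
elim: n => [|n IH] [cE cc]; first by apply: has_len_refl; exact: submod_filt.
have mono a b : (a <= b)%O -> filt b `<=` filt a.
  by move=> ab w [Ew wb]; split=> //; exact: sub_tpow wb.
have c0n m : (m <= n)%N -> (c 0%N <= c m)%O.
  elim: m => // m IHm mn; apply: (le_trans (IHm (ltnW mn))).
  by have [cm _] := cc m (leqW mn); exact: ltW.
have cn := cc n (leqnn _); have [/ltW ltn _] := cn.
rewrite -[X in has_len _ _ _ X]add1n; apply: (has_len_add sB (submod_filt (c n)));
  [exact: mono|exact: mono (c0n n _)|exact: submod_filt| |].
- by apply: covers_length => //; apply: cE; rewrite ?leqnn.
- by apply: IH; split=> [i /leqW|i /leqW]; [exact: cE|exact: cc].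
Qed.

(** The next member is a value in the interval nearest to [a]; anything strictly between would be
    nearer. *)
Lemma saturated_chain a b : values E a -> values E b -> (a <= b)%O ->
  exists n (c : nat -> I -> int),
    [/\ chain (covers (values E)) (values E) n c, c 0%N = a & c n = b].
Proof.
pose dist (c b' : I -> int) : nat := (\sum_(i <- ind) `|b' i - c i|%N)%N.
have dist_lt c c' d : (c < c')%O -> (c' <= d)%O -> (dist c c' <= dist c d)%N /\
    (dist c' d < dist c d)%N.
  move=> cc' c'd; have [i ci] := lt_exists cc'; split.
    rewrite /dist big_seq [leqRHS]big_seq; apply: leq_sum => j _.
    by have := lefP _ _ (ltW cc') j; have := lefP _ _ c'd j; lia.
  rewrite /dist (bigD1_seq i) //= [ltnRHS](bigD1_seq i) //= -addSn; apply: leq_add.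
    by have := lefP _ _ c'd i; lia.
  apply: leq_sum => j _.
  by have := lefP _ _ (ltW cc') j; have := lefP _ _ c'd j; lia.
have [m] := ubnP (dist a b); elim: m a => // m IH a mab va vb ab.
have [->|nab] := eqVneq a b; first by exists 0%N, (fun=> b); split=> //; split=> // -[].
have {nab} ab1 : (a < b)%O by rewrite lt_neqAle nab.
pose P (k : nat) := `[< exists c : I -> int, [/\ values E c, (a < c)%O, (c <= b)%O & dist a c =
  k] >].
have [k /asboolP[c [vc ac cb dk]] kmin] : exists2 k, P k & forall j : nat, P j -> (k <= j)%N.
  have [|k Pk kmin] := @ex_minnP P; last by exists k.
  by exists (dist a b); apply/asboolP; exists b.
have cac : covers (values E) a c.
  split=> // d vd [ad dc].
  have /kmin : P (dist a d).
    by apply/asboolP; exists d; split=> //; exact: le_trans (ltW dc) cb.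
  rewrite -dk leqNgt => /negP; apply.
  have [i di] := lt_exists dc.
  rewrite /dist (bigD1_seq i) //= [ltnRHS](bigD1_seq i) //= -addSn; apply: leq_add.
    by have := lefP _ _ (ltW ad) i; lia.
  by apply: leq_sum => j _; have := lefP _ _ (ltW ad) j; have := lefP _ _ (ltW dc) j; lia.
have [|//|//|n [h [[hE hc] h0 hn]]] := IH c _ vc.
  by have [_ H] := dist_lt _ _ _ ac cb; exact: (leq_trans H).
exists n.+1, (fun k : nat => if k is k'.+1 then h k' else a); split=> //; split.
  by case=> // j; exact: hE.
by case=> [_|j]; [rewrite h0|exact: hc].
Qed.

(** [chain_dist] selects an unspecified chain. Existence rules out its default value, and every
    chain computes the same length. *)
Lemma chain_dist_length a b : values E a -> values E b -> (a <= b)%O ->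
  has_len B (filt b) (filt a) (chain_dist (values E) a b).
Proof.
move=> va vb ab; rewrite /chain_dist; case: xgetP => [n _ [c [cc <- <-]]|N].
  exact: chain_length.
by have [n [c cP]] := saturated_chain va vb ab; case: (N n); exists c.
Qed.

Lemma values_nonempty d : mscale (tpow d) A `<=` E -> forall b, (d <= b)%O -> values E b.
Proof.
move=> Hd b db; exists 1; first exact: unit_in1.
by apply: Hd; apply/tpow_le => //; exact: unit_in1.
Qed.

(** An element of least total excess over [l] is the minimum: its componentwise minimum with an
    element not above it would have smaller excess. *)
Lemma minimum_exists (S : set (I -> int)) l : S !=set0 -> lbound S l ->
  (forall a b, S a -> S b -> S (fun i => Num.min (a i) (b i))) ->
  S (minimum (fun=> 0) S) /\ lbound S (minimum (fun=> 0) S).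
Proof.
move=> [a0 Sa0] lS Smin.
suff : exists c, (S `&` lbound S) c by move=> /(xgetPex (fun=> 0)).
pose dist (b : I -> int) : nat := (\sum_(i <- ind) `|b i - l i|%N)%N.
pose P (k : nat) := `[< exists2 c, S c & dist c = k >].
have [k /asboolP[c Sc dk] kmin] : exists2 k, P k & forall j : nat, P j -> (k <= j)%N.
  have [|k Pk kmin] := @ex_minnP P; last by exists k.
  by exists (dist a0); apply/asboolP; exists a0.
exists c; split=> // b Sb; apply/lefP => i; rewrite leNgt; apply/negP => bc.
have /kmin : P (dist (fun i => Num.min (c i) (b i))).
  by apply/asboolP; exists (fun i => Num.min (c i) (b i)) => //; exact: Smin.
rewrite -dk leqNgt => /negP; apply.
have lc := lefP _ _ (lS _ Sc); have lb := lefP _ _ (lS _ Sb).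
rewrite /dist (bigD1_seq i) //= [ltnRHS](bigD1_seq i) //= -addSn; apply: leq_add.
  by have := lc i; have := lb i; lia.
by apply: leq_sum => j _; have := lc j; have := lb j; lia.
Qed.

Lemma values_lbound : exists l, lbound (values E) l.
Proof.
have [d Hd] := E_high; exists d => a [u uu /Hd]; by move/(tpow_le a d uu).
Qed.

Lemma mu_values : values E (mu (values E)) /\ lbound (values E) (mu (values E)).
Proof.
have [d Hd] := E_low; have [l lE] := values_lbound.
apply: (minimum_exists _ lE); first by exists d; exact: (values_nonempty Hd).
by move=> a b; exact: values_min.
Qed.

Lemma colonP a : set_colon (values E) (@nonneg I) a <-> forall b, (a <= b)%O -> values E b.
Proof.
split=> [H b /lefP ab|H b b0].
  have -> : b = a + (fun i => b i - a i) by apply/funext => i; rewrite /= addrC subrK.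
  by apply: H => i; rewrite subr_ge0.
by apply: H; apply/lefP => i /=; rewrite lerDl; exact: b0.
Qed.

Lemma gamma_values b : (gamma (values E) <= b)%O -> values E b.
Proof.
move: b; apply/colonP; have [d Hd] := E_low; have [l lE] := values_lbound.
have [] // := @minimum_exists (set_colon (values E) (@nonneg I)) l.
- by exists d; apply/colonP; exact: values_nonempty.
- by move=> a /colonP H; apply: lE; exact: H.
move=> a b /colonP Ha /colonP Hb; apply/colonP => c mc.
(* A point above [min(a, b)] is the minimum of a point above [a] and a point above [b]. *)
have -> : c = (fun i => Num.min (Num.max (a i) (c i)) (Num.max (b i) (c i))).
  by apply/funext => i; have /= := lefP _ _ mc i; lia.
apply: values_min; first by apply: Ha; apply/lefP => i; lia.
by apply: Hb; apply/lefP => i; lia.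
Qed.

(** This concerns zero divisors as well: an element of [E] outside [filt mu] would regularize to a
    value not above the minimum. *)
Lemma filt_mu : filt (mu (values E)) = E.
Proof.
apply/seteqP; split=> [w []//|w Ew]; split=> //; apply: contrapT => nw.
have [d vd nd] := regularize1 Ew nw; apply: nd.
by have [_ H] := mu_values; exact: H.
Qed.

Lemma gamma_sub : mscale (tpow (gamma (values E))) A `<=` E.
Proof. exact: (conductor_sub gamma_values). Qed.

End Module.

Theorem length_distance (E F : set K) : submod_in B E -> submod_in B F -> E `<=` F ->
  (exists d, mscale (tpow d) A `<=` E) -> (exists d, F `<=` mscale (tpow d) A) ->
  exists2 n, has_len B E F n & distance (values F) (values E) = n%:Z.
Proof.
move=> sE sF EF [d Hd] [d' Hd'].
have El : exists d, mscale (tpow d) A `<=` E by exists d.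
have Fl : exists d, mscale (tpow d) A `<=` F by exists d; exact: subset_trans EF.
have Eh : exists d, E `<=` mscale (tpow d) A by exists d'; exact: subset_trans Hd'.
have Fh : exists d, F `<=` mscale (tpow d) A by exists d'.
set g := gamma (values E).
have [muE lE] := mu_values sE El Eh; have [muF lF] := mu_values sF Fl Fh.
have vg : values E g by apply: (gamma_values sE El Eh).
have vFg : values F g by have [u uu ug] := vg; exists u => //; exact: EF.
have gE := gamma_sub sE El Eh.
have H1 := chain_dist_length sE El muE vg (lE _ vg).
have H2 := chain_dist_length sF Fl muF vFg (lF _ vFg).
rewrite filt_mu // in H1; rewrite filt_mu // in H2.
(* Both chains end in the same module, so the two chain lengths differ by the length of [F / E]. *)
have Eg : filt E g = mscale (tpow g) A by apply/seteqP; split=> [w []|w wg] //; split=> //;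
  exact: gE.
have Fg : filt F g = mscale (tpow g) A.
  by apply/seteqP; split=> [w []|w wg] //; split=> //; apply: EF; exact: gE.
rewrite Eg in H1; rewrite Fg in H2.
have [n Hn] : exists n, has_len B E F n.
  by case: H2 => H _; apply: (len_le_has sE EF); apply: len_le_mono H.
exists n => //; have H3 := has_len_add sB sE gE EF sF H1 Hn.
rewrite /distance -/g (has_len_uniq H2 H3) PoszD; lia.
Qed.

End SemilocalPrincipal.

(** * The total ring of fractions *)

Section TotalFractionUnits.
Variable R : comNzRingType.
Local Notation Q := (total_frac R).

Definition frac_unit : {pred Q} := [pred y : Q | `[< exists z, z * y = 1 >]].
(** The default [y] makes inversion the identity outside the units, as the unit ring structure
    demands. *)
Definition frac_inv (y : Q) : Q := xget y [set z | z * y = 1].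

Lemma frac_mulVx : {in frac_unit, left_inverse 1 frac_inv *%R}.
Proof. by move=> y /asboolP uy; exact: (xgetPex y uy). Qed.

Lemma frac_unitPl (y z : Q) : z * y = 1 -> frac_unit y.
Proof. by move=> E; apply/asboolP; exists z. Qed.

Lemma frac_inv_out : {in [predC frac_unit], frac_inv =1 id}.
Proof.
by move=> y /asboolP uy; apply: xgetPN => z /= E; apply: uy; exists z.
Qed.

HB.instance Definition _ := GRing.ComNzRing_hasMulInverse.Build Q
  frac_mulVx frac_unitPl frac_inv_out.

Local Notation iota := (loc_of (regular_mulset R)).
Implicit Types (a s : R) (y : Q).

Lemma iota_inj : injective iota.
Proof.
move=> a b /mkfrac_eq[t rt /eqP]; rewrite !mulr1 -(mulr0 t) => /eqP/rt/eqP.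
by rewrite subr_eq0 => /eqP.
Qed.

Lemma frac_repr y : exists a s, regular s /\ y * iota s = iota a.
Proof.
have [a [s [sS ->]]] := mkfrac_surj y; exists a, s; split=> //.
rewrite -[LHS]/(loc_mul _ _) mkfracM; apply/mkfrac_eq; exists 1; first exact: mulset1.
by ring.
Qed.

Lemma iota_unit s : regular s -> iota s \is a GRing.unit.
Proof.
move=> rs; apply/unitrPr; exists (@mkfrac R (regular_mulset R) 1 s rs).
rewrite -[LHS]/(loc_mul _ _) mkfracM; apply/mkfrac_eq; exists 1; first exact: mulset1.
by ring.
Qed.

(** The numerator of a regular fraction is regular in [R], and regular elements of [R] are inverted
    by construction. *)
Lemma regular_unit y : @regular Q y <-> y \is a GRing.unit.
Proof.
split=> [ry|]; last exact: unit_lreg.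
have [a [s [rs E]]] := frac_repr y; have us := iota_unit rs.
suff ra : regular a by have := iota_unit ra; rewrite -E unitrM us andbT.
move=> b c bc; apply: iota_inj; apply: (mulrI us); apply: ry.
by rewrite !mulrA E -!rmorphM bc.
Qed.

End TotalFractionUnits.

Section PowersOfPrincipal.
Variables (K : comUnitRingType) (V : set K) (t : K).
Hypotheses (sV : is_subring V) (ut : t \is a GRing.unit).

Lemma prod_mscale (a b : K) : prod_in V (mscale a V) (mscale b V) = mscale (a * b) V.
Proof.
have sM := submod_mscale (a * b) (submod_subring sV).
apply/seteqP; split.
  apply: span_sub => // _ [_ [_ [[x Vx ->] [y Vy ->] ->]]].
  by exists (x * y); [exact: subringM|ring].
move=> _ [x Vx ->]; apply: sub_span; exists (a * x), (b * 1); split; last by ring.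
- by exists x.
- by exists 1 => //; exact: subring1.
Qed.

Lemma pow_mscale n : pow_in V (mscale t V) n = mscale (t ^+ n) V.
Proof.
elim: n => [|n IH]; first by rewrite mscale1.
by rewrite exprS -prod_mscale -IH.
Qed.

Lemma inv_mscale : inv_in V (mscale t V) = mscale t^-1 V.
Proof.
apply/seteqP; split=> [y Hy|_ [v Vv ->] _ [w Vw ->]].
  exists (t * y); last by rewrite mulKr.
  by rewrite mulrC; apply: Hy; exists 1; [exact: subring1|rewrite mulr1].
have -> : t^-1 * v * (t * w) = (t / t) * (v * w) by ring.
by rewrite divrr // mul1r; exact: subringM.
Qed.

End PowersOfPrincipal.

Lemma zpow_mscale (K : comUnitRingType) (V : set K) (t : K) (k : int) : is_subring V ->
  t \is a GRing.unit -> zpow_in V (mscale t V) k = mscale (t ^ k) V.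
Proof.
move=> sV ut; case: k => n; first exact: pow_mscale.
by rewrite /zpow_in inv_mscale // pow_mscale // exprVn.
Qed.

(** * Transport along the embedding of [R] into its fractions *)

Section RangeTransfer.
Variable R : comNzRingType.
Local Notation Q := (total_frac R).
Local Notation iota := (loc_of (regular_mulset R)).
Local Notation B := (range iota).
Hypothesis noeth : noetherian R.
Hypothesis dim1 : forall P Q M : set R,
  prime_in setT P -> prime_in setT Q -> prime_in setT M -> P `<` Q -> Q `<` M -> False.
Variable x0 : R.
Hypotheses (xJ : jacobson x0) (xreg : regular x0).
Hypothesis red : reduced (completion (@jacobson R)).
Local Notation x := (iota x0).

Lemma submod_preimage (M : set Q) : submod_in B M -> submod_in setT (iota @^-1` M).
Proof.
move=> sM; split; first by rewrite /preimage /= rmorph0; exact: submod0 sM.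
- by move=> a b Ma Mb; rewrite /preimage /= rmorphD; exact: (submodD sM).
- by move=> a b _ Mb; rewrite /preimage /= rmorphM; apply: (submodM sM) => //; exists a.
Qed.

Lemma image_preimage_range (M : set Q) : M `<=` B -> iota @` (iota @^-1` M) = M.
Proof.
move=> MB; apply/seteqP; split=> [_ [a Ma <-]//|y My].
by have [a _ E] := MB y My; exists a => //; rewrite /preimage /= E.
Qed.

Lemma noeth_range (Fam : set (set Q)) : Fam !=set0 -> (forall I, Fam I -> ideal_in B I) ->
  exists2 M, Fam M & forall I, Fam I -> M `<=` I -> I = M.
Proof.
move=> [I0 F0] FB.
have [||_ [M FM <-] Mmax] := @noeth_max _ noeth [set iota @^-1` I | I in Fam].
- by exists (iota @^-1` I0); exists I0.
- by move=> _ [I /FB[sI _] <-]; exact: submod_preimage.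
exists M => // I FI MI; have [_ IB] := FB I FI; have [_ MB] := FB M FM.
rewrite -(image_preimage_range IB) -(image_preimage_range MB); congr (_ @` _).
by apply: Mmax; [exists I|move=> a; exact: MI].
Qed.

Lemma up_preimage lo hi n (Y : set Q) : hi `<=` B -> up B lo hi n Y ->
  up setT (iota @^-1` lo) (iota @^-1` hi) n (iota @^-1` Y).
Proof.
move=> hiB; elim=> [X sX loX Xhi|m X Z uX IH sZ [XZ nZX] Zhi].
  by apply: up0; [exact: submod_preimage|move=> a; exact: loX|move=> a; exact: Xhi].
apply: (upS IH); [exact: submod_preimage| |by move=> a; exact: Zhi].
split; first by move=> a; exact: XZ.
move=> H; apply: nZX => z Zz; have [a _ E] := hiB _ (Zhi z Zz).
by rewrite -E; apply: H; rewrite /preimage /= E.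
Qed.

Lemma has_len_range : exists e, has_len B (mscale x B) B e.
Proof.
have sB := subring_range iota; have sBB := submod_subring sB.
have [n Hn] := finite_length_quot noeth dim1 xreg.
apply: (@len_le_has _ _ _ _ n).
- exact: submod_mscale.
- by apply: mscale_subring => //; exists x0.
move=> k Y /(up_preimage (@subset_refl _ _))/up_mono H; apply: (Hn _ (iota @^-1` Y)).
by apply: H => // _ [c _ ->]; exists (iota c); [exists c|rewrite rmorphM].
Qed.

Lemma jac_range b : B b -> exists2 u, B u & u * (1 - x * b) = 1.
Proof.
move=> [c _ <-]; have [u Eu] := jacobson_unit noeth c xJ.
by exists (iota u); [exists u|rewrite -rmorphM -(rmorph1 iota) -rmorphB -rmorphM Eu].
Qed.

(** Some power of [x0] is a multiple of the denominator [s]. The ideals [x0 ^+ k R + sR] become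
    stationary, so [s] divides a product [x0 ^+ m * (1 - x0 * c)] whose second factor is a unit. *)
Lemma frac_range y : exists n, B (x ^+ n * y).
Proof.
have [a [s [rs E]]] := frac_repr y; have [n Hn] := finite_length_quot noeth dim1 rs.
pose C k := madd (mscale (x0 ^+ k) [set: R]) (mscale s [set: R]).
have sp := @submod_principal R.
have [k|k|m /(_ m.+1 (leqnSn m)) Cm] := len_le_dcc (C := C) Hn.
- by split=> //; [exact: submod_madd|exact: (madd_subr (sp _))].
- move=> _ [_ [v [[r _ ->] sv ->]]]; exists (x0 ^+ k * (x0 * r)), v; split=> //.
    by exists (x0 * r).
  by rewrite exprSr mulrA.
have : C m (x0 ^+ m) by apply: (madd_subl (sp _)); exists 1; rewrite ?mulr1.
rewrite -Cm => -[_ [_ [[c _ ->] [d _ ->] Ed]]].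
have [u Eu] := jacobson_unit noeth c xJ.
have Ex : x0 ^+ m = s * (d * u).
  have Esd : s * d = x0 ^+ m * (1 - x0 * c) by rewrite mulrBr mulr1 {1}Ed exprSr; ring.
  by rewrite mulrA Esd -mulrA [_ * u]mulrC Eu mulr1.
exists m; exists (a * (d * u)) => //.
have -> : iota x0 ^+ m = iota s * iota (d * u) by rewrite -rmorphXn Ex rmorphM.
transitivity (y * iota s * iota (d * u)); first by rewrite E rmorphM.
by ring.
Qed.

Lemma adic_range (r : nat -> Q) k : (forall m, B (r m)) ->
  (forall m, mscale (x ^+ m) B (r m.+1 - r m)) ->
  (forall m, mscale (x ^+ m) B (r m ^+ k)) -> mscale x B (r 1%N).
Proof.
move=> Br rS rk; have /choice[q qi] : forall m, exists a, iota a = r m.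
  by move=> m; have [a _ E] := Br m; exists a.
have pull (z : R) (m : nat) : mscale (x ^+ m) B (iota z) -> mscale (x0 ^+ m) setT z.
  move=> [_ [c _ <-] E]; exists c => //; apply: (@iota_inj R).
  by rewrite rmorphM rmorphXn.
have [m|m|c _ E] := adic_nilpotent noeth dim1 xJ xreg red (r := q) (e := k).
- by apply: pull; rewrite rmorphB /= !qi.
- by apply: pull; rewrite rmorphXn /= qi.
by rewrite -qi E rmorphM; exists (iota c); [exists c|].
Qed.

(** With [w = b * c + g] regular and [b * g = 0], one has [b * w = b * b * c]; division by [w]
    yields [z]. *)
Lemma von_neumann (y : Q) : exists z, y = y * y * z.
Proof.
have [b [s [rs E]]] := frac_repr y.
have [c [g [bg rw]]] := reduced_decomp noeth dim1 xJ xreg red b.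
have us := iota_unit rs; have uw := iota_unit rw.
exists (iota s * iota c / iota (b * c + g)).
apply: (mulIr us); rewrite E; apply: (mulIr uw).
have -> : y * y * (iota s * iota c / iota (b * c + g)) * iota s * iota (b * c + g) =
  (y * iota s) * (y * iota s) * iota c * (iota (b * c + g) / iota (b * c + g)) by ring.
by rewrite divrr // mulr1 E -!rmorphM; congr iota; rewrite mulrDr bg addr0; ring.
Qed.

End RangeTransfer.

(** * Localization and residue fields *)

Section LocalizedFractions.
Variables (R : comNzRingType) (m : maxideal R).
Local Notation Q := (total_frac R).
Local Notation Q' := (total_frac (locmax m)).
Local Notation iota := (loc_of (regular_mulset R)).
Local Notation jm := (loc_of (compl_max m)).
Local Notation iota' := (loc_of (regular_mulset (locmax m))).
Implicit Types (a b s u : R) (y z : Q).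

Definition loc_frac a : Q' := iota' (jm a).

Lemma loc_fracM a b : loc_frac (a * b) = loc_frac a * loc_frac b.
Proof. by rewrite /loc_frac !rmorphM. Qed.
Lemma loc_fracB a b : loc_frac (a - b) = loc_frac a - loc_frac b.
Proof. by rewrite /loc_frac !rmorphB. Qed.
Lemma loc_frac1 : loc_frac 1 = 1. Proof. by rewrite /loc_frac !rmorph1. Qed.
Lemma loc_frac0 : loc_frac 0 = 0. Proof. by rewrite /loc_frac !rmorph0. Qed.

Lemma loc_frac_ker a : loc_frac a = 0 -> exists2 t, ~ (m : set R) t & t * a = 0.
Proof.
rewrite -(rmorph0 iota') => /iota_inj; rewrite -(rmorph0 jm) => /mkfrac_eq[t tS].
by rewrite mul0r subr0 mulr1 => ta; exists t.
Qed.

Lemma loc_frac_unit s : ~ (m : set R) s -> loc_frac s \is a GRing.unit.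
Proof.
move=> nms; apply/unitrPr; exists (iota' (@mkfrac R (compl_max m) 1 s nms)).
rewrite -rmorphM -[RHS](rmorph1 iota'); congr iota'.
rewrite -[LHS]/(loc_mul _ _) mkfracM; apply/mkfrac_eq; exists 1; first exact: mulset1.
by ring.
Qed.

Lemma loc_frac_regular s : regular s -> loc_frac s \is a GRing.unit.
Proof.
move=> rs; apply: iota_unit => p q /eqP; rewrite -subr_eq0 -mulrBr => E.
apply/eqP; rewrite -subr_eq0; move: (p - q) E => {p q} r.
have [a [u [uS ->]]] := mkfrac_surj r; rewrite -[_ * _]/(loc_mul _ _) mkfracM => /eqP.
rewrite -(rmorph0 jm) => /mkfrac_eq[t tS].
rewrite mul0r subr0 mulr1 mulrCA => /eqP; rewrite -(mulr0 s) => /eqP/rs ta.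
by apply/eqP/mkfrac_eq; exists t => //; rewrite mulr0 mul0r subr0 mulr1.
Qed.

(** The map of total rings of fractions induced by localization: a regular element of [R] stays
    regular there. Afterwards it is known only through its effect on fractions. *)
Lemma loc_map_exists : exists f : Q -> Q', forall y a s, regular s ->
  y * iota s = iota a -> f y * loc_frac s = loc_frac a.
Proof.
have /choice[g gP] : forall y, exists p : R * R, regular p.2 /\ y * iota p.2 = iota p.1.
  by move=> y; have [a [s H]] := frac_repr y; exists (a, s).
exists (fun y => loc_frac (g y).1 / loc_frac (g y).2) => y a s rs E.
have [rg Eg] := gP y; have us := loc_frac_regular rg.
have Eas : (g y).1 * s = a * (g y).2.
  by apply: iota_inj; rewrite !rmorphM /= -E -Eg; ring.
rewrite mulrAC -loc_fracM Eas loc_fracM mulrK //.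
Qed.

Variable f : Q -> Q'.
Hypothesis fE : forall y a s, regular s -> y * iota s = iota a -> f y * loc_frac s = loc_frac a.

Lemma loc_map_iota a : f (iota a) = loc_frac a.
Proof.
rewrite -(mulr1 (f _)) -loc_frac1; apply: fE; first exact: lreg1.
by rewrite rmorph1 mulr1.
Qed.

Lemma loc_mapM y z : f (y * z) = f y * f z.
Proof.
have [a [s [rs E]]] := frac_repr y; have [b [u [ru E']]] := frac_repr z.
have rsu : regular (s * u) by exact: lregM.
apply: (mulIr (loc_frac_regular rsu)); rewrite (@fE _ (a * b)) //.
  rewrite !loc_fracM -(fE rs E) -(fE ru E'); ring.
by rewrite !rmorphM /= -E -E'; ring.
Qed.

Lemma loc_mapB y z : f (y - z) = f y - f z.
Proof.
have [a [s [rs E]]] := frac_repr y; have [b [u [ru E']]] := frac_repr z.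
have rsu : regular (s * u) by exact: lregM.
apply: (mulIr (loc_frac_regular rsu)); rewrite (@fE _ (a * u - b * s)) //.
  rewrite loc_fracB !loc_fracM -(fE rs E) -(fE ru E'); ring.
by rewrite rmorphB !rmorphM /= -E -E'; ring.
Qed.

Lemma loc_map_ker y : f y = 0 -> exists2 t, ~ (m : set R) t & iota t * y = 0.
Proof.
have [a [s [rs E]]] := frac_repr y => fy0.
have [|t nt ta] := @loc_frac_ker a; first by rewrite -(fE rs E) fy0 mul0r.
exists t => //; apply: (mulIr (iota_unit rs)).
by rewrite mul0r -mulrA E -rmorphM ta rmorph0.
Qed.

Hypothesis vnr : forall y, exists z, y = y * y * z.

(** A denominator regular in the localization may be a zero divisor in [R]. Adding the complementary
    idempotent [e], which maps to 0, makes it a unit with the same image. *)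
Lemma loc_map_surj (z : Q') : exists y, f y = z.
Proof.
have [p [q [rq E]]] := frac_repr z.
have [a [s [sS Ep]]] := mkfrac_surj p; have [b [u [uS Eq]]] := mkfrac_surj q.
have jM c v vS : @mkfrac R (compl_max m) c v vS * jm v = jm c.
  rewrite -[LHS]/(loc_mul _ _) mkfracM; apply/mkfrac_eq; exists 1; first exact: mulset1.
  by ring.
have us := loc_frac_unit sS; have uu := loc_frac_unit uS; have uq := iota_unit rq.
have Ea : iota' p * loc_frac s = loc_frac a by rewrite -rmorphM Ep jM.
have Eb : iota' q * loc_frac u = loc_frac b by rewrite -rmorphM Eq jM.
pose b' := b * s; pose a' := a * u.
have Ez : z * loc_frac b' = loc_frac a'.
  by rewrite !loc_fracM -Ea -Eb -E; ring.
have ub : loc_frac b' \is a GRing.unit.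
  by rewrite loc_fracM -Eb !unitrM uq uu us.
have [c Ec] := vnr (iota b').
pose e := 1 - iota b' * c.
have be : iota b' * e = 0.
  have -> : iota b' * e = iota b' - iota b' * iota b' * c by rewrite /e; ring.
  by rewrite -Ec subrr.
have fe : f e = 0.
  apply: (mulrI ub); rewrite mulr0 -loc_map_iota -loc_mapM be -(rmorph0 iota).
  by rewrite loc_map_iota loc_frac0.
have uw : iota b' + e \is a GRing.unit.
  apply/unitrPr; exists (iota b' * c * c + e).
  have -> : (iota b' + e) * (iota b' * c * c + e) =
    iota b' * iota b' * c * c + (iota b' * e) * (1 + c * c) + e * e by ring.
  rewrite -Ec be; have -> : e * e = e - (iota b' * e) * c by rewrite /e; ring.
  by rewrite be /e; ring.
have fw : f (iota b' + e) = loc_frac b'.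
  have -> : iota b' + e = iota b' - (0 - e) by ring.
  rewrite loc_mapB loc_mapB fe loc_map_iota -(rmorph0 iota) loc_map_iota loc_frac0; ring.
exists (iota a' / (iota b' + e)); apply: (mulIr ub).
by rewrite Ez -fw -loc_mapM divrK // loc_map_iota.
Qed.

(** Elements of the kernel of [f] are killed by elements outside [m], by which one may divide in
    [V]. So [V] is a union of fibres of [f], and the conditions pass to its image. *)
Lemma valuation_ring_image (V : set Q) : is_subring V -> range iota `<=` V ->
  ~ (setT `<=` V) -> (forall y z, ~ V y -> ~ V z -> ~ V (y * z)) ->
  (forall u y, ~ (m : set R) u -> V (iota u * y) -> V y) ->
  @valuation_rings (locmax m) (f @` V).
Proof.
move=> sV BV nV cV lV.
have fV y z : f y = f z -> V z -> V y.
  move=> E Vz; have [|t nt tyz] := @loc_map_ker (y - z); first by rewrite loc_mapB E subrr.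
  rewrite -(subrK z y); apply: (subringD sV) => //; apply: (lV t) => //.
  by rewrite tyz; exact: subring0.
split.
- split; first by apply/mem_set; exists 1;
  [exact: subring1|rewrite -(rmorph1 iota) loc_map_iota loc_frac1].
  + move=> _ _ /set_mem[y Vy <-] /set_mem[z Vz <-]; apply/mem_set.
    by exists (y - z); [exact: subringB|exact: loc_mapB].
  + move=> _ _ /set_mem[y Vy <-] /set_mem[z Vz <-]; apply/mem_set.
    by exists (y * z); [exact: subringM|exact: loc_mapM].
- move=> _ [p _ <-]; have [a [s [sS Ep]]] := mkfrac_surj p.
  have [y Ey] := loc_map_surj (iota' p); exists y => //.
  apply: (lV s) => //; apply: (fV _ (iota a)); last by apply: BV; exists a.
  rewrite loc_mapM !loc_map_iota Ey /loc_frac -rmorphM; congr iota'; rewrite Ep.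
  rewrite -[LHS]/(loc_mul _ _) mkfracM; apply/mkfrac_eq; exists 1; first exact: mulset1.
  by ring.
- split=> // H; apply: nV => y _; have [|z Vz Ez] := H (f y); first by [].
  exact: fV (esym Ez) Vz.
- move=> z z'; have [y <-] := loc_map_surj z; have [y' <-] := loc_map_surj z'.
  move=> ny ny' [w Vw Ew]; apply: (cV y y').
  + by move=> Vy; apply: ny; exists y.
  + by move=> Vy; apply: ny'; exists y'.
  + by apply: fV Vw; rewrite loc_mapM.
Qed.

Lemma valuation_ring_image_inj (V W : set Q) : is_subring V -> is_subring W ->
  (forall u y, ~ (m : set R) u -> V (iota u * y) -> V y) ->
  (forall u y, ~ (m : set R) u -> W (iota u * y) -> W y) ->
  f @` V = f @` W -> V = W.
Proof.
suff key (V' W' : set Q) : is_subring W' ->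
    (forall u y, ~ (m : set R) u -> W' (iota u * y) -> W' y) ->
    f @` V' = f @` W' -> V' `<=` W'.
  move=> sV sW lV lW E; apply/seteqP; split; first exact: key sW lW E.
  exact: key sV lV (esym E).
move=> sW lW E y Vy; have [z Wz Ez] : (f @` W') (f y) by rewrite -E; exists y.
have [|t nt tyz] := @loc_map_ker (y - z); first by rewrite loc_mapB Ez subrr.
rewrite -(subrK z y); apply: (subringD sW) => //; apply: (lW t) => //.
by rewrite tyz; exact: subring0.
Qed.

End LocalizedFractions.

Lemma residue_representatives (R : comNzRingType) (m : maxideal R) (T : Type) (S : set T) :
  (S #<= [set: quotring (ideal_of_max m)])%card ->
  exists r : T -> R, forall v w, S v -> S w -> (m : set R) (r v - r w) -> v = w.
Proof.
move=> /card_leP/injfunPex[g _ ginj].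
have /choice[r rP] : forall v, exists a : R, forall Sv : S v,
    to_quotring (ideal_of_max m) a = val (g (SigSub (mem_set Sv))).
  move=> v; have [Sv|nSv] := pselect (S v); last by exists 0 => Sv; case: (nSv Sv).
  exists (repr (val (g (SigSub (mem_set Sv))))) => Sv'.
  by rewrite /to_quotring reprK; congr (val (g _)); apply: val_inj.
exists r => v w Sv Sw mvw.
have : to_quotring (ideal_of_max m) (r v) = to_quotring _ (r w) by apply/eqP/quotring_eqP.
rewrite (rP v Sv) (rP w Sw) => /val_inj/ginj E.
by have := congr1 val (E (mem_set I) (mem_set I)).
Qed.

(** * General position over the residue fields *)

Section GeneralPosition.
Variables (R : comNzRingType) (K : comUnitRingType) (phi : {rmorphism R -> K}).
Variables (A : set K) (I : eqType) (n : I -> set K).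
Hypotheses (sA : is_subring A) (BA : range phi `<=` A).
Hypothesis n_max : forall i, maximal_in A (n i).
Variables (f g : K).
Hypotheses (Af : A f) (Ag : A g) (nfg : forall i, ~ (n i f /\ n i g)).

(* On the projective line over the residue field, each [i] excludes at most one point,
   and [1 + size l] points are available. *)
Lemma avoid_points (m : set R) (l : seq I) (r : I -> R) : uniq l ->
  (forall i, i \in l -> forall a, n i (phi a) -> m a) -> ~ m 1 ->
  (forall i j, i \in l -> j \in l -> m (r i - r j) -> i = j) ->
  exists a b, forall i, i \in l -> ~ n i (phi a * f + phi b * g).
Proof.
move=> ul nm m1 rl; apply: contrapT => N.
(* [(0, 1)] is the point at infinity, the one point more than there are indices. *)
pose pts : seq (R * R) := (0, 1) :: [seq (1, r i) | i <- l].
have /choice[h hP] : forall p : R * R, exists i : I,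
    i \in l /\ n i (phi p.1 * f + phi p.2 * g).
  move=> [a b]; apply: contrapT => H; apply: N; exists a, b => i il nf; apply: H.
  by exists i.
have sn i : submod_in A (n i) by exact: maximal_submod.
(* Two points excluded by the same [i] are proportional modulo [n i]; otherwise Cramer's rule would
   put both [f] and [g] in [n i]. *)
have det i p q : n i (phi p.1 * f + phi p.2 * g) -> n i (phi q.1 * f + phi q.2 * g) ->
    n i (phi (p.1 * q.2 - q.1 * p.2)).
  move=> np nq; have Aphi a : A (phi a) by apply: BA; exists a.
  apply: contrapT => nD; apply: (nfg (i := i)); split.
    have : n i (phi (p.1 * q.2 - q.1 * p.2) * f).
      have -> : phi (p.1 * q.2 - q.1 * p.2) * f =
          phi q.2 * (phi p.1 * f + phi p.2 * g) - phi p.2 * (phi q.1 * f + phi q.2 * g).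
        by rewrite rmorphB !rmorphM; ring.
      by apply: (submodB sA (sn i)); apply: (submodM (sn i)).
    by move=> /(maximal_prime sA (n_max i) (Aphi _) Af)[].
  have : n i (phi (p.1 * q.2 - q.1 * p.2) * g).
    have -> : phi (p.1 * q.2 - q.1 * p.2) * g =
        phi p.1 * (phi q.1 * f + phi q.2 * g) - phi q.1 * (phi p.1 * f + phi p.2 * g).
      by rewrite rmorphB !rmorphM; ring.
    by apply: (submodB sA (sn i)); apply: (submodM (sn i)).
  by move=> /(maximal_prime sA (n_max i) (Aphi _) Ag)[].
have hinj : {in pts &, injective h}.
  move=> p q pp qp E; have [hl hp] := hP p; have [_ hq] := hP q; rewrite -E in hq.
  have mD := nm _ hl _ (det _ _ _ hp hq); have mD' := nm _ hl _ (det _ _ _ hq hp).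
  move: pp qp mD mD'; rewrite !inE.
  case/orP=> [/eqP->|/mapP[i il ->]]; case/orP=> [/eqP->|/mapP[j jl ->]] //=;
    rewrite ?mul0r ?mulr1 ?mul1r ?sub0r ?subr0 // => H1 H2.
  by rewrite (rl _ _ il jl H2).
have : (size pts <= size l)%N.
  rewrite -(size_map h pts); apply: uniq_leq_size; last by move=> _ /mapP[p _ ->];
    have [] := hP p.
  rewrite map_inj_in_uniq // /pts /= map_inj_in_uniq.
    rewrite ul andbT; apply/negP => /mapP[i _ [/eqP]]; by rewrite eq_sym oner_eq0.
  move=> i j il jl [E]; apply: rl => //; rewrite E subrr.
  by have := nm i il 0; rewrite rmorph0; apply; exact: submod0 (sn i).
by rewrite /pts /= size_map ltnn.
Qed.

(** Points are counted over one residue field of [R] at a time, which gives a pair of coefficients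
    for each maximal ideal; the Chinese remainder theorem in [R] glues the pairs. *)
Lemma general_position_crt (ms : seq (set R)) (l : seq I) (r : set R -> I -> R) :
  (forall i, i \in l) -> uniq l -> (forall m, m \in ms -> maximal_in setT m) ->
  (forall i, (phi @^-1` n i) \in ms) ->
  (forall m i j, phi @^-1` n i = m -> phi @^-1` n j = m -> m (r m i - r m j) -> i = j) ->
  exists a b, [/\ range phi a, range phi b & forall i, ~ n i (a * f + b * g)].
Proof.
move=> l_all ul mms nms rm.
have ab_ex m : exists p : R * R, m \in ms -> forall i, phi @^-1` n i = m ->
    ~ n i (phi p.1 * f + phi p.2 * g).
  have [mm|nm] := boolP (m \in ms); last by exists (0, 0).
  have [||||a [b H]] := @avoid_points m [seq i <- l | `[< phi @^-1` n i = m >]] (r m).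
  - by rewrite filter_uniq.
  - by move=> i; rewrite mem_filter => /andP[/asboolP <- _] a.
  - exact: (maximal_proper (mms m mm)).
  - move=> i j; rewrite !mem_filter => /andP[/asboolP Ei _] /andP[/asboolP Ej _].
    exact: rm.
  exists (a, b) => _ i Ei; apply: H; rewrite mem_filter l_all andbT; exact/asboolP.
have [p pP] := choice ab_ex.
have e_ex m : exists e : R, m \in ms -> m (1 - e) /\ forall m', m' \in ms -> m' <> m -> m' e.
  have [mm|nm] := boolP (m \in ms); last by exists 0.
  by have [e [_ H1 H2]] := maximal_crt (subringT R) (mms m mm) mms; exists e.
have [e eP] := choice e_ex.
pose ums := undup ms.
pose a := \sum_(m <- ums) e m * (p m).1; pose b := \sum_(m <- ums) e m * (p m).2.
exists (phi a), (phi b); split; [by exists a|by exists b|move=> i].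
set m := phi @^-1` n i; have mm : m \in ms by exact: nms.
have sm := maximal_submod (mms m mm); have sn := maximal_submod (n_max i).
have cong (c : set R -> R) : m (\sum_(m' <- ums) e m' * c m' - c m).
  rewrite (bigD1_seq m) ?mem_undup ?undup_uniq //=.
  have -> : e m * c m + \sum_(m' <- ums | m' != m) e m' * c m' - c m =
    \sum_(m' <- ums | m' != m) e m' * c m' - c m * (1 - e m) by ring.
  have [H1 _] := eP m mm; apply: (submodB (subringT R) sm); last exact: (submodM sm).
  rewrite big_seq_cond; apply: (submod_sum _ sm) => m'; rewrite mem_undup => /andP[m'm nm].
  rewrite mulrC; apply: (submodM sm) => //; have [_ H2] := eP m' m'm; apply: H2 => //.
  by apply/eqP; rewrite eq_sym.
move=> nab; apply: (pP m mm i erefl).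
have ca : n i (phi (a - (p m).1)) := cong (fun m' => (p m').1).
have cb : n i (phi (b - (p m).2)) := cong (fun m' => (p m').2).
have -> : phi (p m).1 * f + phi (p m).2 * g = (phi a * f + phi b * g)
   - (f * phi (a - (p m).1) + g * phi (b - (p m).2)) by rewrite !rmorphB; ring.
by apply: (submodB sA sn) => //; apply: (submodD sn); apply: (submodM sn).
Qed.

End GeneralPosition.

(** * Admissible rings *)

Lemma subring_closed_in (K : comNzRingType) (V : set K) :
  GRing.subring_closed [in V] -> is_subring V.
Proof.
move=> [V1 VB VM]; split; first exact: set_mem.
- by move=> x y Vx Vy; apply: set_mem; apply: VB; exact: mem_set.
- by move=> x y Vx Vy; apply: set_mem; apply: VM; exact: mem_set.
Qed.

(** If [y] is outside [V] and [y * v] is in [V], then [v] is in [V]. Factors [y] are stripped in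
    this way from a monic equation, until [y - c] is in [V] for some [c] from [R]. *)
Lemma integral_in_valuation_ring (R : comNzRingType) (K : comUnitRingType)
    (phi : {rmorphism R -> K}) (V : set K) : is_subring V -> range phi `<=` V ->
  (forall y z, ~ V y -> ~ V z -> ~ V (y * z)) -> [set y | integralOver phi y] `<=` V.
Proof.
move=> sV BV cV y Ay; have [d] := integral_poly_mod Ay.
suff key k z : poly_mod (range phi) y k.+1 z -> V (y ^+ k.+1 - z) -> V y.
  case: d => [/eqP|d yd]; first by rewrite expr0 oner_eq0.
  by apply: key yd _; rewrite subrr; exact: subring0.
move=> Mz Vz; apply: contrapT => nVy; elim: k z Mz Vz => [|k IH] _ [c [z' [Bc Mz' ->]]] Vz.
  apply: nVy; rewrite -(subrK c y); apply: (subringD sV); last exact: BV.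
  by move: Vz; rewrite Mz' mulr0 addr0.
apply: (IH z') => //; apply: contrapT => nV; apply: (cV _ _ nVy nV).
have -> : y * (y ^+ k.+1 - z') = (y ^+ k.+2 - (c + y * z')) + c by rewrite (exprS y k.+1); ring.
by apply: (subringD sV) => //; exact: BV.
Qed.

Section AdmissibleRing.
Variable R : comNzRingType.
Hypothesis adm : admissible R.
Local Notation Q := (total_frac R).
Local Notation iota := (loc_of (regular_mulset R)).
Local Notation B := (range iota).
Local Notation A := [set y : Q | integralOver iota y].

Let sB : is_subring B. Proof. exact: subring_range. Qed.
Let sA : is_subring A. Proof. exact: subring_integral. Qed.
Let BA : B `<=` A. Proof. exact: range_integral. Qed.

Lemma integral_closure_structure :
  [/\ (forall Fam : set (set Q), Fam !=set0 -> (forall J, Fam J -> ideal_in A J) ->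
         exists2 M, Fam M & forall J, Fam J -> M `<=` J -> J = M),
      (exists ns : seq (set Q), uniq ns /\ forall M, (M \in ns) <-> maximal_in A M),
      (forall M, maximal_in A M -> exists t, [/\ A t, t \is a GRing.unit & M = mscale t A]),
      (forall a, A a -> (forall M, maximal_in A M -> ~ M a) -> exists2 b, A b & a * b = 1) &
      [/\ (forall y, exists a c, [/\ A a, A c, c \is a GRing.unit & c * y = a]),
      (exists2 w, w \is a GRing.unit & forall y, A y -> B (w * y)) &
      (forall y : Q, exists z, y = y * y * z)]].
Proof.
have [[noeth dim semi depth] red _ _] := adm.
have d1 := dim1_chain dim.
have [x0 xJ xreg] : exists2 x : R, jacobson x & regular x.
  apply: regular_in_jacobson => // M mM.
  exact: (@depth1_regular _ (MaxIdeal mM) noeth (depth _)).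
pose x := iota x0.
have ux : x \is a GRing.unit by exact: iota_unit.
have Bx : B x by exists x0.
have [e He] := has_len_range noeth d1 xreg.
have jac := jac_range noeth xJ.
have frac := frac_range noeth d1 xJ.
have jac' b : B b -> exists u, u * (1 - x * b) = 1 by move=> /jac[u _ E]; exists u.
have [N cond] := conductor ux Bx jac' frac He (adic_range noeth d1 xJ xreg red).
have noethB := noeth_range noeth.
have stab (M : set Q) y z : submod_in B M -> M `<=` A -> M z -> z \is a GRing.unit ->
    (forall m, M m -> M (y * m)) -> A y.
  move=> sM MA Mz uz My; have uxN : x ^+ N \is a GRing.unit by rewrite unitrX.
  by apply: (stable_integral noeth sM uxN _ Mz uz My) => m /MA; exact: cond.
split.
- exact: (noethA BA ux cond noethB).
- exact: (finite_maximal sB sA BA ux Bx jac cond He).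
- exact: (maximal_principal sB sA BA ux Bx jac cond He noethB stab).
- exact: (unit_of_not_maximal sA BA ux cond noethB).
split; last exact: (von_neumann noeth d1 xJ xreg red).
- move=> y; have [n Bn] := frac y; exists (x ^+ n * y), (x ^+ n).
  by split; rewrite ?unitrX //; [exact: BA|apply: (subringX sA); exact: BA].
- by exists (x ^+ N); rewrite ?unitrX.
Qed.

(* The valuation rings over [R] are the localizations of the integral closure at
   its maximal ideals, each of which is generated by a uniformizer [t V]. *)
Lemma uniformizers : exists (ind : seq (@valuation_rings R)) (t : @valuation_rings R -> Q),
  [/\ uniq ind, (forall V, V \in ind), (forall V, t V \is a GRing.unit), (forall V, A (t V)) &
      [/\ (forall V, maximal_in A (mscale (t V) A)),
      (forall V W, mscale (t V) A (t W) -> V = W),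
      (forall a, A a -> (forall V, ~ mscale (t V) A a) -> exists2 b, A b & a * b = 1) &
      (forall V, val V = vring A t V)]].
Proof.
have [noethA [ns [uns nsP]] princ unitA [frac _ _]] := integral_closure_structure.
pose I0 := 'I_(size ns).
have n_max (i : I0) : maximal_in A (nth set0 ns i) by apply/nsP; exact: mem_nth.
have /choice[t0 t0P] := fun i => princ _ (n_max i).
have ut0 i : t0 i \is a GRing.unit by have [] := t0P i.
have At0 i : A (t0 i) by have [] := t0P i.
have Et0 i : mscale (t0 i) A = nth set0 ns i by have [] := t0P i.
have t0_max i : maximal_in A (mscale (t0 i) A) by rewrite Et0.
have t0_inj i j : mscale (t0 i) A (t0 j) -> i = j.
  move=> tij; apply/val_inj/eqP; rewrite -(nth_uniq set0 (ltn_ord i) (ltn_ord j) uns); apply/eqP.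
  rewrite -!Et0; apply: (maximal_sub_eq sA (t0_max j) (t0_max i)) => _ [a Aa ->].
  by rewrite mulrC; exact: (submodM (maximal_submod (t0_max i))).
have t0_unit a : A a -> (forall i, ~ mscale (t0 i) A a) -> exists2 b, A b & a * b = 1.
  move=> Aa nta; apply: unitA => // M mM Ma; have Mns : M \in ns by apply/nsP.
  have iM : (index M ns < size ns)%N by rewrite index_mem.
  by apply: (nta (Ordinal iM)); rewrite Et0 /= nth_index.
have un_ind : uniq (enum 'I_(size ns)) := enum_uniq _.
have me_ind (i : I0) : i \in enum 'I_(size ns) by rewrite mem_enum.
have vr_val i : valuation_rings (vring A t0 i).
  have [V1 VB VM] := subring_vring sA t0_max i; split.
  - split; first exact: mem_set.
    + by move=> x y /set_mem Vx /set_mem Vy; apply: mem_set; exact: VB.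
    + by move=> x y /set_mem Vx /set_mem Vy; apply: mem_set; exact: VM.
  - by move=> y /BA; exact: (sub_vring sA t0_max).
  - by split=> //; exact: (vring_neqT ut0 (i := i)).
  - move=> y z.
    exact: (vring_compl sA un_ind me_ind ut0 At0 t0_max t0_inj t0_unit noethA frac).
have classify (V : @valuation_rings R) : exists i, val V = vring A t0 i.
  have [sV BV [_ nV] cV] := set_valP V; have sV' := subring_closed_in sV.
  have AV := integral_in_valuation_ring sV' BV cV.
  exact: (vring_classification sA un_ind me_ind ut0 At0 t0_max t0_inj t0_unit noethA frac sV'
    AV nV cV).
have [g gP] := choice classify.
(* The index set becomes the set of valuation rings itself, so that exponent vectors and value
   vectors have the same type. *)
pose h (i : I0) : @valuation_rings R := SigSub (mem_set (vr_val i)).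
have gh i : g (h i) = i.
  have E : vring A t0 i = vring A t0 (g (h i)) := gP (h i).
  by have := vring_inj sA ut0 At0 t0_inj E.
have hg V : h (g V) = V by apply: val_inj; rewrite /= gP.
exists [seq h i | i <- enum 'I_(size ns)], (t0 \o g); split.
- by rewrite map_inj_uniq //; exact: can_inj gh.
- by move=> V; rewrite -(hg V); apply: map_f; exact: me_ind.
- by move=> V; exact: ut0.
- by move=> V; exact: At0.
split.
- by move=> V; exact: t0_max.
- by move=> V W /t0_inj E; rewrite -(hg V) E hg.
- by move=> a Aa nta; apply: t0_unit => // i; rewrite -(gh i); exact: nta.
- by move=> V; rewrite [LHS]gP.
Qed.

Variables (ind : seq (@valuation_rings R)) (t : @valuation_rings R -> Q).
Hypotheses (uniq_ind : uniq ind) (mem_ind : forall V, V \in ind).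
Hypothesis ut : forall V, t V \is a GRing.unit.
Hypothesis At : forall V, A (t V).
Hypothesis t_max : forall V, maximal_in A (mscale (t V) A).
Hypothesis t_inj : forall V W, mscale (t V) A (t W) -> V = W.
Hypothesis t_unit : forall a, A a -> (forall V, ~ mscale (t V) A a) ->
  exists2 b, A b & a * b = 1.
Hypothesis val_vring : forall V, val V = vring A t V.

Let noethA := let: And5 h _ _ _ _ := integral_closure_structure in h.
Let frac := let: And5 _ _ _ _ (And3 h _ _) := integral_closure_structure in h.

Lemma val_ideal_vring V : val_ideal (val V) = mscale (t V) (val V).
Proof.
rewrite val_vring; apply: xget_unique.
  split; first exact: (vring_maximal sA ut At t_max).
  exists (t V); split; last by apply/regular_unit.
  exists 1; rewrite ?mulr1 //; apply: (sub_vring sA t_max); exact: subring1.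
move=> m [mm [y [my /regular_unit uy]]].
exact: (vring_maximal_unique sA uniq_ind mem_ind ut At t_max t_inj t_unit noethA frac mm my uy).
Qed.

Lemma valuation_tpow V u a : unit_in A u ->
  valuation (val V) (u * tpow ind t a) = (a V)%:E.
Proof.
move=> uu; have sV : is_subring (val V) by rewrite val_vring; exact: (subring_vring sA t_max).
have zP k : zpow_in (val V) (val_ideal (val V)) k (u * tpow ind t a) <-> k <= a V.
  rewrite val_ideal_vring zpow_mscale // val_vring.
  exact: (vring_scale_tpow sA uniq_ind mem_ind ut At t_max t_inj).
rewrite /valuation ifF; last first.
  apply/asboolP => H; have /zP := H (a V + 1); by rewrite leNgt ltzD1 lexx.
congr (_%:E); apply: xget_unique.
  by split; [exact/zP|move=> k /zP].
move=> k [/zP ka kmax]; apply/eqP; rewrite eq_le ka /=; apply: kmax; exact/zP.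
Qed.

Lemma value_set_values (E : set Q) : value_set E = values A ind t E.
Proof.
apply/seteqP; split=> [a [y [Ey /regular_unit uy ya]]|a [u uu Eu]].
  have [u [b [uu Eb]]] := factor_unit sA uniq_ind mem_ind ut At t_max t_unit noethA frac uy.
  exists u => //; suff -> : a = b by rewrite -Eb.
  by apply/funext => V; have := ya V; rewrite Eb valuation_tpow // => -[].
exists (u * tpow ind t a); split=> //; last by move=> V; exact: valuation_tpow.
apply/regular_unit; rewrite unitrM (tpow_unit ind ut) andbT; by case: uu.
Qed.

Lemma residue_field V w : A w -> exists2 r, B r & mscale (t V) A (w - r).
Proof.
move=> Aw; have [_ _ rr _] := adm; have [r nr] := rr _ (t_max V) w Aw.
by exists (iota r) => //; exists r.
Qed.

(** Residual rationality replaces an inverse modulo [t V * A] by an element of [R]. *)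
Lemma contraction_maximal V : maximal_in setT (iota @^-1` mscale (t V) A).
Proof.
set m := iota @^-1` _.
have sn := maximal_submod (t_max V).
have sm : submod_in setT m.
  apply: submod_preimage; split; [exact: submod0 sn|by move=> *; exact: (submodD sn)|].
  by move=> a y /BA; exact: (submodM sn).
have m1 : ~ m 1 by rewrite /m /preimage /= rmorph1; exact: (maximal_proper (t_max V)).
split; [by split|by split=> // H; apply: m1; exact: H|].
move=> J [sJ _] mJ; have [Jm|nJm] := pselect (J `<=` m); first by left; apply/seteqP.
have [r Jr nr] : exists2 r, J r & ~ m r.
  by apply: contrapT => H; apply: nJm => r Jr; apply: contrapT => nr; apply: H; exists r.
right; apply: submod1T => //.
have Ar : A (iota r) by apply: BA; exists r.
have [b Ab nb] := maximal_inv sA (t_max V) Ar nr.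
have [_ [s _ <-] ns] := residue_field V Ab.
have -> : 1 = (1 - s * r) + s * r by ring.
apply: (submodD sJ); last exact: (submodM sJ).
apply: mJ; rewrite /m /preimage /= rmorphB rmorph1 rmorphM /=.
have -> : 1 - iota s * iota r = (1 - b * iota r) + iota r * (b - iota s) by ring.
by apply: (submodD sn) => //; exact: (submodM sn).
Qed.

(** Valuation rings whose maximal ideal contracts to [m] have distinct images among the valuation
    rings over the localization at [m]. The bound on the residue field thus assigns them distinct
    residues. *)
Lemma admissible_general_position f g : A f -> A g ->
  (forall V, ~ (mscale (t V) A f /\ mscale (t V) A g)) ->
  exists a b, [/\ B a, B b & forall V, ~ mscale (t V) A (a * f + b * g)].
Proof.
have [[noeth dim /finite_seqP[ms msE] depth] red _ large] := adm.
have [_ _ _ _ [_ _ vnr]] := integral_closure_structure.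
have mms M : M \in ms <-> maximal_in setT M.
  by split=> [H|H]; [have : [set` ms] M by []; rewrite -msE|have : [set` ms] M by rewrite -msE].
have rep (m : set R) : exists r : @valuation_rings R -> R, maximal_in setT m ->
    forall V W, iota @^-1` mscale (t V) A = m -> iota @^-1` mscale (t W) A = m ->
      m (r V - r W) -> V = W.
  have [mm|nm] := pselect (maximal_in setT m); last by exists (fun=> 0).
  pose M := MaxIdeal mm; have [h hE] := loc_map_exists M.
  have [r rP] := residue_representatives (large M).
  exists (fun V => r (h @` val V)) => _ V W EV EW.
  (* An element of [R] outside [m] avoids the maximal ideal at [U], so it may serve as a denominator
     in [val U]. *)
  have lV U : iota @^-1` mscale (t U) A = m ->
      forall u y, ~ m u -> (val U : set Q) (iota u * y) -> (val U : set Q) y.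
    move=> EU u y nu; rewrite !val_vring => -[s [As ns Asy]].
    have Au : A (iota u) by apply: BA; exists u.
    exists (s * iota u); rewrite -mulrA; split; [exact: (subringM sA As Au)| |exact: Asy].
    move=> /(maximal_prime sA (t_max U) As Au)[//|nu']; apply: nu; rewrite -EU //.
  have vU U : iota @^-1` mscale (t U) A = m -> @valuation_rings (locmax M) (h @` val U).
    move=> EU; have [sU BU [_ nU] cU] := set_valP U.
    by apply: (valuation_ring_image hE vnr (subring_closed_in sU)) => //; exact: lV.
  move=> /(rP _ _ (vU V EV) (vU W EW)) E; apply: val_inj.
  have sV := subring_closed_in (let: And4 h _ _ _ := set_valP V in h).
  have sW := subring_closed_in (let: And4 h _ _ _ := set_valP W in h).
  exact: (valuation_ring_image_inj hE sV sW (lV V EV) (lV W EW) E).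
have [r rP] := choice rep; move=> Af Ag nfg.
apply: (general_position_crt (ms := ms) (l := ind) (r := r) sA BA t_max Af Ag nfg) => //.
- by move=> m /mms.
- by move=> V; apply/mms; exact: contraction_maximal.
- move=> m V W EV EW; apply: rP => //; rewrite -EV; exact: contraction_maximal.
Qed.

(** The unit [y0] of [E], times the conductor, gives a monomial multiple of [A] inside [E]; the
    denominator [r] encloses [F] in another. *)
Theorem admissible_length (E F : set Q) : submod_in B E -> submod_in B F -> E `<=` F ->
  (exists2 y, E y & y \is a GRing.unit) ->
  (exists2 r, r \is a GRing.unit & forall y, F y -> A (r * y)) ->
  exists2 n, has_len B E F n & distance (value_set F) (value_set E) = n%:Z.
Proof.
move=> sE sF EF [y0 Ey0 uy0] [r ur Fr].
have [_ _ _ _ [_ [w uw Bw] vnr]] := integral_closure_structure.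
have fac := factor_unit sA uniq_ind mem_ind ut At t_max t_unit noethA frac.
rewrite !value_set_values.
apply: (length_distance sA uniq_ind mem_ind ut At t_max t_inj t_unit noethA frac sB BA vnr
  admissible_general_position residue_field) => //.
- have [|u [d [[uu Au Aui] Ed]]] := fac (y0 * w); first by rewrite unitrM uy0.
  exists d => _ [a Aa ->]; have -> : tpow ind t d * a = w * (u^-1 * a) * y0.
    have -> : w * (u^-1 * a) * y0 = (y0 * w) * u^-1 * a by ring.
    rewrite Ed; have -> : u * tpow ind t d * u^-1 * a = (u / u) * (tpow ind t d * a) by ring.
    by rewrite divrr // mul1r.
  apply: (submodM sE _ Ey0); apply: Bw; exact: (subringM sA Aui Aa).
- have [u [d [[uu Au Aui] Ed]]] := fac r ur.
  exists (fun V => - d V) => y Fy; exists (u^-1 * (r * y)).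
    exact: (subringM sA Aui (Fr y Fy)).
  rewrite tpowN // Ed; have -> : (tpow ind t d)^-1 * (u^-1 * (u * tpow ind t d * y)) =
    (u / u) * (tpow ind t d / tpow ind t d) * y by ring.
  by rewrite !divrr ?tpow_unit // !mul1r.
Qed.

End AdmissibleRing.

(** * The length of a subquotient *)

Lemma up_chain (T : comNzRingType) (A lo hi : set T) n (Y : set T) : up A lo hi n Y ->
  exists c : nat -> set T, [/\ c n = Y,
    (forall i, (i <= n)%N -> [/\ submod_in A (c i), lo `<=` c i & c i `<=` hi]) &
    (forall i, (i < n)%N -> c i `<` c i.+1)].
Proof.
elim=> [X sX loX Xhi|k X Z uX [c [cX cP cS]] sZ XZ Zhi].
  by exists (fun=> X); split.
have [_ loX _] := up_prop uX; have [XZ' _] := XZ.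
exists (fun i => if (i <= k)%N then c i else Z); split; first by rewrite ltnn.
- move=> i _; case: ifP => ik; first exact: cP.
  by split=> //; exact: subset_trans XZ'.
- move=> i; rewrite ltnS => ik; rewrite ik; have [ik'|] := boolP (i < k)%N; first exact: cS.
  by rewrite -leqNgt => ki; have -> : i = k; [by apply/eqP; rewrite eqn_leq ik ki|rewrite cX].
Qed.

Section QuotientLength.
Variable R : comNzRingType.
Local Notation Q := (total_frac R).
Local Notation B := (range (loc_of (regular_mulset R))).

Lemma submod_closed_in (N : set Q) : GRing.submod_closed [in N] <-> submod_in B N.
Proof.
split=> [[N0 NL]|sN].
  have N0' : N 0 by exact: set_mem.
  split=> // [y z Ny Nz|_ z [a _ <-] Nz]; apply: set_mem.
    by rewrite -(scale1r y); apply: NL; exact: mem_set.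
  by rewrite -[_ * _]addr0; apply: (NL a); exact: mem_set.
split; first by apply: mem_set; exact: submod0 sN.
move=> a y z /set_mem Ny /set_mem Nz; apply: mem_set.
by apply: (submodD sN) => //; apply: (submodM sN) => //; exists a.
Qed.

Variables E F : submod Q.
Hypothesis EF : E `<=` F.

Lemma to_quotmod_eq y z : to_quotmod E y = to_quotmod E z <-> (E : set Q) (y - z).
Proof. by split=> [/eqP/quotmod_eqP|H] //; apply/eqP/quotmod_eqP. Qed.

(** The correspondence theorem: images and preimages under the projection exchange strict chains
    between [E] and [F] with strict chains of submodules of the quotient. *)
Lemma mod_length_subquot n : has_len B E F n -> mod_length (subquot F E) = (n%:Z)%:E.
Proof.
move=> [Hle [Y uY]].
have sE : submod_in B E := (submod_closed_in _).1 (submodP E).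
have sF : submod_in B F := (submod_closed_in _).1 (submodP F).
have toZ (a : R) y : to_quotmod E (a *: y) = a *: to_quotmod E y by rewrite -to_quotmodZ.
apply: nat_sup_max.
  have [c [_ cP cS]] := up_chain uY; exists (fun i => to_quotmod E @` c i); split=> i ik.
    have [/submod_closed_in[c0 cL] Ec cF] := cP i ik; split.
      split; first by apply: mem_set; exists 0; [exact: set_mem|rewrite raddf0].
      move=> a _ _ /set_mem[y cy <-] /set_mem[z cz <-]; apply: mem_set.
      exists (a *: y + z); last by rewrite raddfD /= toZ.
      by apply: set_mem; apply: cL; exact: mem_set.
    by move=> _ [y cy <-]; exists y => //; exact: cF.
  have [cc ncc] := cS i ik; have [si Ei _] := cP i (ltnW ik).
  split; first by move=> _ [y cy <-]; exists y => //; exact: cc.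
  move=> H; apply: ncc => y cy.
  have [|z cz /to_quotmod_eq Ezy] := H (to_quotmod E y); first by exists y.
  rewrite -[y](subKr z); apply: (submodB (subring_range _) si cz); exact: Ei.
move=> k [c [cP cS]].
pose D i : set Q := to_quotmod E @^-1` c i.
have sD i : (i <= k)%N -> [/\ submod_in B (D i), E `<=` D i & D i `<=` F].
  move=> ik; have [[c0 cL] cF] := cP i ik; split.
  - apply/submod_closed_in; split.
      by apply: mem_set; rewrite /D /preimage /= raddf0; exact: set_mem.
    move=> a y z /set_mem Dy /set_mem Dz; apply: mem_set.
    rewrite /D /preimage /= raddfD /= toZ; apply: set_mem; apply: cL; exact: mem_set.
  - move=> y Ey; rewrite /D /preimage /=.
    have -> : to_quotmod E y = 0 by rewrite -(raddf0 (to_quotmod E)); apply/to_quotmod_eq;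
      rewrite subr0.
    exact: set_mem.
  - move=> y Dy; have [z Fz /esym/to_quotmod_eq Eyz] := cF _ Dy.
    by rewrite -(subrK z y); apply: (submodD sF) => //; exact: EF.
suff u j : (j <= k)%N -> up B E F j (D j) by exact: Hle (u k (leqnn k)).
elim: j => [|j IH] jk; first by have [? ? ?] := sD 0%N isT; apply: up0.
have [? _ ?] := sD _ jk; apply: (upS (IH (ltnW jk))) => //.
have [cc ncc] := cS j jk; split; first by move=> y; exact: cc.
move=> H; apply: ncc => q cq.
have Eq : q = to_quotmod E (repr q) by rewrite /to_quotmod reprK.
by rewrite Eq; apply: H; rewrite /D /preimage /= -Eq.
Qed.

End QuotientLength.

Theorem proposition4p2p7 (R : comNzRingType) (E F : submod (total_frac R)) :
  admissible R ->
  regular_fractional_ideal E -> regular_fractional_ideal F ->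
  E `<=` F ->
  mod_length (subquot F E) = (distance (value_set F) (value_set E))%:E.
Proof.
move=> adm [_ [y0 [Ey0 /regular_unit uy0]]] [[r rr Fr] _] EF.
have [ind [t [ui mi ut At [tm tj tu vv]]]] := uniformizers adm.
have sE := (submod_closed_in _).1 (submodP E).
have sF := (submod_closed_in _).1 (submodP F).
have [||n Hn ->] := admissible_length adm ui mi ut At tm tj tu vv sE sF EF.
- by exists y0.
- exists (loc_of (regular_mulset R) r); first exact: iota_unit.
  by move=> y /Fr Bry; apply: range_integral.
exact: mod_length_subquot.
Qed.
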